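(* Assume (VD). (a) Let $(\mathcal{E}^{(L)},\mathcal{F}^{(L)})$ be a strongly local regular $p$-energy satisfying $\mathrm{PI}^{(L)}(\Psi)$ and $\mathrm{CE}^{(L)}_{\mathrm{strong}}(\Psi)$ for a doubling function $\Psi$. Let $\Upsilon$ be a doubling function such that $\mathrm{SUG}(\Upsilon,\Psi)$ holds, and let $(\mathcal{E}^{(J,\Upsilon)},\mathcal{F}^{(J,\Upsilon)})$ be a non-local $p$-form associated with $\Upsilon$. Then $(\mathcal{E}^{(J,\Upsilon)},\mathcal{F}^{(J,\Upsilon)})$ is a regular $p$-energy satisfying $\mathrm{CE}^{(J)}_{\mathrm{strong}}(\Upsilon)$. (b) Let $\Psi$ be a doubling function and $(\mathcal{E}^{(J,\Psi)},\mathcal{F}^{(J,\Psi)})$ a non-local $p$-form associated with $\Psi$ which is a regular $p$-energy satisfying $\mathrm{CE}^{(J)}_{\mathrm{strong}}(\Psi)$. Let $\Upsilon$ be a doubling function such that $\mathrm{UG}(\Upsilon,\Psi)$ holds, and let $(\mathcal{E}^{(J,\Upsilon)},\mathcal{F}^{(J,\Upsilon)})$ be a non-local $p$-form associated with $\Upsilon$. Then $(\mathcal{E}^{(J,\Upsilon)},\mathcal{F}^{(J,\Upsilon)})$ is a regular $p$-energy satisfying $\mathrm{CE}^{(J)}_{\mathrm{strong}}(\Upsilon)$.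
   Context: Standing setting. Fix $p\in(1,\infty)$. $(X,d,m)$: $(X,d)$ complete, unbounded, locally compact, separable metric space with all open balls relatively compact; $m$ a positive Radon measure of full support. $B(x,r)$ open ball, $V(x,r)=m(B(x,r))$. The chain condition is assumed: there is $C_{cc}>0$ such that any $x,y$ and $n\ge1$ admit $x_0=x,\dots,x_n=y$ with $d(x_k,x_{k-1})\le C_{cc}d(x,y)/n$. (VD): $V(x,2r)\le C_{VD}V(x,r)$ for all $x,r$. The support of $f$ is the support of $|f|dm$; $u_A$ denotes the $m$-average of $u$ over $A$. Doubling function: a homeomorphism $\Psi:[0,\infty)\to[0,\infty)$ with $\Psi(2r)\le C_\Psi\Psi(r)$ and $C_\Psi^{-1}(R/r)^{\beta^{(1)}_\Psi}\le\Psi(R)/\Psi(r)\le C_\Psi(R/r)^{\beta^{(2)}_\Psi}$ for $0<r\le R$, for some $C_\Psi>1$, $0<\beta^{(1)}_\Psi\le\beta^{(2)}_\Psi$. $\mathrm{SUG}(\Upsilon,\Psi)$: there is an increasing $\Theta:[0,1]\to[0,\infty)$ with $\Theta(1)\ge1$ and $\sum_{n\ge0}\Theta(2^{-n})<\infty$ such that $\frac{\Upsilon(R)}{\Upsilon(r)}\le\Theta(\frac rR)\frac{\Psi(R)}{\Psi(r)}$ for all $0<r\le R$. $\mathrm{UG}(\Upsilon,\Psi)$: there is $C\ge1$ with $\frac{\Upsilon(R)}{\Upsilon(r)}\le C\frac{\Psi(R)}{\Psi(r)}$ for all $0<r\le R$. Cutoff function for $U\subseteq V$ ($U,V$ open,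 $\overline U\subseteq V$): measurable $\phi$, $0\le\phi\le1$ a.e., $\phi=1$ a.e. near $\overline U$, $\mathrm{supp}\,\phi\subseteq V$. $p$-form: linear $\mathcal F\subseteq L^p$, $\mathcal E\ge0$ with $\mathcal E^{1/p}$ a seminorm; $\mathcal E_1=\mathcal E+\|\cdot\|_{L^p}^p$. $p$-energy: additionally $\mathcal F$ dense in $L^p$, $(\mathcal F,\mathcal E_1^{1/p})$ Banach, Markovian ($\varphi(f)\in\mathcal F$, $\mathcal E(\varphi(f))\le\mathcal E(f)$ for $1$-Lipschitz $\varphi$ with $\varphi(0)=0$), and $p$-Clarkson inequality. Strongly local: $\mathcal E(f+g)=\mathcal E(f)+\mathcal E(g)$ for compactly supported $f,g\in\mathcal F$ with $g$ constant near $\mathrm{supp} f$. Regular: $\mathcal F\cap C_c(X)$ uniformly dense in $C_c(X)$ and $\mathcal E_1^{1/p}$-dense in $\mathcal F$. Local energy measure: for a strongly local regular $p$-energy, the canonical $p$-energy measure $\Gamma^{(L)}(f)$, a positive Radon measure with total mass $\mathcal E^{(L)}(f)$ (local, satisfying the chain rule $d\Gamma^{(L)}(\varphi(f))=|\varphi'(f)|^pd\Gamma^{(L)}(f)$). $\mathrm{PI}^{(L)}(\Psi)$: there are $C_{PI}>0$, $A_{PI}\ge1$ with $\int_{B(x,r)}|f-f_{B(x,r)}|^pdm\le C_{PI}\Psi(r)\Gamma^{(L)}(f)(B(x,A_{PI}r))$ for all balls and $f\in\mathcal F^{(L)}$. Non-local $p$-form associated with a doubling $\Upsilon$: $K^{(J,\Upsilon)}$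 symmetric on $X\times X\setminus\mathrm{diag}$ with $\frac{C_1}{V(x,d(x,y))\Upsilon(d(x,y))}\le K^{(J,\Upsilon)}(x,y)\le\frac{C_2}{V(x,d(x,y))\Upsilon(d(x,y))}$; $\mathcal E^{(J,\Upsilon)}(u)=\iint|u(x)-u(y)|^pK^{(J,\Upsilon)}\,dm\,dm$, $\mathcal F^{(J,\Upsilon)}=\{u\in L^p:\mathcal E^{(J,\Upsilon)}(u)<\infty\}$; $\Gamma^{(J,\Upsilon)}_X(u)(dx)=(\int_X|u(x)-u(y)|^pK^{(J,\Upsilon)}(x,y)m(dy))m(dx)$. $\mathrm{CE}^{(\bullet)}_{\mathrm{strong}}(\Phi)$ (for $\bullet=L$ with $\Gamma=\Gamma^{(L)}$, or $\bullet=J$ with the non-local form associated with $\Phi$ and $\Gamma=\Gamma^{(J,\Phi)}_X$): there are $\delta\in(0,1)$, $A_E>1$, $C>0$ such that for every ball $B(x_0,r)$ there is a cutoff function $\phi$ in the domain for $B(x_0,r)\subseteq B(x_0,A_Er)$ with (i) $|\phi(x)-\phi(y)|\le C(\frac{d(x,y)}r\wedge1)^\delta$ for all $x,y\in X$ and (ii) $\Gamma(\phi)(B(x,s))\le C(\frac sr\wedge1)^\delta\frac{V(x,s)}{\Phi(s\wedge r)}$ for all $x\in X$, $s>0$. *)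

(* Defs.v *)
From HB Require Import structures.
From mathcomp Require Import all_boot all_order all_algebra.
From mathcomp Require Import all_classical all_reals all_analysis.
Set Implicit Arguments. Unset Strict Implicit. Unset Printing Implicit Defensive.
Import Order.TTheory GRing.Theory Num.Theory.
Local Open Scope classical_set_scope.
Local Open Scope ring_scope.

Section MetricMeasure.
Context {R : realType} {d0 : measure_display} {X : measurableType d0}.
Variable dist : X -> X -> R.

Definition dball (x : X) (r : R) : set X := [set y | dist x y < r].
Definition dopen (U : set X) : Prop :=
  forall x, U x -> exists r, 0 < r /\ dball x r `<=` U.
Definition dclosure (A : set X) : set X :=
  [set x | forall e, 0 < e -> exists a, A a /\ dist x a < e].
Definition dcompact (K : set X) : Prop :=
  forall (I : Type) (U : I -> set X), (forall i, dopen (U i)) ->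
    K `<=` \bigcup_i U i ->
    exists F : set I, finite_set F /\ K `<=` \bigcup_(i in F) U i.
Definition dcontinuous (f : X -> R) : Prop :=
  forall x e, 0 < e -> exists del, 0 < del /\
    forall y, dist x y < del -> `|f x - f y| < e.

Definition is_metric : Prop :=
  (forall x y, 0 <= dist x y) /\ (forall x y, dist x y = 0 <-> x = y) /\
  (forall x y, dist x y = dist y x) /\
  (forall x y z, dist x z <= dist x y + dist y z).
Definition dcomplete : Prop :=
  forall u : nat -> X,
    (forall e, 0 < e -> exists N, forall n k, (N <= n)%N -> (N <= k)%N ->
       dist (u n) (u k) < e) ->
    exists x, forall e, 0 < e -> exists N, forall n, (N <= n)%N -> dist (u n) x < e.
Definition dunbounded : Prop := forall M, exists x y, M < dist x y.
Definition dlocally_compact : Prop :=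
  forall x, exists U, dopen U /\ U x /\ dcompact (dclosure U).
Definition dseparable : Prop :=
  exists D : set X, countable D /\
    forall x e, 0 < e -> exists y, D y /\ dist x y < e.
Definition balls_relatively_compact : Prop :=
  forall x r, dcompact (dclosure (dball x r)).
Definition borel_sigma : Prop :=
  forall A : set X, measurable A <-> <<s dopen >> A.

(** positive Radon measure: on a locally compact separable metric space, a
    Borel measure finite on compact sets is Radon *)
Definition radon (mu : {measure set X -> \bar R}) : Prop :=
  forall K, dcompact K -> (mu K < +oo)%E.

Definition chain_condition : Prop :=
  exists Ccc, 0 < Ccc /\ forall x y (n : nat), (1 <= n)%N ->
    exists c : nat -> X, c 0%N = x /\ c n = y /\
      forall k, (1 <= k <= n)%N -> dist (c k) (c k.-1) <= Ccc * dist x y / n%:R.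

Variable m : {measure set X -> \bar R}.

Definition standing_setting : Prop :=
  is_metric /\ dcomplete /\ dunbounded /\ dlocally_compact /\ dseparable /\
  balls_relatively_compact /\ borel_sigma /\ radon m /\
  (forall x r, 0 < r -> (0 < m (dball x r))%E) /\ chain_condition.

Definition vol (x : X) (r : R) : R := fine (m (dball x r)).

Definition VD : Prop :=
  exists CVD, forall x r, 0 < r -> vol x (2 * r) <= CVD * vol x r.

(** support of f := support of the measure |f| dm *)
Definition dsupp (f : X -> R) : set X :=
  [set x | forall r, 0 < r -> (0 < m (dball x r `&` [set y | (f y != 0)%R]))%E].

Definition Cc (f : X -> R) : Prop :=
  dcontinuous f /\ dcompact (dclosure [set x | f x != 0]).

Definition average (f : X -> R) (A : set X) : R :=
  fine (\int[m]_(x in A) (f x)%:E)%E / fine (m A).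

Variable p : R.

Definition Lp_fun (f : X -> R) : Prop :=
  measurable_fun setT f /\ (\int[m]_x ((`|f x| `^ p)%:E) < +oo)%E.
Definition Lp_pow (f : X -> R) : R := fine (\int[m]_x ((`|f x| `^ p)%:E))%E.

(** ** p-forms and p-energies; [F] is a set of functions closed under
    a.e. equality and [E] is invariant under a.e. equality (L^p classes) *)
Definition is_pform (F : set (X -> R)) (E : (X -> R) -> R) : Prop :=
  (forall f, F f -> Lp_fun f) /\
  F (fun _ => 0) /\
  (forall f g, F f -> F g -> F (fun x => f x + g x)) /\
  (forall (a : R) f, F f -> F (fun x => a * f x)) /\
  (forall f g, F f -> measurable_fun setT g -> {ae m, forall x, f x = g x} ->
     F g /\ E g = E f) /\
  (forall f, F f -> 0 <= E f) /\
  (forall (a : R) f, F f -> E (fun x => a * f x) = `|a| `^ p * E f) /\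
  (forall f g, F f -> F g ->
     E (fun x => f x + g x) `^ p^-1 <= E f `^ p^-1 + E g `^ p^-1).

Definition E1 (E : (X -> R) -> R) (f : X -> R) : R := E f + Lp_pow f.

Definition clarkson (F : set (X -> R)) (E : (X -> R) -> R) : Prop :=
  forall f g, F f -> F g ->
  let s := E (fun x => f x + g x) in
  let d := E (fun x => f x - g x) in
  let q := (p - 1)^-1 in
  (p <= 2 ->
     s `^ q + d `^ q <= 2 * (E f + E g) `^ q /\
     2 * (E f `^ q + E g `^ q) `^ (p - 1) <= s + d) /\
  (2 <= p ->
     s + d <= 2 * (E f `^ q + E g `^ q) `^ (p - 1) /\
     2 * (E f + E g) `^ q <= s `^ q + d `^ q).

Definition is_penergy (F : set (X -> R)) (E : (X -> R) -> R) : Prop :=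
  is_pform F E /\
  (forall f, Lp_fun f -> forall e, 0 < e ->
     exists g, F g /\ Lp_pow (fun x => f x - g x) < e) /\
  (forall u : nat -> X -> R, (forall n, F (u n)) ->
     (forall e, 0 < e -> exists N, forall n k, (N <= n)%N -> (N <= k)%N ->
        E1 E (fun x => u n x - u k x) < e) ->
     exists v, F v /\ forall e, 0 < e -> exists N, forall n, (N <= n)%N ->
        E1 E (fun x => u n x - v x) < e) /\
  (forall phi : R -> R, phi 0 = 0 -> (forall s t, `|phi s - phi t| <= `|s - t|) ->
     forall f, F f -> F (phi \o f) /\ E (phi \o f) <= E f) /\
  clarkson F E.

Definition strongly_local (F : set (X -> R)) (E : (X -> R) -> R) : Prop :=
  forall f g, F f -> F g -> dcompact (dsupp f) -> dcompact (dsupp g) ->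
    (exists (a : R) (U : set X), dopen U /\ dsupp f `<=` U /\
        {ae m, forall x, U x -> g x = a}) ->
    E (fun x => f x + g x) = E f + E g.

Definition is_regular (F : set (X -> R)) (E : (X -> R) -> R) : Prop :=
  (forall f, Cc f -> forall e, 0 < e ->
     exists g, F g /\ Cc g /\ forall x, `|f x - g x| <= e) /\
  (forall f, F f -> forall e, 0 < e ->
     exists g, F g /\ Cc g /\ E1 E (fun x => f x - g x) < e).

Definition is_regular_penergy F E : Prop := is_penergy F E /\ is_regular F E.

Definition Ederiv (E : (X -> R) -> R) (f g : X -> R) : R :=
  p^-1 * derive1 (fun t : R => E (fun x => f x + t * g x)) 0.

Definition is_canonical_energy_measure (F : set (X -> R)) (E : (X -> R) -> R)
    (Gam : (X -> R) -> {measure set X -> \bar R}) : Prop :=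
  (forall f, F f -> radon (Gam f)) /\
  (forall f, F f -> Gam f setT = (E f)%:E) /\
  (forall f g A, F f -> F g -> measurable A ->
     `|fine (Gam f A) `^ p^-1 - fine (Gam g A) `^ p^-1|
       <= E (fun x => f x - g x) `^ p^-1) /\
  (forall f g, F f -> (exists M, {ae m, forall x, `|f x| <= M}) -> F g -> Cc g ->
     let fg := fun x => f x * g x in
     let h := fun x => `|f x| `^ (p / (p - 1)) in
     derivable (fun t : R => E (fun x => f x + t * fg x)) 0 1 /\
     derivable (fun t : R => E (fun x => h x + t * g x)) 0 1 /\
     (\int[Gam f]_x (g x)%:E =
       (Ederiv E f fg - ((p - 1) / p) `^ (p - 1) * Ederiv E h g)%:E)%E).

Definition cutoff (U V : set X) (phi : X -> R) : Prop :=
  measurable_fun setT phi /\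
  {ae m, forall x, 0 <= phi x <= 1} /\
  (exists W, dopen W /\ dclosure U `<=` W /\ {ae m, forall x, W x -> phi x = 1}) /\
  dsupp phi `<=` V.

Definition PI_L (F : set (X -> R)) (Gam : (X -> R) -> {measure set X -> \bar R})
    (Psi : R -> R) : Prop :=
  exists CPI API, 0 < CPI /\ 1 <= API /\
    forall x r f, 0 < r -> F f ->
      (\int[m]_(y in dball x r) ((`|f y - average f (dball x r)| `^ p)%:E)
        <= (CPI * Psi r)%:E * Gam f (dball x (API * r)))%E.

(** [Gam f A] is the energy measure of [f] evaluated on [A] *)
Definition CE_strong (F : set (X -> R)) (Gam : (X -> R) -> set X -> \bar R)
    (Phi : R -> R) : Prop :=
  exists del AE C, 0 < del < 1 /\ 1 < AE /\ 0 < C /\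
    forall x0 r, 0 < r -> exists phi,
      F phi /\ cutoff (dball x0 r) (dball x0 (AE * r)) phi /\
      (forall x y, `|phi x - phi y| <= C * (Num.min (dist x y / r) 1) `^ del) /\
      (forall x s, 0 < s ->
         (Gam phi (dball x s)
           <= (C * (Num.min (s / r) 1) `^ del * vol x s / Phi (Num.min s r))%:E)%E).

Definition jump_kernel (Ups : R -> R) (K : X -> X -> R) : Prop :=
  measurable_fun setT (fun z : X * X => K z.1 z.2) /\
  exists C1 C2, 0 < C1 /\ 0 < C2 /\
    forall x y, x <> y ->
      K x y = K y x /\
      C1 / (vol x (dist x y) * Ups (dist x y)) <= K x y /\
      K x y <= C2 / (vol x (dist x y) * Ups (dist x y)).

Definition GammaJ (K : X -> X -> R) (u : X -> R) (A : set X) : \bar R :=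
  (\int[m]_(x in A) \int[m]_y ((`|u x - u y| `^ p * K x y)%:E))%E.
Definition EJ (K : X -> X -> R) (u : X -> R) : R := fine (GammaJ K u setT).
Definition FJ (K : X -> X -> R) : set (X -> R) :=
  [set u | Lp_fun u /\ (GammaJ K u setT < +oo)%E].

End MetricMeasure.

Section Scale.
Context {R : realType}.

Definition homeo_nonneg (Psi : R -> R) : Prop :=
  exists Psiinv : R -> R,
    (forall r, 0 <= r -> 0 <= Psi r /\ 0 <= Psiinv r /\
                         Psiinv (Psi r) = r /\ Psi (Psiinv r) = r) /\
    (forall x e, 0 <= x -> 0 < e -> exists del, 0 < del /\ forall y, 0 <= y ->
        `|x - y| < del -> `|Psi x - Psi y| < e /\ `|Psiinv x - Psiinv y| < e).

Definition doubling_fun (Psi : R -> R) : Prop :=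
  homeo_nonneg Psi /\
  exists CPsi b1 b2, 1 < CPsi /\ 0 < b1 <= b2 /\
    (forall r, 0 <= r -> Psi (2 * r) <= CPsi * Psi r) /\
    (forall r Rr, 0 < r -> r <= Rr ->
       CPsi^-1 * (Rr / r) `^ b1 <= Psi Rr / Psi r /\
       Psi Rr / Psi r <= CPsi * (Rr / r) `^ b2).

Definition SUG (Ups Psi : R -> R) : Prop :=
  exists Theta : R -> R,
    (forall s t, 0 <= s -> s <= t -> t <= 1 -> Theta s <= Theta t) /\
    (forall t, 0 <= t <= 1 -> 0 <= Theta t) /\
    1 <= Theta 1 /\
    (exists M, forall N, \sum_(0 <= n < N) Theta (2 ^- n) <= M) /\
    (forall r Rr, 0 < r -> r <= Rr ->
       Ups Rr / Ups r <= Theta (r / Rr) * (Psi Rr / Psi r)).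

Definition UG (Ups Psi : R -> R) : Prop :=
  exists C, 1 <= C /\ forall r Rr, 0 < r -> r <= Rr ->
    Ups Rr / Ups r <= C * (Psi Rr / Psi r).

End Scale.

(* Main.v *)
(* The jump density |u(x) - u(y)|^p K(x,y) on X x X is the p-th power of the norm of
   a function that depends linearly on u, so the p-form axioms, Clarkson's inequality
   and completeness are inherited from L^p(X x X); only density needs an argument.
   Cut the pairs at d(x,y) = t. The far jumps are controlled by the L^p norm, or by
   the Hoelder bound of a cutoff function. The near jumps are controlled by
   (Psi(t)/Ups(t)) times the given energy measure of a neighbourhood: in (b) because
   the kernels compare pointwise there, in (a) by applying the Poincare inequality to
   the dyadic annuli 2^(-n-1) t < d(x,y) <= 2^(-n) t, whose contributions are summable
   by SUG. Hence the given domain is contained in the non-local one and its cutoff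
   functions satisfy the cutoff condition for the non-local form.
   For the density of compactly supported continuous functions in the energy norm,
   take an e-net with bounded overlap and cutoff functions of its balls, and paint
   successively suitable values a_i of f with these cutoff functions. The error
   is bounded by the energy of the jumps of f of length O(e), plus the L^p mass of f
   on the balls not yet painted. *)
Require Import Defs.
From HB Require Import structures.
From mathcomp Require Import all_boot all_order all_algebra.
From mathcomp Require Import all_classical all_reals all_analysis.
From mathcomp Require Import measurable_realfun ring lra.
Import Order.TTheory GRing.Theory Num.Theory.
Import numFieldNormedType.Exports.
Local Open Scope classical_set_scope.
Local Open Scope ring_scope.
Set Implicit Arguments. Unset Strict Implicit. Unset Printing Implicit Defensive.

(** * Clarkson's inequality and completeness of L^p *)

Section power_inequalities.
Context {R : realType}.
Implicit Types a b p x : R.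

(** The obstacle is the factor [1 / U e]. An approximant built at mesh [e] has jumps of its own at
    that scale, weighted by [1 / U e], which blows up as [e] tends to 0; closeness in [L^p]
    therefore gives no control of the energy. What saves the estimate is that the oscillation of [f]
    around well-chosen values is bounded by [U e] times the energy of its jumps of length O(e), and
    this energy tends to 0 because [f] has finite energy. The mass of the cells left unpainted
    carries no factor [U e]. Hence the mesh is fixed first, and the number of layers only
    afterwards, in terms of [U e]. This number is finite because the approximant must have compact
    support. Overpainting needs no normalising sum, and each layer touches only boundedly many
    cells. The argument uses the energy of cutoff functions for the non-local form itself, so the
    cutoff condition is transferred before regularity is proved. In that transfer the Hoelder
    exponent has to be lowered below the lower growth exponent of [Ups], so that the weighted far
    jumps remain integrable. *)

Lemma le_powR2 p a b : 0 <= p -> 0 <= a -> a <= b -> a `^ p <= b `^ p.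
Proof.
by move=> p0 a0 ab; apply: ge0_ler_powR => //; rewrite nnegrE// (le_trans a0).
Qed.

Lemma powR_powRV p a : p != 0 -> 0 <= a -> (a `^ p) `^ p^-1 = a.
Proof. by move=> p0 a0; rewrite -powRrM divff// powRr1. Qed.

Lemma powRV_powR p a : p != 0 -> 0 <= a -> (a `^ p^-1) `^ p = a.
Proof. by move=> p0 a0; rewrite -powRrM mulVf// powRr1. Qed.

Lemma powR_convex2 p t a b : 1 <= p -> 0 <= t <= 1 ->
  `|(1 - t) * a + t * b| `^ p <= (1 - t) * `|a| `^ p + t * `|b| `^ p.
Proof.
move=> p1 /andP[t0 t1].
have p0 : 0 <= p by rewrite (le_trans _ p1).
have s0 : 0 <= 1 - t by rewrite subr_ge0.
apply: (@le_trans _ _ (((1 - t) * `|a| + t * `|b|) `^ p)).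
  apply: le_powR2 => //; apply: le_trans (ler_normD _ _) _.
  by rewrite !normrM (ger0_norm s0) (ger0_norm t0).
have := convex_powR p1 (Itv01 t0 t1) (x := `|b|) (y := `|a|).
rewrite !inE /= !in_itv /= !normr_ge0 => /(_ isT isT).
by rewrite addrC [leRHS]addrC.
Qed.

Lemma powR_normD_le p a b : 1 <= p ->
  `|a + b| `^ p <= 2 `^ p * (`|a| `^ p + `|b| `^ p).
Proof.
move=> p1; have p0 : 0 <= p by rewrite (le_trans _ p1).
have : `|a + b| <= 2 * Num.max `|a| `|b|.
  apply: le_trans (ler_normD _ _) _.
  by rewrite mulr2n mulrDl !mul1r lerD// ?le_max ?lexx ?orbT.
move=> /(le_powR2 p0 (normr_ge0 _)) /le_trans; apply.
rewrite powRM ?le_max ?normr_ge0// ler_wpM2l ?powR_ge0//.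
by case: (leP `|a| `|b|) => _; rewrite ?lerDl ?lerDr powR_ge0.
Qed.

(** A crude power-mean inequality: the sum has at most [k] terms, hence is at most [k] times its
    largest term, whose power occurs on the right. *)
Lemma sum_powR_le p n (b : nat -> R) (s : pred nat) (k : R) : 1 <= p -> 0 <= k ->
  (forall i, 0 <= b i) -> \sum_(i < n | s i) 1 <= k ->
  (\sum_(i < n | s i) b i) `^ p <= k `^ p * \sum_(i < n | s i) b i `^ p.
Proof.
move=> p1 k0 b0 sk; have p0 : 0 <= p by rewrite (le_trans _ p1).
have [[i0 si0]|N] := pselect (exists i : 'I_n, s i); last first.
  rewrite !big_pred0 ?mulr0 ?powR0 ?gt_eqF ?(lt_le_trans _ p1)// => i;
    by apply/negP => si; apply: N; exists i.
pose j := [arg max_(i > i0 | s i) b i]%O.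
have [sj jmax] : s j /\ forall i : 'I_n, s i -> b i <= b j.
  by rewrite /j; case: arg_maxP => // i si H; split.
apply: (@le_trans _ _ ((k * b j) `^ p)).
  apply: le_powR2 => //; first exact: sumr_ge0.
  apply: (@le_trans _ _ (\sum_(i < n | s i) 1 * b j)).
    by apply: ler_sum => i si; rewrite mul1r jmax.
  by rewrite -mulr_suml ler_wpM2r.
rewrite powRM// ler_wpM2l ?powR_ge0// (bigD1 j)//= lerDl.
by apply: sumr_ge0 => i _; exact: powR_ge0.
Qed.

End power_inequalities.

Section clarkson_pointwise.
Context {R : realType}.
Implicit Types a b p x : R.

(* The function [f] interpolates between both sides of the inequality:
   [f (x `^ (p / (p - 1) - 1))] is the left-hand side, [f 1] the right-hand side. *)
Lemma clarkson_unit p x : 1 < p <= 2 -> 0 < x < 1 ->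
  2 * (1 + x `^ (p / (p - 1))) `^ (p - 1) <= (1 + x) `^ p + (1 - x) `^ p.
Proof.
move=> /andP[p1 p2] /andP[x0 x1].
have p0 : 0 < p by rewrite (lt_trans _ p1).
have pm0 : 0 < p - 1 by rewrite subr_gt0.
pose f (t : R) := (1 + t `^ (1 - p) * x) * (1 + t * x) `^ (p - 1) +
                  (1 - t `^ (1 - p) * x) * (1 - t * x) `^ (p - 1).
pose t0 := x `^ (p / (p - 1) - 1).
have qE : p / (p - 1) - 1 = (p - 1)^-1.
  by rewrite -{2}(@divff _ (p - 1)) ?gt_eqF// -mulrBl opprB addrC subrK mul1r.
have t0_gt0 : 0 < t0 by rewrite powR_gt0.
have t01 : t0 <= 1.
  have -> : 1 = 1 `^ (p / (p - 1) - 1) :> R by rewrite powR1.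
  by apply: le_powR2; [rewrite qE invr_ge0 ltW|exact: ltW|exact: ltW].
have ft0 : f t0 = 2 * (1 + x `^ (p / (p - 1))) `^ (p - 1).
  rewrite /f.
  have -> : t0 `^ (1 - p) = x^-1.
    rewrite /t0 -powRrM qE -(opprB p 1) mulrN mulVf ?gt_eqF//.
    by rewrite powR_inv1// ltW.
  have tx : t0 * x = x `^ (p / (p - 1)).
    by rewrite mulrC mulr_powRB1 ?ltW// divr_gt0.
  by rewrite mulVf ?gt_eqF// subrr mul0r addr0 tx.
have f1 : f 1 = (1 + x) `^ p + (1 - x) `^ p.
  by rewrite /f powR1/= !mul1r !mulr_powRB1// ?subr_ge0 ?addr_ge0// ltW.
rewrite -ft0 -f1.
have pos1 t : t \in `[t0, 1] -> [/\ 0 < t, t <= 1, 0 < 1 + t * x & 0 < 1 - t * x].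
  rewrite in_itv /= => /andP[/(lt_le_trans t0_gt0) t_gt0 t_le1].
  split => //; first by rewrite addr_gt0// mulr_gt0.
  by rewrite subr_gt0 (le_lt_trans _ x1)// ger_pMl.
have df t : t \in `[t0, 1] -> is_derive t 1 f
   ((p - 1) * x * (1 - t `^ (- p)) *
     ((1 + t * x) `^ (p - 2) - (1 - t * x) `^ (p - 2))).
  move=> /pos1[t_gt0 t_le1 A0 B0].
  have D1 : is_derive t 1 (fun t : R => t `^ (1 - p)) ((1 - p) * t `^ (- p)).
    have -> : t `^ (- p) = t `^ (1 - p - 1) by rewrite addrAC subrr sub0r.
    exact: is_derive1_powR.
  have D2 : is_derive t 1 (fun t : R => 1 + t * x) x.
    by apply: is_derive_eq; rewrite /GRing.scale/=; ring.
  have D3 : is_derive t 1 (fun t : R => 1 - t * x) (- x).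
    by apply: is_derive_eq; rewrite /GRing.scale/=; ring.
  have pm2 : p - 2 = p - 1 - 1 by rewrite -addrA -opprD.
  have D4 : is_derive t 1 (fun t : R => (1 + t * x) `^ (p - 1))
              ((p - 1) * (1 + t * x) `^ (p - 2) * x).
    rewrite pm2; exact: (@is_derive1_comp _ (fun s : R => s `^ (p - 1)) (fun t : R => 1 + t * x)
      _ _ _ (is_derive1_powR (p - 1) A0) D2).
  have D5 : is_derive t 1 (fun t : R => (1 - t * x) `^ (p - 1))
              ((p - 1) * (1 - t * x) `^ (p - 2) * - x).
    rewrite pm2; exact: (@is_derive1_comp _ (fun s : R => s `^ (p - 1)) (fun t : R => 1 - t * x)
      _ _ _ (is_derive1_powR (p - 1) B0) D3).
  apply: is_derive_eq.
  rewrite /GRing.scale/=.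
  have -> : (1 + t * x) `^ (p - 1) = (1 + t * x) * (1 + t * x) `^ (p - 2).
    by rewrite pm2 mulr_powRB1// ltW.
  have -> : (1 - t * x) `^ (p - 1) = (1 - t * x) * (1 - t * x) `^ (p - 2).
    by rewrite pm2 mulr_powRB1// ltW.
  have -> : t `^ (1 - p) = t * t `^ (- p).
    rewrite powRD; first by rewrite powRr1// ltW.
    by rewrite (gt_eqF t_gt0) implybT.
  ring.
have cf : {within `[t0, 1], continuous f}.
  apply: derivable_within_continuous => t tt; exact: (@ex_derive _ _ _ _ _ _ _ (df t tt)).
have sub t : t \in `]t0, 1[ -> t \in `[t0, 1].
  by rewrite !in_itv/= => /andP[/ltW -> /ltW ->].
apply: (ger0_derive1_ndecr (a := t0) (b := 1)) => //.
  move=> t /sub tt; exact: (@ex_derive _ _ _ _ _ _ _ (df t tt)).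
move=> t /sub tt; have [t_gt0 t_le1 A0 B0] := pos1 _ tt.
rewrite derive1E (@derive_val _ _ _ _ _ _ _ (df t tt)).
rewrite -mulrA; apply: mulr_ge0; first by apply: mulr_ge0; exact: ltW.
(* Both factors are nonpositive: [t <= 1] makes [t ^ (-p)] at least 1, and [p <= 2] makes the power
   [p - 2] nonincreasing. *)
apply: mulr_le0; rewrite subr_le0.
  rewrite powRN invf_ge1 ?powR_gt0//.
  by have := le_powR2 (ltW p0) (ltW t_gt0) t_le1; rewrite powR1.
have -> : p - 2 = - (2 - p) by rewrite opprB.
rewrite !powRN lef_pV2 ?posrE ?powR_gt0//.
apply: le_powR2; [by rewrite subr_ge0|exact: ltW|].
by rewrite lerD2l (@le_trans _ _ 0)// ?oppr_le0 mulr_ge0// ltW.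
Qed.

(** Both sides are symmetric, depend only on the absolute values and are homogeneous of degree [p],
    so the ratio [x = b / a] in [0, 1] decides. The endpoints 0 and 1 are computed directly, the
    interior is [clarkson_unit]. *)
Lemma clarkson_pointwise_le2 p a b : 1 < p <= 2 ->
  2 * (`|a| `^ (p / (p - 1)) + `|b| `^ (p / (p - 1))) `^ (p - 1) <=
  `|a + b| `^ p + `|a - b| `^ p.
Proof.
move=> p12; have /andP[p1 p2] := p12.
have p0 : 0 < p by rewrite (lt_trans _ p1).
have pm0 : 0 < p - 1 by rewrite subr_gt0.
have q0 : 0 < p / (p - 1) by rewrite divr_gt0.
wlog ab : a b / `|b| <= `|a|.
  move=> H; have /orP[|ba] := le_total `|b| `|a|; first exact: H.
  by have := H b a ba; rewrite (addrC b a) (distrC b a) (addrC (`|b| `^ _)).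
wlog [a0 b0] : a b ab / 0 <= a /\ 0 <= b.
  move=> H; have := H `|a| `|b|; rewrite !normr_id => /(_ ab (conj (normr_ge0 _) (normr_ge0 _))).
  suff -> : `| `|a| + `|b| | `^ p + `| `|a| - `|b| | `^ p =
            `|a + b| `^ p + `|a - b| `^ p by [].
  have [a0|a0] := leP 0 a; have [b0|b0] := leP 0 b;
    rewrite ?(ger0_norm a0) ?(ger0_norm b0) ?(ltr0_norm a0) ?(ltr0_norm b0) ?opprK //.
  - by rewrite addrC.
  - by rewrite (addrC (- a)) (distrC b a) (addrC (`|a - b| `^ _)) -opprD normrN addrC (addrC a).
  - by rewrite -opprD normrN (addrC (- a)) (distrC b a).
have [a00|a_neq0] := eqVneq a 0.
  move: ab; rewrite a00 normr0 normr_le0 => /eqP ->.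
  by rewrite subr0 addr0 normr0 !powR0 ?gt_eqF// addr0 powR0 ?gt_eqF// mulr0 addr0.
have a_gt0 : 0 < a by rewrite lt_def a_neq0.
rewrite !ger0_norm// in ab.
rewrite !ger0_norm ?subr_ge0 ?addr_ge0//.
have main : 2 * (1 + (b / a) `^ (p / (p - 1))) `^ (p - 1) <=
            (1 + b / a) `^ p + (1 - b / a) `^ p.
  have [ba1|ba1] := eqVneq (b / a) 1.
    rewrite ba1 powR1 subrr powR0 ?gt_eqF// addr0.
    by rewrite mulr_powRB1 ?addr_ge0.
  have [b00|b_neq0] := eqVneq b 0.
    by rewrite b00 mul0r powR0 ?gt_eqF// subr0 addr0 !powR1 mulr1.
  apply: clarkson_unit => //; apply/andP; split.
    by rewrite divr_gt0// lt_def b_neq0.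
  by rewrite lt_neqAle ba1/= ler_pdivrMr// mul1r.
have := ler_wpM2l (powR_ge0 a p) main.
have E c : 0 <= c -> 0 <= 1 + c / a.
  by move=> c0; rewrite addr_ge0// divr_ge0// ltW.
have -> : a `^ p * (2 * (1 + (b / a) `^ (p / (p - 1))) `^ (p - 1)) =
   2 * (a `^ (p / (p - 1)) + b `^ (p / (p - 1))) `^ (p - 1).
  rewrite mulrCA; congr (2 * _).
  have -> : a `^ p = (a `^ (p / (p - 1))) `^ (p - 1).
    by rewrite -powRrM divfK// gt_eqF.
  rewrite -powRM ?addr_ge0 ?powR_ge0//.
  have ba : a * (b / a) = b by rewrite mulrC divfK.
  by rewrite mulrDr mulr1 -(powRM _ a0 (divr_ge0 b0 a0)) ba.
have ba : a * (b / a) = b by rewrite mulrC divfK.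
rewrite mulrDr -!powRM ?E ?subr_ge0 ?ler_pdivrMr ?mul1r//.
by rewrite mulrDr mulrBr mulr1 ba.
Qed.

(* Duality: apply the case of the conjugate exponent to [(a + b, a - b)]. *)
Lemma clarkson_pointwise_ge2 p a b : 2 <= p ->
  `|a + b| `^ p + `|a - b| `^ p <=
  2 * (`|a| `^ (p / (p - 1)) + `|b| `^ (p / (p - 1))) `^ (p - 1).
Proof.
move=> p2; have p1 : 1 < p by rewrite (lt_le_trans _ p2)// ltr1n.
have p0 : 0 < p by rewrite (lt_trans _ p1).
have pm0 : 0 < p - 1 by rewrite subr_gt0.
set q := p / (p - 1).
have qm1 : q - 1 = (p - 1)^-1.
  by rewrite /q -{2}(@divff _ (p - 1)) ?gt_eqF// -mulrBl opprB addrC subrK mul1r.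
have qm1_gt0 : 0 < q - 1 by rewrite qm1 invr_gt0.
have qp : q / (q - 1) = p by rewrite qm1 invrK divfK// gt_eqF.
have q12 : 1 < q <= 2.
  rewrite -subr_gt0 qm1_gt0/= -(@lerD2r _ (- 1)) qm1.
  have -> : 2 - 1 = 1 :> R by ring.
  by rewrite invf_le1//; lra.
have := @clarkson_pointwise_le2 _ (a + b) (a - b) q12.
rewrite qp.
have -> : a + b + (a - b) = 2 * a by ring.
have -> : a + b - (a - b) = 2 * b by ring.
rewrite !normrM (ger0_norm (_ : 0 <= 2))// !(powRM q (_ : 0 <= 2))// -mulrDr.
set s := `|a + b| `^ p + _; set t := `|a| `^ q + _ => H.
have s0 : 0 <= s by rewrite addr_ge0// powR_ge0.
have t0 : 0 <= t by rewrite addr_ge0// powR_ge0.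
have := le_powR2 (ltW pm0) (mulr_ge0 (ler0n R 2) (powR_ge0 _ _)) H.
rewrite powRM ?powR_ge0// powRM ?powR_ge0// -!powRrM qm1 mulVf ?gt_eqF// powRr1//.
rewrite /q divfK ?gt_eqF//.
have -> : 2 `^ p = 2 `^ (p - 1) * 2 :> R.
  by rewrite mulrC mulr_powRB1.
by rewrite -mulrA ler_pM2l// powR_gt0.
Qed.

End clarkson_pointwise.

Section Lp_functions.
Context {d} {T : measurableType d} {R : realType}.
Variable mu : {measure set T -> \bar R}.
Implicit Types (f g : T -> R) (p : R).

(** The integral of a nonnegative function is a supremum over the simple functions below it, so
    monotonicity needs no measurability. This spares measurability proofs for iterated and
    restricted integrands. *)
Lemma ge0_le_integral_nomeas (D : set T) (f g : T -> \bar R) :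
  (forall x, D x -> 0 <= f x)%E -> (forall x, D x -> f x <= g x)%E ->
  (\int[mu]_(x in D) f x <= \int[mu]_(x in D) g x)%E.
Proof.
move=> f0 fg; rewrite !ge0_integralE//; last first.
  by move=> x Dx; apply: le_trans (fg x Dx); exact: f0.
apply: ereal_sup_le => _ [h hf <-]; exists h => // x; apply: le_trans (hf x) _.
rewrite /patch; case: ifPn => // /set_mem; exact: fg.
Qed.

Lemma measurable_norm_powR p f : measurable_fun setT f ->
  measurable_fun setT (fun x => `|f x| `^ p).
Proof.
move=> mf; apply: (measurableT_comp (measurable_powR p)).
exact: measurableT_comp.
Qed.

Lemma measurable_EFin_norm_powR p f : measurable_fun setT f ->
  measurable_fun setT (fun x => (`|f x| `^ p)%:E).
Proof. by move=> mf; apply/measurable_EFinP; exact: measurable_norm_powR. Qed.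

Lemma Lp_int_ge0 p f : (0 <= \int[mu]_x (`|f x| `^ p)%:E)%E.
Proof. by apply: integral_ge0 => x _; rewrite lee_fin powR_ge0. Qed.

Lemma Lp_powE p f : Lp_fun mu p f ->
  (\int[mu]_x (`|f x| `^ p)%:E = (Lp_pow mu p f)%:E)%E.
Proof. by move=> [_ fy]; rewrite /Lp_pow fineK// ge0_fin_numE// Lp_int_ge0. Qed.

Lemma Lp_pow_ge0 p f : 0 <= Lp_pow mu p f.
Proof. by rewrite fine_ge0// Lp_int_ge0. Qed.

Lemma Lp_intZ p (a : R) f : measurable_fun setT f ->
  (\int[mu]_x (`|a * f x| `^ p)%:E = (`|a| `^ p)%:E * \int[mu]_x (`|f x| `^ p)%:E)%E.
Proof.
move=> mf; rewrite -ge0_integralZl_EFin ?powR_ge0//.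
- by apply: eq_integral => x _; rewrite normrM powRM// EFinM.
- exact: measurable_EFin_norm_powR.
Qed.

Lemma Lp_funZ p (a : R) f : Lp_fun mu p f -> Lp_fun mu p (fun x => a * f x).
Proof.
move=> Lf; have [mf fy] := Lf; split; first exact: measurable_funM.
by rewrite Lp_intZ// Lp_powE// -EFinM ltry.
Qed.

Lemma Lp_powZ p (a : R) f : Lp_fun mu p f ->
  Lp_pow mu p (fun x => a * f x) = `|a| `^ p * Lp_pow mu p f.
Proof.
by move=> Lf; have [mf fy] := Lf; rewrite {1}/Lp_pow Lp_intZ// Lp_powE.
Qed.

Lemma Lp_fun0 p : p != 0 -> Lp_fun mu p (fun _ => 0).
Proof.
move=> p0; split; first exact: measurable_cst.
by under eq_integral do rewrite normr0 powR0//; rewrite integral0 ltry.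
Qed.

Lemma Lp_fun_le p f g : 0 <= p -> measurable_fun setT g -> Lp_fun mu p f ->
  (forall x, `|g x| <= `|f x|) -> Lp_fun mu p g /\ Lp_pow mu p g <= Lp_pow mu p f.
Proof.
move=> p0 mg Lf gf; have [mf fy] := Lf.
have H : (\int[mu]_x (`|g x| `^ p)%:E <= \int[mu]_x (`|f x| `^ p)%:E)%E.
  apply: ge0_le_integral_nomeas => x _; rewrite lee_fin ?powR_ge0//.
  exact: le_powR2.
have Lg : Lp_fun mu p g by split; [exact: mg|exact: le_lt_trans fy].
by split; [exact: Lg|move: H; rewrite (Lp_powE Lg) (Lp_powE Lf)].
Qed.

Lemma Lp_int_ae p f g : measurable_fun setT f -> measurable_fun setT g ->
  {ae mu, forall x, f x = g x} ->
  (\int[mu]_x (`|g x| `^ p)%:E = \int[mu]_x (`|f x| `^ p)%:E)%E.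
Proof.
move=> mf mg fg; apply: ge0_ae_eq_integral.
- exact: measurableT.
- exact: measurable_EFin_norm_powR.
- exact: measurable_EFin_norm_powR.
- by move=> x _; rewrite lee_fin powR_ge0.
- by move=> x _; rewrite lee_fin powR_ge0.
- case: fg => A [mA A0 sub]; exists A; split => //.
  by apply: subset_trans sub => x /= nfg fgx; apply: nfg => _; rewrite fgx.
Qed.

Lemma Lp_intD_le p f g : 1 <= p -> measurable_fun setT f -> measurable_fun setT g ->
  (\int[mu]_x (`|f x + g x| `^ p)%:E <=
   (2 `^ p)%:E * (\int[mu]_x (`|f x| `^ p)%:E + \int[mu]_x (`|g x| `^ p)%:E))%E.
Proof.
move=> p1 mf mg.
rewrite -ge0_integralD//; last 2 first.
- exact: measurable_EFin_norm_powR.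
- exact: measurable_EFin_norm_powR.
rewrite -ge0_integralZl_EFin ?powR_ge0//; last first.
  by apply: emeasurable_funD; exact: measurable_EFin_norm_powR.
  by move=> x _; rewrite adde_ge0// lee_fin powR_ge0.
apply: ge0_le_integral_nomeas => x _; first by rewrite lee_fin powR_ge0.
by rewrite -EFinD -EFinM lee_fin powR_normD_le.
Qed.

Lemma Lp_funD p f g : 1 <= p -> Lp_fun mu p f -> Lp_fun mu p g ->
  Lp_fun mu p (fun x => f x + g x).
Proof.
move=> p1 Lf Lg; have [mf _] := Lf; have [mg _] := Lg.
split; first exact: measurable_funD.
apply: le_lt_trans (Lp_intD_le p1 mf mg) _.
by rewrite !Lp_powE// -EFinD -EFinM ltry.
Qed.

Lemma Lp_funB p f g : 1 <= p -> Lp_fun mu p f -> Lp_fun mu p g ->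
  Lp_fun mu p (fun x => f x - g x).
Proof.
move=> p1 Lf Lg.
have -> : (fun x => f x - g x) = (fun x => f x + -1 * g x).
  by apply/funext => x; rewrite mulN1r.
exact: (Lp_funD p1 Lf (Lp_funZ (-1) Lg)).
Qed.

Lemma Lp_pow_minkowski p f g : 1 <= p -> Lp_fun mu p f -> Lp_fun mu p g ->
  Lp_pow mu p (fun x => f x + g x) `^ p^-1 <=
  Lp_pow mu p f `^ p^-1 + Lp_pow mu p g `^ p^-1.
Proof.
move=> p1 Lf Lg; have p0 : 0 < p by rewrite (lt_le_trans _ p1).
have LE h : Lp_fun mu p h ->
    ('N[mu]_p%:E [EFin \o h] = (Lp_pow mu p h `^ p^-1)%:E)%E.
  move=> Lh; rewrite -poweR_EFin -Lp_powE//.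
  have := powR_Lnorm mu (EFin \o h) (lt0r_neq0 p0).
  rewrite /=.
  by move=> <-; rewrite -poweRrM mulfV ?gt_eqF// poweRe1// Lnorm_ge0.
have := @minkowski_EFin _ _ _ mu _ _ _ (proj1 Lf) (proj1 Lg) p1.
by rewrite (LE _ Lf) (LE _ Lg) (LE _ (Lp_funD p1 Lf Lg)).
Qed.

End Lp_functions.

(** * Clarkson's inequality in [L^p] *)

Section clarkson_Lp.
Context {d} {T : measurableType d} {R : realType}.
Variable mu : {measure set T -> \bar R}.
Implicit Types (f g : T -> R) (p : R).

Lemma Lp_pow_comb p (a b : R) f g : 0 <= a -> 0 <= b ->
  Lp_fun mu p f -> Lp_fun mu p g ->
  (\int[mu]_x (a * `|f x| `^ p + b * `|g x| `^ p)%:E =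
    (a * Lp_pow mu p f + b * Lp_pow mu p g)%:E)%E.
Proof.
move=> a0 b0 Lf Lg.
have mf := measurable_norm_powR p (proj1 Lf).
have mg := measurable_norm_powR p (proj1 Lg).
move: (Lp_powE Lf) (Lp_powE Lg).
set A := Lp_pow mu p f; set B := Lp_pow mu p g => EA EB.
have -> : (a * A + b * B)%:E = (a%:E * \int[mu]_x (`|f x| `^ p)%:E +
    b%:E * \int[mu]_x (`|g x| `^ p)%:E)%E by rewrite EA EB.
rewrite -!ge0_integralZl_EFin//; last 2 first.
- exact/measurable_EFinP.
- exact/measurable_EFinP.
rewrite -ge0_integralD//.
- by move=> x _; rewrite -EFinM lee_fin mulr_ge0// powR_ge0.
- by apply/measurable_EFinP; exact: measurable_funM.
- by move=> x _; rewrite -EFinM lee_fin mulr_ge0// powR_ge0.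
- by apply/measurable_EFinP; exact: measurable_funM.
Qed.

Lemma Lp_pow_comb_le p (a b a' b' : R) f g f' g' :
  0 <= a -> 0 <= b -> 0 <= a' -> 0 <= b' ->
  Lp_fun mu p f -> Lp_fun mu p g -> Lp_fun mu p f' -> Lp_fun mu p g' ->
  (forall x, a * `|f x| `^ p + b * `|g x| `^ p <= a' * `|f' x| `^ p + b' * `|g' x| `^ p) ->
  a * Lp_pow mu p f + b * Lp_pow mu p g <= a' * Lp_pow mu p f' + b' * Lp_pow mu p g'.
Proof.
move=> a0 b0 a'0 b'0 Lf Lg Lf' Lg' H.
rewrite -lee_fin -(Lp_pow_comb a0 b0 Lf Lg) -(Lp_pow_comb a'0 b'0 Lf' Lg').
apply: ge0_le_integral_nomeas => x _; rewrite lee_fin//.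
by rewrite addr_ge0// mulr_ge0// powR_ge0.
Qed.

(** Hoelder's inequality for two summands, with conjugate exponents [1 / (p - 1)] and [1 / (2 - p)];
    hence [p = 2] is separate. It is an equality at [(u, v) = (A, B)], so it replaces the concave
    expression in [(u, v)] by an optimal linear one, which can be integrated. *)
Lemma powR_sum_dual (p q A B u v : R) : 1 < p <= 2 -> q = (p - 1)^-1 ->
  0 <= A -> 0 <= B -> 0 <= u -> 0 <= v ->
  A `^ (q - 1) * u + B `^ (q - 1) * v <=
    (A `^ q + B `^ q) `^ (2 - p) * (u `^ q + v `^ q) `^ (p - 1).
Proof.
move=> /andP[p1 p2] qE A0 B0 u0 v0.
have pm0 : 0 < p - 1 by rewrite subr_gt0.
have [pE|pn2] := eqVneq p 2.
  have pm1 : p - 1 = 1 by rewrite pE; ring.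
  have q1 : q = 1 by rewrite qE pm1 invr1.
  by rewrite q1 subrr pm1 pE subrr !powRr0 !mul1r !powRr1 ?addr_ge0.
have {}p2 : p < 2 by rewrite lt_neqAle pn2.
have q1 : 1 < q by rewrite qE invf_gt1// ltrBlDr.
have q0 : 0 < q by rewrite qE invr_gt0.
have qm0 : 0 < q - 1 by rewrite subr_gt0.
have qi : (q / (q - 1))^-1 = 2 - p.
  have pE : p = q^-1 + 1 by rewrite qE invrK subrK.
  rewrite pE invf_div mulrBl divff ?gt_eqF// mul1r; ring.
have conj : q^-1 + (q / (q - 1))^-1 = 1 by rewrite qi qE invrK; ring.
have := hoelder2 u0 v0 (powR_ge0 A (q - 1)) (powR_ge0 B (q - 1)) q0 _ conj.
have qV : q^-1 = p - 1 by rewrite qE invrK.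
rewrite qi qV -!powRrM mulrCA divff ?gt_eqF// mulr1.
move=> /(_ (divr_gt0 q0 qm0)) H.
by rewrite [leRHS]mulrC [X in X + _]mulrC [X in _ + X]mulrC.
Qed.

Lemma powR_sum_dual_le (p q A B s t : R) : 1 < p <= 2 -> q = (p - 1)^-1 ->
  0 <= A -> 0 <= B -> 0 <= s -> 0 <= t ->
  let c := (A `^ q + B `^ q) `^ (2 - p) / 2 in
  A `^ (q - 1) * A + B `^ (q - 1) * B <= c * s + c * t ->
  2 * (A `^ q + B `^ q) `^ (p - 1) <= s + t.
Proof.
move=> /andP[p1 p2] qE A0 B0 s0 t0 c; rewrite /c {c}.
have pm0 : 0 < p - 1 by rewrite subr_gt0.
have q0 : 0 < q by rewrite qE invr_gt0.
have E (a : R) : 0 <= a -> a `^ (q - 1) * a = a `^ q.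
  by move=> a0; rewrite mulrC mulr_powRB1.
rewrite -mulrDr (E _ A0) (E _ B0).
have : 0 <= A `^ q + B `^ q by rewrite addr_ge0// powR_ge0.
move: (A `^ q + B `^ q) => S S0.
have [S00|Sn0] := eqVneq S 0.
  by rewrite S00 (@powR0 _ (p - 1)) ?gt_eqF// mulr0 addr_ge0.
have Sp : 0 < S `^ (2 - p) by rewrite powR_gt0// lt_def Sn0.
rewrite -mulrA -ler_pdivrMl//.
have -> : (S `^ (2 - p))^-1 * S = S `^ (p - 1).
  rewrite -powRN -{2}(powRr1 S0) -powRD ?Sn0 ?implybT//.
  by congr (_ `^ _); ring.
by rewrite ler_pdivlMl.
Qed.

(** Here [p - 1 <= 1], so Minkowski's inequality cannot be used for the inner power. The pointwise
    inequality is instead linearised by [powR_sum_dual], with weights taken from the norms of [f]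
    and [g], then integrated; [powR_sum_dual_le] removes the weights. *)
Lemma Lp_clarkson_base_le2 p f g : 1 < p <= 2 -> Lp_fun mu p f -> Lp_fun mu p g ->
  2 * (Lp_pow mu p f `^ (p - 1)^-1 + Lp_pow mu p g `^ (p - 1)^-1) `^ (p - 1) <=
  Lp_pow mu p (fun x => f x + g x) + Lp_pow mu p (fun x => f x - g x).
Proof.
move=> p12 Lf Lg; have /andP[p1 p2] := p12.
have pm0 : 0 < p - 1 by rewrite subr_gt0.
have A0 := Lp_pow_ge0 mu p f; have B0 := Lp_pow_ge0 mu p g.
have LD := Lp_funD (ltW p1) Lf Lg; have LB := Lp_funB (ltW p1) Lf Lg.
have s0 := Lp_pow_ge0 mu p (fun x => f x + g x).
have d0 := Lp_pow_ge0 mu p (fun x => f x - g x).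
set q := (p - 1)^-1; have q0 : 0 < q by rewrite invr_gt0.
set A := Lp_pow mu p f in A0 *; set B := Lp_pow mu p g in B0 *.
set s := Lp_pow _ _ _ in s0 *; set t := Lp_pow _ _ _ in d0 *.
set S := A `^ q + B `^ q.
have S0 : 0 <= S by rewrite addr_ge0// powR_ge0.
pose c := S `^ (2 - p) / 2.
have c0 : 0 <= c by rewrite divr_ge0// powR_ge0.
have : A `^ (q - 1) * A + B `^ (q - 1) * B <= c * s + c * t.
  apply: (Lp_pow_comb_le (powR_ge0 _ _) (powR_ge0 _ _) c0 c0 Lf Lg LD LB) => x.
  apply: le_trans (powR_sum_dual p12 (erefl q) A0 B0 (powR_ge0 _ _) (powR_ge0 _ _)) _.
  rewrite -/q -/S -!powRrM -mulrDr /c -mulrA ler_wpM2l ?powR_ge0//.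
  by rewrite ler_pdivlMl// clarkson_pointwise_le2.
exact: (powR_sum_dual_le p12 (erefl q)).
Qed.

(** Now [p - 1 >= 1]: the integrated right-hand side is a power of the [L^(p-1)] norm of a sum of
    the two functions [h f] and [h g], which Minkowski's inequality splits. *)
Lemma Lp_clarkson_base_ge2 p f g : 2 <= p -> Lp_fun mu p f -> Lp_fun mu p g ->
  Lp_pow mu p (fun x => f x + g x) + Lp_pow mu p (fun x => f x - g x) <=
  2 * (Lp_pow mu p f `^ (p - 1)^-1 + Lp_pow mu p g `^ (p - 1)^-1) `^ (p - 1).
Proof.
move=> p2 Lf Lg.
have p1 : 1 < p by rewrite (lt_le_trans _ p2)// ltr1n.
have r1 : 1 <= p - 1 by lra.
have pm0 : 0 < p - 1 by rewrite subr_gt0.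
pose h (f : T -> R) x := `|f x| `^ (p / (p - 1)).
have hE k x : `|h k x| `^ (p - 1) = `|k x| `^ p.
  by rewrite ger0_norm ?powR_ge0// -powRrM divfK// gt_eqF.
have Lh k : Lp_fun mu p k -> Lp_fun mu (p - 1) (h k).
  move=> [mk ky]; split; first exact: measurable_norm_powR.
  by under eq_integral do rewrite hE.
have LhE k : Lp_pow mu (p - 1) (h k) = Lp_pow mu p k.
  by rewrite /Lp_pow; under eq_integral do rewrite hE.
have LhD := Lp_funD r1 (Lh _ Lf) (Lh _ Lg).
have := Lp_pow_minkowski r1 (Lh _ Lf) (Lh _ Lg); rewrite !LhE.
move=> /(le_powR2 (ltW pm0) (powR_ge0 _ _)).
rewrite powRV_powR ?gt_eqF// ?Lp_pow_ge0// => H.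
apply: le_trans (ler_wpM2l (ler0n R 2) H).
have LD := Lp_funD (ltW p1) Lf Lg; have LB := Lp_funB (ltW p1) Lf Lg.
rewrite -lee_fin -(mul1r (Lp_pow _ p _)) -(mul1r (Lp_pow _ p (fun x => f x - g x))).
rewrite -(Lp_pow_comb ler01 ler01 LD LB) EFinM -(Lp_powE LhD).
rewrite -ge0_integralZl_EFin//; last first.
  by apply: measurable_EFin_norm_powR; exact: (proj1 LhD).
apply: ge0_le_integral_nomeas => x _; rewrite ?lee_fin.
  by rewrite addr_ge0// mulr_ge0// powR_ge0.
rewrite !mul1r (ger0_norm (addr_ge0 (powR_ge0 _ _) (powR_ge0 _ _))).
exact: clarkson_pointwise_ge2.
Qed.

(** The remaining two inequalities are the base ones for the pair [(f + g, f - g)], whose sum and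
    difference are [2 f] and [2 g]. What is left is to take the power [q] and cancel a power of
    2. *)
Lemma clarkson_duality (p q A B s t : R) : 1 < p -> q = (p - 1)^-1 ->
  0 <= A -> 0 <= B -> 0 <= s -> 0 <= t ->
  (2 * (s `^ q + t `^ q) `^ (p - 1) <= 2 `^ p * A + 2 `^ p * B ->
    s `^ q + t `^ q <= 2 * (A + B) `^ q) /\
  (2 `^ p * A + 2 `^ p * B <= 2 * (s `^ q + t `^ q) `^ (p - 1) ->
    2 * (A + B) `^ q <= s `^ q + t `^ q).
Proof.
move=> p1 qE A0 B0 s0 t0.
have p0 : 0 < p by rewrite (lt_trans _ p1).
have pm0 : 0 < p - 1 by rewrite subr_gt0.
have q0 : 0 < q by rewrite qE invr_gt0.
have : 0 <= s `^ q + t `^ q by rewrite addr_ge0// powR_ge0.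
move: (s `^ q + t `^ q) => S S0.
have E2 : 2 `^ p = 2 * 2 `^ (p - 1) :> R by rewrite mulr_powRB1.
have Sq : (S `^ (p - 1)) `^ q = S by rewrite qE powR_powRV// gt_eqF.
have ABq : (2 `^ (p - 1) * (A + B)) `^ q = 2 * (A + B) `^ q.
  by rewrite powRM ?powR_ge0 ?addr_ge0// qE powR_powRV// gt_eqF.
rewrite -mulrDr E2 -mulrA !ler_pM2l//; split.
  by move=> /(le_powR2 (ltW q0) (powR_ge0 _ _)); rewrite Sq ABq.
move=> /(le_powR2 (ltW q0)); rewrite Sq ABq; apply.
by rewrite mulr_ge0 ?powR_ge0 ?addr_ge0.
Qed.

Lemma Lp_clarkson p : 1 < p -> clarkson p (Lp_fun mu p) (Lp_pow mu p).
Proof.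
move=> p1 f g Lf Lg s t q.
have LD := Lp_funD (ltW p1) Lf Lg; have LB := Lp_funB (ltW p1) Lf Lg.
have E2f : Lp_pow mu p (fun x => f x + g x + (f x - g x)) = 2 `^ p * Lp_pow mu p f.
  rewrite -{1}(ger0_norm (ler0n R 2)) -(Lp_powZ 2 Lf).
  by congr Lp_pow; apply/funext => x; ring.
have E2g : Lp_pow mu p (fun x => f x + g x - (f x - g x)) = 2 `^ p * Lp_pow mu p g.
  rewrite -{1}(ger0_norm (ler0n R 2)) -(Lp_powZ 2 Lg).
  by congr Lp_pow; apply/funext => x; ring.
have [D1 D2] := clarkson_duality p1 (erefl q) (Lp_pow_ge0 mu p f)
  (Lp_pow_ge0 mu p g) (Lp_pow_ge0 mu p (fun x => f x + g x))
  (Lp_pow_ge0 mu p (fun x => f x - g x)).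
split=> p2.
  have p12 : 1 < p <= 2 by rewrite p1.
  split; last exact: (Lp_clarkson_base_le2 p12 Lf Lg).
  apply: D1; rewrite -E2f -E2g; exact: (Lp_clarkson_base_le2 p12 LD LB).
split; first exact: (Lp_clarkson_base_ge2 p2 Lf Lg).
apply: D2; rewrite -E2f -E2g; exact: (Lp_clarkson_base_ge2 p2 LD LB).
Qed.

End clarkson_Lp.

(** * Fatou's lemma and almost everywhere convergent subsequences *)

Section Lp_convergence.
Context {d} {T : measurableType d} {R : realType}.
Variable mu : {measure set T -> \bar R}.
Implicit Types (f g : T -> R) (p : R).

Lemma limn_einf_le (u : (\bar R)^nat) (c : \bar R) :
  (forall n, u n <= c)%E -> (limn_einf u <= c)%E.
Proof.
move=> uc; rewrite limn_einf_lim; apply: lime_le; first exact: is_cvg_einfs.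
apply: nearW => n; apply: le_trans (uc n).
by apply: ereal_inf_lbound; exists n => /=.
Qed.

Lemma cvg_norm_powR p (u : nat -> R) (l : R) : 0 < p ->
  u n @[n --> \oo] --> l -> (`|u n| `^ p)%:E @[n --> \oo] --> (`|l| `^ p)%:E.
Proof.
move=> p0 ul; apply: cvg_EFin; first exact: nearW.
have [l0|l0] := eqVneq l 0.
  apply/cvgrPdist_lt => e e0; near=> n.
  rewrite l0 normr0 powR0 ?gt_eqF// sub0r normrN /= ger0_norm ?powR_ge0//.
  have -> : e = (e `^ p^-1) `^ p by rewrite powRV_powR ?gt_eqF// ltW.
  apply: gt0_ltr_powR; rewrite ?nnegrE ?powR_ge0//.
  rewrite -normrN -sub0r -l0; near: n.
  by move/cvgrPdist_lt : ul; apply; rewrite powR_gt0.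
have {}l0 : 0 < `|l| by rewrite normr_gt0.
have ul' : `|u n| @[n --> \oo] --> `|l| by exact: cvg_norm.
apply: (@continuous_cvg _ _ _ _ _ (fun n => `|u n|) (fun x : R => x `^ p)) ul'.
apply: differentiable_continuous; apply/derivable1_diffP.
by apply: derivable_powR; rewrite in_itv/= l0.
Unshelve. all: by end_near. Qed.

Lemma Lp_fatou p (w : nat -> T -> R) (v : T -> R) (c : \bar R) : 0 < p ->
  (forall n, measurable_fun setT (w n)) -> measurable_fun setT v ->
  {ae mu, forall x, w n x @[n --> \oo] --> v x} ->
  (forall n, \int[mu]_x (`|w n x| `^ p)%:E <= c)%E ->
  (\int[mu]_x (`|v x| `^ p)%:E <= c)%E.
Proof.
move=> p0 mw mv wv wc.
have mwp n : measurable_fun setT (fun x => (`|w n x| `^ p)%:E).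
  exact: measurable_EFin_norm_powR.
have w0 n x : [set: T] x -> (0 <= (`|w n x| `^ p)%:E)%E.
  by move=> _; rewrite lee_fin; exact: powR_ge0.
apply: le_trans (le_trans (fatou mu measurableT mwp w0) (limn_einf_le wc)).
rewrite le_eqVlt; apply/orP; left; apply/eqP.
apply: ge0_ae_eq_integral.
- exact: measurableT.
- exact: measurable_EFin_norm_powR.
- rewrite (_ : (fun x => _) =
      (fun x => - limn_esup (-%E \o (fun n => (`|w n x| `^ p)%:E)))%E); last first.
    by apply/funext => x; rewrite limn_esupN oppeK.
  apply: measurableT_comp => //; apply: measurable_fun_limn_esup => n.
  exact: measurableT_comp.
- by move=> x _; rewrite lee_fin powR_ge0.
- move=> x _; rewrite limn_einf_lim; apply: lime_ge; first exact: is_cvg_einfs.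
  apply: nearW => n; apply: le_ereal_inf_tmp => _ [k _ <-].
  by rewrite lee_fin powR_ge0.
- case: wv => A [mA A0 sub]; exists A; split => //.
  apply: subset_trans sub => x /= H wvx; apply: H => _.
  by have [->] := cvg_limn_einf_sup (cvg_norm_powR p0 wvx).
Qed.

(** The first half of the Riesz-Fischer theorem. Only an almost everywhere limit is extracted;
    convergence in norm is recovered by Fatou's lemma, which then serves [X] and the product space
    at once. *)
Lemma Lp_cauchy_subseq p (u : nat -> T -> R) : 0 < p ->
  (forall n, measurable_fun setT (u n)) ->
  (forall e, 0 < e -> exists N, forall n k, (N <= n)%N -> (N <= k)%N ->
     (\int[mu]_x (`|u n x - u k x| `^ p)%:E < e%:E)%E) ->
  exists (v : T -> R) (phi : nat -> nat), [/\ measurable_fun setT v,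
    forall k, (k <= phi k)%N &
    {ae mu, forall x, u (phi n) x @[n --> \oo] --> v x}].
Proof.
move=> p0 mu_ cu.
pose h k : R := 2^-1 ^+ k.
have h0 k : 0 < h k by rewrite exprn_gt0.
have hp0 k : 0 < h k `^ p by rewrite powR_gt0.
(* The factor [h k ^ p] leaves the weighted increments [g k] with integrals that sum to at most 1.
   Where their sum [G x] is finite, [|D k x|] is at most [G x ^ (1/p) * h k], a geometric
   majorant. *)
pose e k : R := h k `^ p * (1 / (2 ^ k.+1)%:R).
have e0 k : 0 < e k by rewrite mulr_gt0// divr_gt0// ltr0n expn_gt0.
have /choice[N HN] k := cu _ (e0 k).
(* A sum of thresholds in place of a maximum: [phi k] and [phi k.+1] both exceed [N k], and
   [phi k >= k]. *)
pose phi k := (k + \sum_(j < k.+1) N j)%N.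
have phiN k j : (j <= k)%N -> (N j <= phi k)%N.
  move=> jk; rewrite /phi (bigD1 (Ordinal (jk : (j < k.+1)%N)))//=.
  by rewrite addnCA leq_addr.
pose D k x := u (phi k.+1) x - u (phi k) x.
have mD k : measurable_fun setT (D k) by exact: measurable_funB.
have iD k : (\int[mu]_x (`|D k x| `^ p)%:E <= (e k)%:E)%E.
  by apply: ltW; apply: HN; exact: phiN.
pose g k x : \bar R := ((h k `^ p)^-1 * `|D k x| `^ p)%:E.
have g0 k x : (0 <= g k x)%E.
  by rewrite lee_fin mulr_ge0// ?powR_ge0// invr_ge0 ltW.
have mg k : measurable_fun setT (g k).
  apply/measurable_EFinP; apply: measurable_funM => //.
  exact: measurable_norm_powR.
have ig k : (\int[mu]_x g k x <= (1 / (2 ^ k.+1)%:R)%:E)%E.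
  rewrite /g; under eq_integral do rewrite EFinM.
  rewrite ge0_integralZl_EFin//; last 2 first.
  - exact: measurable_EFin_norm_powR.
  - by rewrite invr_ge0 ltW.
  rewrite lee_pdivrMl// -EFinM; exact: iD.
pose G x := (\sum_(k <oo) g k x)%E.
have iG : (\int[mu]_x G x <= 1)%E.
  rewrite /G integral_nneseries//.
  apply: le_trans (epsilon_trick0 xpredT ler01).
  by apply: lee_nneseries => k *; [exact: integral_ge0|exact: ig].
have G0 x : (0 <= G x)%E by apply: nneseries_ge0 => k _ _; exact: g0.
have mG : measurable_fun setT G by exact: ge0_emeasurable_sum.
have Gfin : {ae mu, forall x, setT x -> G x \is a fin_num}.
  apply: integrable_ae => //; apply/integrableP; split => //.
  under eq_integral do rewrite gee0_abs//.
  by apply: le_lt_trans iG _; rewrite ltry.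
(* The upper limit is measurable without any convergence; [fine] gives a real default value on the
   null set where it may be infinite. *)
pose v x := fine (limn_esup (fun k => (u (phi k) x)%:E)).
exists v, phi; split.
- apply: measurableT_comp => //.
  by apply: measurable_fun_limn_esup => k; apply/measurable_EFinP.
- by move=> k; exact: leq_addr.
case: Gfin => A [mA A0 sub]; exists A; split => //.
apply: subset_trans sub => x /= H /(_ I) Gx; apply: H.
suff : cvgn (fun n => u (phi n) x).
  move=> /cvg_ex[l ul].
  have ul' : (u (phi n) x)%:E @[n --> \oo] --> l%:E by apply: cvg_EFin => //; exact: nearW.
  by rewrite /v (cvg_limn_einf_sup ul').
have cs : cvgn (series (fun k => D k x)).
  apply: normed_cvg.
  pose C := fine (G x) `^ p^-1.
  apply: (@series_le_cvg _ _ (geometric C 2^-1)) => //.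
  - by move=> k /=.
  - by move=> k; rewrite /geometric/= mulr_ge0 ?powR_ge0// exprn_ge0.
  - move=> k; rewrite /geometric/=.
    have : (g k x <= G x)%E.
      have := @nneseries_lim_ge R (g^~ x) xpredT 0 k.+1 (fun n _ _ => g0 n x).
      apply: le_trans; rewrite big_mkord big_ord_recr/=.
      by rewrite leeDr// sume_ge0.
    rewrite -(fineK Gx) lee_fin ler_pdivrMl// => DG.
    rewrite -(@powR_powRV _ p `|D k x|) ?gt_eqF//.
    apply: le_trans (le_powR2 _ (powR_ge0 _ _) DG) _; first by rewrite invr_ge0 ltW.
    rewrite (powRM _ (powR_ge0 _ _) (fine_ge0 (G0 x))) powR_powRV ?gt_eqF//; last exact: ltW.
    by rewrite [leLHS]mulrC.
  - by apply: is_cvg_geometric_series; rewrite ger0_norm// invf_lt1 ?ltr1n.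
have -> : (fun n => u (phi n) x) = (fun n => series (fun k => D k x) n + u (phi 0) x).
  apply/funext => n.
  by rewrite /series /D /= telescope_sumr// subrK.
by apply: is_cvgD => //; exact: is_cvg_cst.
Qed.

End Lp_convergence.

(** * Coverings, nets and jump kernels *)

Section dyadic.
Context {R : realType}.

Lemma ltr_exp2n (a : R) : exists n : nat, a < 2 ^+ n.
Proof.
exists (Num.trunc `|a|).+1; apply: le_lt_trans (ler_norm a) _.
apply: lt_le_trans (truncnS_gt _) _.
by rewrite -natrX ler_nat ltnW// ltn_expl.
Qed.

Lemma dyadic_bracket (a : R) : 1 <= a -> exists n : nat, 2 ^+ n <= a < 2 ^+ n.+1.
Proof.
move=> a1; have [n0 an0] := ltr_exp2n a.
have ex : exists n, a < 2 ^+ n.+1.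
  by exists n0; apply: lt_le_trans an0 _; rewrite ler_eXn2l ?ltr1n.
exists (ex_minn ex); case: ex_minnP => -[|n] an minn.
  by rewrite expr0 a1.
rewrite an andbT leNgt; apply/negP => an'.
by have := minn n an'; rewrite ltnn.
Qed.

Lemma nneseries_ge_term (f : (\bar R)^nat) k :
  (forall n, 0 <= f n)%E -> (f k <= \sum_(n <oo) f n)%E.
Proof.
move=> f0; apply: le_trans (nneseries_lim_ge k.+1 (fun n _ _ => f0 n)).
by rewrite big_mkord big_ord_recr/= leeDr// sume_ge0.
Qed.

Lemma nneseries_geometric_le (c l : R) : 0 <= c -> 0 <= l < 1 ->
  (\sum_(n <oo) (c * l ^+ n)%:E <= (c / (1 - l))%:E)%E.
Proof.
move=> c0 /andP[l0 l1]; apply: lime_le.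
  by apply: is_cvg_nneseries => n _ _; rewrite lee_fin mulr_ge0// exprn_ge0.
apply: nearW => n; rewrite big_mkord sumEFin lee_fin -mulr_sumr ler_wpM2l//.
have l10 : 0 < 1 - l by rewrite subr_gt0.
rewrite -div1r ler_pdivlMr// mulrC -opprB mulNr.
rewrite [X in - ((_ - _) * X)](_ : _ = \sum_(i < n) l ^+ i) -?subrX1 ?opprB//.
by rewrite gerBl exprn_ge0.
Qed.

End dyadic.

Section integral_covers.
Context {d} {T : measurableType d} {R : realType}.
Variable mu : {measure set T -> \bar R}.
Local Open Scope ereal_scope.

Lemma integral_cover_le (D : set T) (F : (set T)^nat) (f : T -> \bar R) :
  (forall n, measurable (F n)) -> measurable_fun setT f -> (forall x, 0 <= f x) ->
  D `<=` \bigcup_n F n ->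
  \int[mu]_(x in D) f x <= \sum_(n <oo) \int[mu]_(x in F n) f x.
Proof.
move=> mF mf f0 DF.
have f0' (E : set T) x : 0 <= (f \_ E) x by rewrite /patch; case: ifP.
under eq_eseriesr do rewrite integral_mkcond.
rewrite -integral_nneseries//; last first.
  move=> n; apply/(measurable_restrict f (mF n) measurableT).
  by rewrite setTI; exact: measurable_funTS.
rewrite integral_mkcond; apply: ge0_le_integral_nomeas => // x _.
rewrite {1}/patch; case: ifPn => [/set_mem /DF[n _ Fnx]|_]; last first.
  by apply: nneseries_ge0 => *; exact: f0'.
apply: le_trans (nneseries_ge_term n (fun n => f0' (F n) x)).
by rewrite /patch mem_set.
Qed.

Lemma integral_setS (A B : set T) (f : T -> \bar R) :
  (forall x, 0 <= f x) -> A `<=` B ->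
  \int[mu]_(x in A) f x <= \int[mu]_(x in B) f x.
Proof.
move=> f0 AB; rewrite (integral_mkcond A) (integral_mkcond B).
have f0' (E : set T) x : 0 <= (f \_ E) x by rewrite /patch; case: ifP.
apply: ge0_le_integral_nomeas => // x _; rewrite {1}/patch; case: ifPn => // xA.
by rewrite /patch mem_set//; apply: AB; exact: set_mem.
Qed.

Lemma integral_setU_le (A B : set T) (f : T -> \bar R) :
  measurable A -> measurable B -> measurable_fun setT f -> (forall x, 0 <= f x) ->
  \int[mu]_(x in A `|` B) f x <= \int[mu]_(x in A) f x + \int[mu]_(x in B) f x.
Proof.
move=> mA mB mf f0.
have f0' (E : set T) x : 0 <= (f \_ E) x by rewrite /patch; case: ifP.
have mf' A' : measurable A' -> measurable_fun setT (f \_ A').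
  move=> mA'; apply/(measurable_restrict f mA' measurableT).
  by rewrite setTI; exact: measurable_funTS.
rewrite !(integral_mkcond A) !(integral_mkcond B) (integral_mkcond (A `|` B)).
rewrite -ge0_integralD//; [|exact: mf'|exact: mf'].
apply: ge0_le_integral_nomeas => // x _; rewrite {1}/patch; case: ifPn; last first.
  by rewrite adde_ge0.
move=> /set_mem[xA|xB].
  by rewrite {1}/patch mem_set// leeDl.
by rewrite {2}/patch mem_set// leeDr.
Qed.

Lemma integral_overlap (F : (set T)^nat) (f : T -> \bar R) (N : R) :
  (0 <= N)%R ->
  (forall n, measurable (F n)) -> measurable_fun setT f -> (forall x, 0 <= f x) ->
  (forall x n, (\sum_(i < n) \1_(F i) x <= N)%R) ->
  \sum_(n <oo) \int[mu]_(x in F n) f x <= N%:E * \int[mu]_x f x.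
Proof.
move=> N0 mF mf f0 FN.
have f0' (E : set T) x : 0 <= (f \_ E) x by rewrite /patch; case: ifP.
under eq_eseriesr do rewrite integral_mkcond.
rewrite -integral_nneseries//; last first.
  move=> n; apply/(measurable_restrict f (mF n) measurableT).
  by rewrite setTI; exact: measurable_funTS.
rewrite -ge0_integralZl_EFin//.
apply: ge0_le_integral_nomeas => x _.
  by apply: nneseries_ge0 => *; exact: f0'.
apply: lime_le.
  by apply: is_cvg_nneseries => n _ _.
apply: nearW => n; rewrite big_mkord.
rewrite (eq_bigr (fun i : 'I_n => (\1_(F i) x)%:E * f x)); last first.
  move=> i _; rewrite /patch indicE; case: ifPn => _; by rewrite ?mul1e ?mul0e.
rewrite -ge0_sume_distrl; last by move=> i _; rewrite lee_fin.
rewrite sumEFin; apply: lee_wpmul2r; first exact: f0.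
by rewrite lee_fin; exact: FN.
Qed.

End integral_covers.

(** Balls of integer radius around one point have finite measure and exhaust the space. This is
    stated for a bare measure, because the metric lemmas that follow live over a measure already
    carrying the sigma-finite structure required by products. *)
Lemma standing_sigma_finite (R : realType) (d0 : measure_display)
    (X : measurableType d0) (dist : X -> X -> R) (m : {measure set X -> \bar R}) :
  standing_setting dist m -> sigma_finite setT m.
Proof.
move=> [[d0_ [dxx [dsym dtri]]] [_ [unb [_ [_ [rc [bs [rad _]]]]]]]].
have [x0 _] := unb 0.
have mo U : dopen dist U -> measurable U by move=> oU; apply/bs; exact: sub_sigma_algebra.
have ob r : dopen dist (dball dist x0 r).
  move=> x xr; exists (r - dist x0 x); split; first by rewrite subr_gt0.
  move=> y /= xy; rewrite /dball/=; apply: le_lt_trans (dtri x0 x y) _.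
  by rewrite addrC -ltrBrDr.
exists (fun n => dball dist x0 n%:R).
  rewrite eqEsubset; split => // x _; exists (Num.trunc (dist x0 x)).+1 => //=.
  by rewrite /dball/= truncnS_gt.
move=> n; split; first exact: mo.
apply: le_lt_trans (rad _ (rc x0 n%:R)).
apply: le_measure; rewrite ?inE.
- exact: mo.
- rewrite -[X in measurable X]setCK; apply: measurableC; apply: mo.
  move=> x /=; rewrite /dclosure/= => /existsNP[e /not_implyP[e0 ne]].
  exists (e / 2); split; first by rewrite divr_gt0.
  move=> y xy /= cy; apply: ne; have [a [xa ya]] := cy _ (divr_gt0 e0 (ltr0n R 2)).
  exists a; split => //; apply: le_lt_trans (dtri x y a) _.
  by rewrite (splitr e) ltrD.
- by move=> x xr e e0; exists x; split => //; rewrite (dxx x x).2.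
Qed.

Lemma measurable_fun_lt {d} {T : measurableType d} {R : realType} (f : T -> R) :
  (forall r, measurable [set x | f x < r]) -> measurable_fun setT f.
Proof.
move=> H; apply: (measurability _ (RGenInftyO.measurableE R)) => //.
move=> _ [_ [r ->] <-]; rewrite setTI.
rewrite (_ : _ @^-1` _ = [set x | f x < r]) //.
Qed.

Lemma measurable_set_lt {d} {T : measurableType d} {R : realType} (f g : T -> R) :
  measurable_fun setT f -> measurable_fun setT g -> measurable [set x | f x < g x].
Proof.
move=> mf mg; have := measurable_fun_ltr mf mg measurableT (Y := [set true]) I.
by rewrite setTI.
Qed.

Lemma measurable_set_le {d} {T : measurableType d} {R : realType} (f g : T -> R) :
  measurable_fun setT f -> measurable_fun setT g -> measurable [set x | f x <= g x].
Proof.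
move=> mf mg; have := measurable_fun_ler mf mg measurableT (Y := [set true]) I.
by rewrite setTI.
Qed.

(** * Volumes and measurability in a doubling metric measure space *)

Section metric_measure.
Context {R : realType} {d0 : measure_display} {X : measurableType d0}.
Variables (dist : X -> X -> R) (m : {sigma_finite_measure set X -> \bar R}).
Hypothesis SS : standing_setting dist m.
Hypothesis VDm : VD dist m.
Implicit Types (x y z : X) (r t : R).

Lemma mdist_ge0 x y : 0 <= dist x y. Proof. by case: SS => -[]. Qed.
Lemma mdistxx x : dist x x = 0. Proof. by case: SS => -[_ [/(_ x x)[_ ->]]]. Qed.
Lemma mdist_eq0 x y : dist x y = 0 -> x = y.
Proof. by case: SS => -[_ [/(_ x y)[]]]. Qed.
Lemma mdistC x y : dist x y = dist y x.
Proof. by case: SS => -[_ [_ [/(_ x y)]]]. Qed.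
Lemma mdist_tri y x z : dist x z <= dist x y + dist y z.
Proof. by case: SS => -[_ [_ [_ ]]]. Qed.

Lemma mdist_gt0 x y : x <> y -> 0 < dist x y.
Proof.
by move=> xy; rewrite lt_def mdist_ge0 andbT; apply/eqP => /mdist_eq0.
Qed.

Lemma dopen_dball x r : dopen dist (dball dist x r).
Proof.
move=> y yr; exists (r - dist x y); split; first by rewrite subr_gt0.
move=> z /= yz; rewrite /dball/=; apply: le_lt_trans (mdist_tri y x z) _.
by rewrite addrC -ltrBrDr.
Qed.

Lemma measurable_dopen U : dopen dist U -> measurable U.
Proof.
case: SS => [_ [_ [_ [_ [_ [_ [bs _]]]]]]] oU.
by apply/bs; exact: sub_sigma_algebra.
Qed.

Lemma measurable_dball x r : measurable (dball dist x r).
Proof. exact/measurable_dopen/dopen_dball. Qed.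

Lemma dopenC_dclosure A : dopen dist (~` dclosure dist A).
Proof.
move=> x /=; rewrite /dclosure/= => /existsNP[e /not_implyP[e0 ne]].
exists (e / 2); split; first by rewrite divr_gt0.
move=> y xy /= cy; apply: ne; have [a [xa ya]] := cy _ (divr_gt0 e0 (ltr0n R 2)).
exists a; split => //; apply: le_lt_trans (mdist_tri y x a) _.
by rewrite (splitr e) ltrD.
Qed.

Lemma sub_dclosure A : A `<=` dclosure dist A.
Proof. by move=> x Ax e e0; exists x; rewrite mdistxx. Qed.

Lemma measure_dball_lty x r : (m (dball dist x r) < +oo)%E.
Proof.
have [_ [_ [_ [_ [_ [rc [_ [rad _]]]]]]]] := SS.
apply: le_lt_trans (rad _ (rc x r)); apply: le_measure; rewrite ?inE.
- exact: measurable_dball.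
- rewrite -[X in measurable X]setCK; apply: measurableC; apply: measurable_dopen.
  exact: dopenC_dclosure.
- exact: sub_dclosure.
Qed.

Lemma volE x r : m (dball dist x r) = (vol dist m x r)%:E.
Proof. by rewrite /vol fineK// ge0_fin_numE// measure_dball_lty. Qed.

Lemma vol_gt0 x r : 0 < r -> 0 < vol dist m x r.
Proof.
move=> r0; have [_ [_ [_ [_ [_ [_ [_ [_ [full _]]]]]]]]] := SS.
by rewrite -lte_fin -volE full.
Qed.

Lemma vol_sub x y r t : dist x y + r <= t -> vol dist m y r <= vol dist m x t.
Proof.
move=> yx; rewrite -lee_fin -!volE; apply: le_measure; rewrite ?inE.
- exact: measurable_dball.
- exact: measurable_dball.
- move=> z /= yz; apply: le_lt_trans (mdist_tri y x z) _.
  by apply: lt_le_trans yx; rewrite ltrD2l.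
Qed.

Lemma vol_mono x r t : r <= t -> vol dist m x r <= vol dist m x t.
Proof. by move=> rt; apply: vol_sub; rewrite mdistxx add0r. Qed.

Lemma VD_scale : exists D : R -> R, forall L, 1 <= D L /\
  forall x r, 0 < r -> vol dist m x (L * r) <= D L * vol dist m x r.
Proof.
have [C HC] := VDm.
have [x0 _] : exists x : X, True.
  by have [_ [_ [unb _]]] := SS; have [x _] := unb 0; exists x.
have C1 : 1 <= C.
  have V := vol_gt0 x0 ltr01.
  rewrite -(@ler_pM2r _ (vol dist m x0 1))// mul1r.
  by apply: le_trans (HC x0 1 ltr01); apply: vol_mono; rewrite mulr1 ler1n.
have iter n x r : 0 < r -> vol dist m x (2 ^+ n * r) <= C ^+ n * vol dist m x r.
  move=> r0; elim: n => [|n IH]; first by rewrite !expr0 !mul1r.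
  rewrite !exprS -!mulrA; apply: le_trans (HC _ _ _) _.
    by rewrite mulr_gt0// exprn_gt0.
  by rewrite ler_wpM2l// (le_trans _ C1).
have /choice[N HN] := @ltr_exp2n R.
exists (fun L => C ^+ N L) => L; split; first exact: exprn_ege1.
move=> x r r0; apply: le_trans (iter (N L) x r r0); apply: vol_mono.
by rewrite ler_pM2r// ltW.
Qed.

Lemma exists_dense_seq : exists q : nat -> X,
  forall x e, 0 < e -> exists n, dist x (q n) < e.
Proof.
have [_ [_ [unb [_ [[D [cD dD]] _]]]]] := SS.
have [x0 _] := unb 0.
have [y0 [Dy0 _]] := dD x0 1 ltr01.
have [q qD] : exists q : nat -> X, D `<=` range q.
  move/pfcard_geP : cD => [D0|[f]]; first by rewrite D0 in Dy0.
  exists f; apply: subset_trans (@surj _ _ _ _ f) _ => _ [n _ <-].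
  by exists n.
exists q => x e e0; have [y [/qD[n _ <-] xy]] := dD x e e0.
by exists n.
Qed.

Lemma measurable_fun_dcontinuous (f : X -> R) :
  dcontinuous dist f -> measurable_fun setT f.
Proof.
move=> cf; apply: measurable_fun_lt => r; apply: measurable_dopen => x /= xr.
have [e [e0 he]] := cf x (r - f x) (ltac:(by rewrite subr_gt0)).
exists e; split => // y /he; rewrite /= distrC => /(le_lt_trans (ler_norm _)).
by rewrite ltrBlDr subrK.
Qed.

Lemma measurable_mdist_l x : measurable_fun setT (dist x).
Proof. by apply: measurable_fun_lt => r; exact: measurable_dball. Qed.

(** The product sigma-algebra is generated by rectangles, so joint measurability uses separability:
    [dist x y < r] holds iff some point [q n] of a dense sequence satisfies
    [dist (q n) x + dist (q n) y < r]. *)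
Lemma measurable_mdist : measurable_fun setT (fun z : X * X => dist z.1 z.2).
Proof.
have [q dq] := exists_dense_seq.
apply: measurable_fun_lt => r.
have -> : [set z : X * X | dist z.1 z.2 < r] =
    \bigcup_n [set z : X * X | dist (q n) z.1 + dist (q n) z.2 < r].
  rewrite eqEsubset; split => [[x y] /= xy|[x y] [n _ /=]].
    have e0 : 0 < (r - dist x y) / 2 by rewrite divr_gt0// subr_gt0.
    have [n xn] := dq x _ e0; exists n => //=.
    rewrite (mdistC _ x).
    have := mdist_tri x (q n) y; rewrite (mdistC _ x); lra.
  by apply: le_lt_trans; rewrite (mdistC (q n) x) mdist_tri.
apply: bigcupT_measurable => n.
have mf : measurable_fun setT (fun z : X * X => dist (q n) z.1 + dist (q n) z.2).
  apply: measurable_funD.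
    exact: (measurableT_comp (measurable_mdist_l (q n)) measurable_fst).
  exact: (measurableT_comp (measurable_mdist_l (q n)) measurable_snd).
have := mf measurableT `]-oo, r[%classic (measurable_itv _).
rewrite setTI (_ : _ @^-1` _ = [set z : X * X | dist (q n) z.1 + dist (q n) z.2 < r])//.
Qed.

End metric_measure.

Section scales.
Context {R : realType}.
Implicit Types (U : R -> R) (r s : R).

Definition scale_bounds U (C b1 b2 : R) :=
  [/\ 1 <= C, 0 < b1, forall r, 0 < r -> 0 < U r,
   forall r s, 0 < r -> r <= s -> U r * (s / r) `^ b1 <= C * U s &
   forall r s, 0 < r -> r <= s -> U s <= C * (s / r) `^ b2 * U r].

Lemma doubling_scale_bounds U : doubling_fun U ->
  exists C b1 b2, scale_bounds U C b1 b2.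
Proof.
move=> [[Ui [Upos _]] [C [b1 [b2 [C1 [/andP[b10 b12] [_ Ub]]]]]]].
have C0 : 0 < C by rewrite (lt_trans _ C1).
have U0 r : 0 < r -> 0 < U r.
  move=> r0; rewrite lt_def; apply/andP; split; last by have [] := Upos r (ltW r0).
  (* If [U r] vanished, the quotient at two equal radii would be 0, below its lower bound [C^-1]. *)
  apply/eqP => Ur; have [+ _] := Ub r r r0 (lexx r).
  by rewrite Ur mul0r divff ?gt_eqF// powR1 mulr1 leNgt invr_gt0 C0.
exists C, b1, b2; split => //; first exact: ltW.
  move=> r s r0 rs; have [+ _] := Ub r s r0 rs.
  by rewrite ler_pdivlMr ?U0// -mulrA ler_pdivrMl// mulrC.
move=> r s r0 rs; have [_] := Ub r s r0 rs.
by rewrite ler_pdivrMr ?U0.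
Qed.

Lemma scale_bounds_le U C b1 b2 : scale_bounds U C b1 b2 ->
  forall r s, 0 < r -> r <= s -> U r <= C * U s.
Proof.
move=> [C1 b10 U0 Ul _] r s r0 rs; apply: le_trans (Ul r s r0 rs).
have H : 1 <= (s / r) `^ b1.
  have sr : 1 <= s / r by rewrite ler_pdivlMr// mul1r.
  by have := le_powR2 (ltW b10) ler01 sr; rewrite powR1.
by rewrite ler_peMr// ltW// U0.
Qed.

End scales.

Section kernels.
Context {R : realType} {d0 : measure_display} {X : measurableType d0}.
Variables (dist : X -> X -> R) (m : {sigma_finite_measure set X -> \bar R}).
Hypothesis SS : standing_setting dist m.
Hypothesis VDm : VD dist m.
Variables (p : R) (U : R -> R) (K : X -> X -> R) (CU b1 b2 : R).
Hypothesis p1 : 1 < p.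
Hypothesis HU : scale_bounds U CU b1 b2.
Hypothesis HK : jump_kernel dist m U K.
Implicit Types (x y z : X) (r t : R).
Local Notation V := (vol dist m).

(** Volumes are increasing and [U] is so up to [CU]; hence the bounds may be taken at any [t] above,
    respectively below, the distance. Later estimates fix one [t] on a whole region of pairs. *)
Lemma kernel_bounds : exists k1 k2, [/\ 0 < k1, 0 < k2,
  (forall x y t, x <> y -> dist x y <= t -> k1 / (V x t * U t) <= K x y) &
  (forall x y t, 0 < t -> t <= dist x y -> K x y <= k2 / (V x t * U t))].
Proof.
have [C1 b10 U0 Ul Uu] := HU; have Um := scale_bounds_le HU.
have C0 : 0 < CU by rewrite (lt_le_trans _ C1).
have [mK [c1 [c2 [c10 [c20 Kb]]]]] := HK.
exists (c1 / CU), (c2 * CU); split; rewrite ?divr_gt0 ?mulr_gt0//.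
  move=> x y t xy yt; have d_gt0 := mdist_gt0 SS xy.
  have [_ [Kl _]] := Kb x y xy; apply: le_trans Kl.
  have t0 := lt_le_trans d_gt0 yt.
  have P s : 0 < s -> 0 < V x s * U s.
    by move=> s0; rewrite mulr_gt0 ?U0// vol_gt0.
  rewrite ler_pdivrMr ?P// mulrAC ler_pdivlMr ?P// -mulrA ler_pM2l//.
  rewrite ler_pdivrMl// [leRHS]mulrCA; apply: ler_pM.
  - by rewrite ltW// vol_gt0.
  - by rewrite ltW// U0.
  - exact: (vol_mono SS).
  - exact: Um.
move=> x y t t0 ty; have d_gt0 := lt_le_trans t0 ty.
have xy : x <> y by move=> xy; move: d_gt0; rewrite xy (mdistxx SS) ltxx.
have [_ [_ Ku]] := Kb x y xy; apply: le_trans Ku _.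
have P s : 0 < s -> 0 < V x s * U s.
  by move=> s0; rewrite mulr_gt0 ?U0// vol_gt0.
rewrite ler_pdivrMr ?P// mulrAC ler_pdivlMr ?P// -mulrA ler_pM2l//.
rewrite [leRHS]mulrCA; apply: ler_pM.
- by rewrite ltW// vol_gt0.
- by rewrite ltW// U0.
- exact: (vol_mono SS).
- exact: Um.
Qed.

Lemma kernel_gt0 x y : x <> y -> 0 < K x y.
Proof.
move=> xy; have [k1 [k2 [k10 _ Kl _]]] := kernel_bounds.
have [_ _ U0 _ _] := HU.
apply: lt_le_trans (Kl x y (dist x y) xy (lexx _)).
by rewrite divr_gt0// mulr_gt0 ?U0 ?vol_gt0// (mdist_gt0 SS).
Qed.

Lemma kernel_sym x y : x <> y -> K x y = K y x.
Proof. by move=> xy; have [_ [c1 [c2 [_ [_ /(_ x y xy)[]]]]]] := HK. Qed.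

Lemma measurable_kernel : measurable_fun setT (fun z : X * X => K z.1 z.2).
Proof. by have [] := HK. Qed.

Definition jint (u : X -> R) (z : X * X) : R := `|u z.1 - u z.2| `^ p * K z.1 z.2.

(** The kernel is arbitrary on the diagonal, even in sign. The vanishing increment hides this, and
    the case of equal points is always settled here. *)
Lemma jint_diag u x : jint u (x, x) = 0.
Proof.
by rewrite /jint /= subrr normr0 powR0 ?mul0r// gt_eqF// (lt_trans _ p1).
Qed.

Lemma jint_ge0 u (z : X * X) : 0 <= jint u z.
Proof.
case: z => x y; have [->|/eqP xy] := eqVneq x y; first by rewrite jint_diag.
by rewrite mulr_ge0// ?powR_ge0// ltW// kernel_gt0.
Qed.

Lemma measurable_jint u : measurable_fun setT u -> measurable_fun setT (jint u).
Proof.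
move=> mu; apply: measurable_funM; last exact: measurable_kernel.
apply: measurable_norm_powR; apply: measurable_funB.
  exact: (measurableT_comp mu measurable_fst).
exact: (measurableT_comp mu measurable_snd).
Qed.

(** On the annulus at distance about [2 ^ n * t], doubling cancels the volumes and the growth of [U]
    leaves [2 ^ (n * (g - b1))], summable since [g < b1]. The weight [g = 0] serves the [L^p] bound
    of far jumps, [g > 0] the Hoelder bound of cutoff functions. *)
Lemma far_kernel (g : R) : 0 <= g < b1 -> exists C, 0 < C /\ forall x t, 0 < t ->
  (\int[m]_(y in [set y | (t <= dist x y)%R]) (dist x y `^ g * K x y)%:E <=
    (C * (t `^ g / U t))%:E)%E.
Proof.
move=> /andP[g0 gb]; have [C1 b10 U0 Ul Uu] := HU.
have C0 : 0 < CU by rewrite (lt_le_trans _ C1).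
have [k1 [k2 [k10 k20 Kl Ku]]] := kernel_bounds.
have [D HD] := VD_scale SS VDm; have [D1 {}HD] := HD 2.
have D0 : 0 < D 2 by rewrite (lt_le_trans _ D1).
pose l : R := 2 `^ (g - b1).
have l0 : 0 < l by rewrite powR_gt0.
have l1 : l < 1.
  rewrite /l -(opprB b1) powRN invf_lt1 ?powR_gt0//.
  have := @gt0_ltr_powR R (b1 - g) _ 1 2; rewrite powR1 !nnegrE; apply => //.
    by rewrite subr_gt0.
  by rewrite ltr1n.
pose C := 2 `^ g * k2 * D 2 * CU.
have CC : 0 < C by rewrite !mulr_gt0// powR_gt0.
exists (C / (1 - l)); split; first by rewrite divr_gt0// subr_gt0.
move=> x t t0.
pose A n := [set y | 2 ^+ n * t <= dist x y < 2 ^+ n.+1 * t].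
have md := measurable_mdist_l SS x.
have mA n : measurable (A n).
  rewrite (_ : A n = [set y | 2 ^+ n * t <= dist x y] `&`
    [set y | dist x y < 2 ^+ n.+1 * t]); last first.
    by apply/seteqP; split => [y /andP[? ?]//|y [/= ? ?]]; apply/andP.
  by apply: measurableI; [exact: measurable_set_le|exact: measurable_set_lt].
have mK : measurable_fun setT (K x).
  have := measurableT_comp measurable_kernel (measurable_pair1 x); exact.
have mf : measurable_fun setT (fun y => (dist x y `^ g * K x y)%:E).
  apply/measurable_EFinP; apply: measurable_funM => //.
  exact: (measurableT_comp (measurable_powR g) md).
pose D0' := [set y | t <= dist x y].
have mD0 : measurable D0'.
  exact: measurable_set_le.
have xNy y s : 0 < s -> s <= dist x y -> x <> y.
  by move=> s0 sy xy; move: (lt_le_trans s0 sy); rewrite xy (mdistxx SS) ltxx.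
(* Restricting to [D0'] makes the integrand nonnegative everywhere; at [y = x] the sign of the
   kernel is unknown. *)
pose f := (fun y => (dist x y `^ g * K x y)%:E) \_ D0'.
have f0 y : (0 <= f y)%E.
  rewrite /f /patch; case: ifPn => // /set_mem /= ty.
  by rewrite lee_fin mulr_ge0 ?powR_ge0// ltW// kernel_gt0//; exact: xNy ty.
have mf' : measurable_fun setT f.
  apply/(measurable_restrict _ mD0 measurableT); rewrite setTI.
  exact: measurable_funTS.
rewrite (_ : integral _ _ _ = \int[m]_(y in D0') f y)%E; last first.
  by apply: eq_integral => y yD; rewrite /f /patch yD.
apply: le_trans (integral_cover_le m mA mf' f0 _) _.
  move=> y /= ty; have a1 : 1 <= dist x y / t by rewrite ler_pdivlMr// mul1r.
  have [n /andP[na an]] := dyadic_bracket a1; exists n => //.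
  by rewrite /A/= -ler_pdivlMr// -ltr_pdivrMr// na an.
rewrite mulrAC.
have Cg : 0 <= C * (t `^ g / U t).
  by apply: mulr_ge0; [exact: ltW|apply: divr_ge0; [exact: powR_ge0|rewrite ltW// U0]].
have l01 : 0 <= l < 1 by rewrite ltW.
apply: le_trans (nneseries_geometric_le Cg l01).
apply: lee_nneseries => n *; first exact: integral_ge0.
  have pn : 0 < (2 : R) ^+ n by rewrite exprn_gt0.
  have pt : 0 < 2 ^+ n * t by rewrite mulr_gt0.
  pose c := (2 ^+ n.+1 * t) `^ g * (k2 / (V x (2 ^+ n * t) * U (2 ^+ n * t))).
  have c0 : 0 <= c.
    rewrite mulr_ge0 ?powR_ge0// divr_ge0 ?ltW// mulr_gt0 ?U0//.
    exact: (vol_gt0 SS).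
  apply: (@le_trans _ _ (\int[m]_(y in A n) cst c%:E y)%E).
    apply: ge0_le_integral_nomeas => // y /andP[yl yu].
    rewrite /f /patch; case: ifPn => _; last by rewrite lee_fin.
    rewrite lee_fin ler_pM ?powR_ge0//.
    + by rewrite ltW// kernel_gt0//; exact: xNy yl.
    + by apply: le_powR2 => //; [exact: (mdist_ge0 SS)|exact: ltW].
    + exact: Ku.
  rewrite integral_cst//.
  apply: (@le_trans _ _ (c%:E * (V x (2 ^+ n.+1 * t))%:E)%E).
    apply: lee_wpmul2l; first by rewrite lee_fin.
    rewrite -(volE SS); apply: le_measure; rewrite ?inE//.
    + exact: (measurable_dball SS).
    + by move=> y /andP[].
  rewrite -EFinM lee_fin /c.
  have Vx0 : 0 < V x (2 ^+ n * t) by exact: (vol_gt0 SS).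
  have HV := HD x _ pt; rewrite mulrA -exprS in HV.
  apply: (@le_trans _ _ ((2 ^+ n.+1 * t) `^ g * (k2 / (V x (2 ^+ n * t) * U (2 ^+ n * t))) *
                  (D 2 * V x (2 ^+ n * t)))).
    by apply: ler_wpM2l HV.
  have -> : (2 ^+ n.+1 * t) `^ g * (k2 / (V x (2 ^+ n * t) * U (2 ^+ n * t))) *
     (D 2 * V x (2 ^+ n * t)) =
     (2 ^+ n.+1 * t) `^ g * k2 * D 2 / U (2 ^+ n * t).
    by field; rewrite !gt_eqF//= U0.
  rewrite ler_pdivrMr ?U0//.
  have tt : t <= 2 ^+ n * t by apply: ler_peMl; [exact: ltW|rewrite exprn_ege1// ler1n].
  have := Ul _ _ t0 tt; rewrite mulfK ?gt_eqF// => UU.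
  have E1 : (2 ^+ n.+1 * t) `^ g = 2 `^ g * (2 ^+ n) `^ g * t `^ g.
    by rewrite exprS !powRM ?mulr_ge0 ?exprn_ge0// ltW.
  have E2 : l ^+ n = (2 ^+ n) `^ g / (2 ^+ n) `^ b1.
    rewrite /l -powR_mulrn ?powR_ge0// -powRrM -(powR_mulrn n (ler0n R 2)) -!powRrM.
    rewrite -powRB; last by rewrite pnatr_eq0 implybT.
    by congr (_ `^ _); ring.
  rewrite E1 E2 /C.
  have P2 : 0 < (2 ^+ n : R) `^ b1 by rewrite powR_gt0.
  have -> : 2 `^ g * k2 * D 2 * CU * (t `^ g / U t) * ((2 ^+ n) `^ g / (2 ^+ n) `^ b1) *
     U (2 ^+ n * t) =
     (2 `^ g * (2 ^+ n) `^ g * t `^ g * k2 * D 2) *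
     ((CU * U (2 ^+ n * t)) / (U t * (2 ^+ n) `^ b1)).
    by field; rewrite !gt_eqF//= U0.
  apply: ler_peMr; first by rewrite !mulr_ge0 ?powR_ge0// ltW.
  by rewrite ler_pdivlMr ?mulr_gt0 ?U0// mul1r.
Qed.

End kernels.

(** * Double integrals and mean values *)

Section product_integrals.
Context {d} {T : measurableType d} {R : realType}.
Variable m : {sigma_finite_measure set T -> \bar R}.
Local Open Scope ereal_scope.
Implicit Types (f : T * T -> \bar R) (S : set (T * T)) (A B : set T).

Lemma prod_integralE f S : measurable S -> measurable_fun setT f ->
  (forall z, 0 <= f z) ->
  \int[m \x m]_(z in S) f z = \int[m]_x \int[m]_y (f \_ S) (x, y).
Proof.
move=> mS mf f0; rewrite integral_mkcond fubini_tonelli1//.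
  by apply/(measurable_restrict _ mS measurableT); rewrite setTI; exact: measurable_funTS.
by move=> z; rewrite /patch; case: ifP.
Qed.

Lemma prod_integral_setX f A B : measurable A -> measurable B ->
  measurable_fun setT f -> (forall z, 0 <= f z) ->
  \int[m \x m]_(z in A `*` B) f z = \int[m]_(x in A) \int[m]_(y in B) f (x, y).
Proof.
move=> mA mB mf f0; rewrite prod_integralE; [|exact: measurableX|exact: mf|exact: f0].
rewrite [RHS]integral_mkcond; apply: eq_integral => x _.
rewrite {2}/patch; case: ifPn => xA.
  rewrite [RHS]integral_mkcond; apply: eq_integral => y _.
  by rewrite /patch in_setX/= xA.
rewrite integral0_eq// => y _; rewrite /patch in_setX/=.
by rewrite (negbTE xA).
Qed.

Lemma prod_integral_swap f : measurable_fun setT f -> (forall z, 0 <= f z) ->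
  \int[m \x m]_z f (z.2, z.1) = \int[m \x m]_z f z.
Proof.
move=> mf f0; rewrite (fubini_tonelli1 f)// fubini_tonelli2//.
by apply: measurableT_comp => //; exact: measurable_swap.
Qed.

(** If [h] exceeded its mean throughout [A], the difference [k] would be positive on a set of
    positive measure and yet have integral 0. *)
Lemma exists_le_mean A (h : T -> \bar R) : measurable A -> 0 < m A -> m A < +oo ->
  measurable_fun setT h -> (forall x, 0 <= h x) ->
  exists2 x, A x & m A * h x <= \int[m]_(x in A) h x.
Proof.
move=> mA A0 Aoo mh h0; apply: contrapT => H.
have {}H x : A x -> \int[m]_(x in A) h x < m A * h x.
  by move=> Ax; rewrite ltNge; apply/negP => hx; apply: H; exists x.
have [x0 Ax0] : A !=set0.
  by apply/set0P/negP => /eqP A00; move: A0; rewrite A00 measure0 ltxx.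
have I0 : 0 <= \int[m]_(x in A) h x by exact: integral_ge0.
have Ifin : \int[m]_(x in A) h x \is a fin_num.
  by rewrite ge0_fin_numE// (lt_le_trans (H _ Ax0))// leey.
have Afin : m A \is a fin_num by rewrite ge0_fin_numE.
have a0 : (0 < fine (m A))%R by rewrite fine_gt0// A0.
pose c := (fine (\int[m]_(x in A) h x) / fine (m A))%R.
have cm : c%:E * m A = \int[m]_(x in A) h x.
  by rewrite -{1}(fineK Afin) -EFinM /c divfK ?gt_eqF// fineK.
have hc x : A x -> c%:E < h x.
  move=> Ax; have := H _ Ax; rewrite -cm [c%:E * _]muleC -(fineK Afin).
  by rewrite lte_pmul2l ?lte_fin.
pose k x := h x - c%:E.
have mk : measurable_fun A k.
  by apply: emeasurable_funB => //; exact: measurable_funTS.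
have k0 x : A x -> 0 <= k x by move=> Ax; rewrite sube_ge0// ltW// hc.
have c0 : (0 <= c)%R by rewrite divr_ge0 ?fine_ge0// ltW.
have Ik : \int[m]_(x in A) h x = \int[m]_(x in A) h x + \int[m]_(x in A) k x.
  rewrite -{2}cm -integral_cst// -ge0_integralD//.
    by apply: eq_integral => x _; rewrite /= addeC subeK.
have {}Ik : \int[m]_(x in A) `|k x| = 0.
  rewrite (eq_integral k); last by move=> x /set_mem Ax; rewrite gee0_abs// k0.
  move: Ik; rewrite -(fineK Ifin); move: (\int[m]_(x in A) k x) (integral_ge0 m k0).
  move: (fine _) => a; case=> [r| |]//= _ [ar]; congr EFin; lra.
have [N [mN N0 AN]] := (ae_eq_integral_abs m mA mk).1 Ik.
suff : m A <= 0 by rewrite leNgt A0.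
rewrite -N0; apply: le_measure; rewrite ?inE// => x Ax; apply: AN => /= /(_ Ax).
by move/eqP; rewrite gt_eqF// /k sube_gt0 hc.
Qed.

Lemma measurable_fun_diff (u : T -> R) : measurable_fun setT u ->
  measurable_fun setT (fun z : T * T => (u z.1 - u z.2)%R).
Proof.
move=> mu; apply: measurable_funB.
  exact: (measurableT_comp mu measurable_fst).
exact: (measurableT_comp mu measurable_snd).
Qed.

(** Passing through a constant [c] turns the one-variable oscillation of a Poincare inequality into
    a bound for a double integral. *)
Lemma prod_oscillation_le p (u : T -> R) (c : R) B : (1 <= p)%R ->
  measurable_fun setT u -> measurable B -> m B < +oo ->
  \int[m \x m]_(z in B `*` B) (`|u z.1 - u z.2| `^ p)%:E <=
  (2 * 2 `^ p)%:E * (m B * \int[m]_(x in B) (`|u x - c| `^ p)%:E).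
Proof.
move=> p1 mu mB Boo.
have Bfin : m B \is a fin_num by rewrite ge0_fin_numE.
pose g x : \bar R := (`|u x - c| `^ p)%:E.
have g0 x : 0 <= g x by rewrite lee_fin powR_ge0.
have mg : measurable_fun setT g.
  exact: (measurable_EFin_norm_powR p (measurable_funB mu (measurable_cst c))).
have mgB : measurable_fun B g by exact: measurable_funTS.
rewrite prod_integral_setX//; last first.
  exact: (measurable_EFin_norm_powR p (measurable_fun_diff mu)).
set I := \int[m]_(x in B) g x.
have I0 : 0 <= I by exact: integral_ge0.
apply: (@le_trans _ _ (\int[m]_(x in B) ((2 `^ p)%:E * (g x * m B + I)))).
  apply: ge0_le_integral_nomeas => x Bx.
    by apply: integral_ge0 => y _; rewrite lee_fin powR_ge0.
  apply: (@le_trans _ _ (\int[m]_(y in B) ((2 `^ p)%:E * (g x + g y)))).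
    apply: ge0_le_integral_nomeas => y By; first by rewrite lee_fin powR_ge0.
    rewrite /g -EFinD -EFinM lee_fin.
    have -> : (u (x, y).1 - u (x, y).2 = (u x - c) + - (u y - c))%R by rewrite /=; ring.
    by rewrite -(normrN (u y - c)%R) powR_normD_le.
  have my : measurable_fun B (fun y => g x + g y).
    by apply: emeasurable_funD => //; exact: measurable_cst.
  rewrite ge0_integralZl_EFin ?powR_ge0//; last by move=> y _; rewrite adde_ge0.
  by rewrite ge0_integralD// -/I integral_cst.
have mgm : measurable_fun B (fun x => g x * m B).
  by apply: emeasurable_funM => //; exact: measurable_cst.
have mgI : measurable_fun B (fun x => g x * m B + I).
  by apply: emeasurable_funD => //; exact: measurable_cst.
have gm0 x : 0 <= g x * m B by exact: mule_ge0.
rewrite ge0_integralZl_EFin ?powR_ge0//; last by move=> x _; exact: adde_ge0.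
rewrite ge0_integralD//.
rewrite (ge0_integralZr m mB mgB)// -/I integral_cst//.
rewrite [in leRHS]mulrC EFinM -muleA lee_wpmul2l ?lee_fin ?powR_ge0//.
by rewrite (muleC I) -mule2n mule_natl.
Qed.

End product_integrals.

Section greedy.
Variable e : nat -> nat -> bool.

(** Indices are scanned in increasing order, and one is kept when [e] relates it to all those kept
    before. Along a dense sequence this yields a maximal separated set without Zorn's lemma. *)
Fixpoint greedy_seq (n : nat) : seq nat :=
  if n is n'.+1 then
    if all (e^~ n') (greedy_seq n') then n' :: greedy_seq n' else greedy_seq n'
  else [::].

Definition greedy (n : nat) : bool := all (e^~ n) (greedy_seq n).

Lemma mem_greedy_seq n k : (k \in greedy_seq n) = (k < n)%N && greedy k.
Proof.
elim: n => [|n IH]; first by rewrite in_nil ltn0.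
rewrite /=; case: ifPn => [gn|gn].
  rewrite inE IH ltnS [(k <= n)%N]leq_eqVlt; case: eqVneq => [->|_] //=.
rewrite IH ltnS [(k <= n)%N]leq_eqVlt; case: eqVneq => [->|_] //=.
by rewrite ltnn /= /greedy (negbTE gn).
Qed.

Lemma greedy_sep i j : (i < j)%N -> greedy i -> greedy j -> e i j.
Proof.
by move=> ij gi /allP; apply; rewrite mem_greedy_seq ij.
Qed.

Lemma greedy_cover n : greedy n \/ exists2 k, greedy k & ~~ e k n.
Proof.
have [gn|/allPn[k kn ne]] := boolP (greedy n); [by left|right].
by exists k => //; move: kn; rewrite mem_greedy_seq => /andP[].
Qed.

End greedy.

Section nets.
Context {R : realType} {d0 : measure_display} {X : measurableType d0}.
Variables (dist : X -> X -> R) (m : {sigma_finite_measure set X -> \bar R}).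
Hypothesis SS : standing_setting dist m.
Hypothesis VDm : VD dist m.

(** Greedy selection of [e / 2]-separated points from a dense sequence. The balls of radius [e / 4]
    around them are disjoint, so comparing volumes bounds their number near [x]. The overlap bound
    [N] is found before the mesh and does not depend on it. *)
Lemma exists_net : exists N : R -> R, (forall L, 0 <= N L) /\
  forall e, 0 < e -> exists (c : nat -> X) (s : pred nat),
    (forall x, exists2 i, s i & dist (c i) x < e) /\
    forall L x n, 0 <= L -> \sum_(i < n | s i && (dist (c i) x < L * e)) 1 <= N L.
Proof.
have [D HD] := VD_scale SS VDm.
(* If [dist (q i) x < L * e], the ball of radius [(L + 1) * e] around [x] lies in that of radius
   [(2 * L + 1) * e] around [q i], which is [4 * (2 * L + 1)] times [e / 4]. *)
exists (fun L => D (4 * (2 * L + 1))); split.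
  by move=> L; have [+ _] := HD (4 * (2 * L + 1)); exact: le_trans.
move=> e e0; have [q dq] := exists_dense_seq SS.
have e2 : 0 < e / 2 by rewrite divr_gt0.
have e4 : 0 < e / 4 by rewrite divr_gt0.
pose sep i j := e / 2 <= dist (q i) (q j).
exists q, (greedy sep); split.
  move=> x; have [n xn] := dq x _ e2; rewrite (mdistC SS) in xn.
  have [gn|[k gk]] := greedy_cover sep n.
    by exists n => //; apply: lt_le_trans xn _; rewrite ler_pdivrMr// ler_peMr ?ltW// ltr1n.
  rewrite -ltNge => kn; exists k => //.
  by have := mdist_tri SS (q n) (q k) x; lra.
move=> L x n L0; set P := fun i : nat => greedy sep i && (dist (q i) x < L * e).
have V0 : 0 < vol dist m x ((L + 1) * e) by rewrite (vol_gt0 SS)// mulr_gt0// ltr_wpDl.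
set D' := D _.
have D0 : 0 < D' by have [+ _] := HD (4 * (2 * L + 1)); exact: lt_le_trans.
rewrite -(ler_pM2r V0).
apply: (@le_trans _ _ (\sum_(i < n | P i) D' * vol dist m (q i) (e / 4))).
  rewrite mulr_suml; apply: ler_sum => i /andP[_ ix]; rewrite mul1r.
  have [_ H] := HD (4 * (2 * L + 1)); apply: le_trans (H (q i) _ e4).
  by apply: (vol_sub SS); lra.
rewrite -mulr_sumr ler_pM2l// -lee_fin -sumEFin.
rewrite (eq_bigr (fun i : 'I_n => m (dball dist (q i) (e / 4)))); last first.
  by move=> i _; rewrite (volE SS).
rewrite -(measure_bigsetU_ord_cond m (P := fun i : 'I_n => P i)); last 2 first.
- by move=> i _; exact: (measurable_dball SS).
- move=> i j /andP[gi _] /andP[gj _] [z [/= zi zj]]; apply: contrapT => ij.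
  have S : e / 2 <= dist (q i) (q j).
    have : i != j :> nat by apply/eqP => ij'; apply: ij; exact: val_inj.
    rewrite neq_ltn => /orP[lt_ij|lt_ji]; first exact: (@greedy_sep sep i j).
    by rewrite (mdistC SS); exact: (@greedy_sep sep j i).
  have := mdist_tri SS z (q i) (q j); rewrite (mdistC SS z (q j)).
  by rewrite /dball /= in zi zj; lra.
rewrite -(volE SS); apply: le_measure; rewrite ?inE.
- by apply: bigsetU_measurable => i _; exact: (measurable_dball SS).
- exact: (measurable_dball SS).
- elim/big_ind: _ => [z []|A1 A2 s1 s2 z [/s1|/s2]//|i /andP[_ ix] z /= zi].
  have := mdist_tri SS (q i) x z; rewrite (mdistC SS x (q i)).
  by rewrite /dball /= in zi *; lra.
Qed.

End nets.

(** * The non-local form is a p-energy *)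

Section jump_energy.
Context {R : realType} {d0 : measure_display} {X : measurableType d0}.
Variables (dist : X -> X -> R) (m : {sigma_finite_measure set X -> \bar R}).
Hypothesis SS : standing_setting dist m.

Variables (p : R) (U : R -> R) (K : X -> X -> R) (CU b1 b2 : R).
Hypothesis p1 : 1 < p.
Hypothesis HU : scale_bounds U CU b1 b2.
Hypothesis HK : jump_kernel dist m U K.
Implicit Types (u v f g : X -> R) (z : X * X).

Local Notation J := (jint p K).
Let P : {measure set (X * X) -> \bar R} := (m \x m)%E.

Let p0 : 0 < p. Proof. by rewrite (lt_trans _ p1). Qed.

Let pn0 : p != 0. Proof. exact: lt0r_neq0. Qed.

Lemma measurable_EFin_jint u : measurable_fun setT u ->
  measurable_fun setT (fun z => (J u z)%:E).
Proof. by move=> mu; apply/measurable_EFinP; exact: (measurable_jint p HK mu). Qed.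

Lemma EFin_jint_ge0 u z : (0 <= (J u z)%:E)%E.
Proof. by rewrite lee_fin; exact: (jint_ge0 SS p1 HU HK). Qed.

Lemma GammaJE u A : measurable_fun setT u -> measurable A ->
  (GammaJ m p K u A = \int[m \x m]_(z in A `*` setT) (J u z)%:E)%E.
Proof.
move=> mu mA; rewrite prod_integral_setX//.
- exact: measurable_EFin_jint.
- by move=> z; exact: EFin_jint_ge0.
Qed.

Lemma GammaJTE u : measurable_fun setT u ->
  (GammaJ m p K u setT = \int[m \x m]_z (J u z)%:E)%E.
Proof. by move=> mu; rewrite GammaJE// setXTT. Qed.

(* [jdiff] embeds the jump energy isometrically into [L^p] of the product
   space; the truncation of [K] only concerns its arbitrary diagonal values. *)
Definition jdiff u z : R := (u z.1 - u z.2) * (Num.max (K z.1 z.2) 0) `^ p^-1.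

Lemma measurable_jdiff u : measurable_fun setT u -> measurable_fun setT (jdiff u).
Proof.
move=> mu; apply: measurable_funM; first exact: measurable_fun_diff.
apply: (measurableT_comp (measurable_powR p^-1)).
apply: measurable_maxr; first exact: (measurable_kernel HK).
exact: measurable_cst.
Qed.

Lemma norm_jdiff u z : `|jdiff u z| `^ p = J u z.
Proof.
rewrite /jdiff normrM powRM// (ger0_norm (powR_ge0 _ _)) powRV_powR//; last first.
  by rewrite le_max lexx orbT.
case: z => x y /=; have [->|/eqP xy] := eqVneq x y.
  by rewrite jint_diag// subrr normr0 powR0// mul0r.
rewrite /jint /=; congr (_ * _); apply/max_idPl; rewrite ltW//.
exact: (kernel_gt0 SS HU HK).
Qed.

Lemma GammaJ_jdiff u : measurable_fun setT u ->
  (GammaJ m p K u setT = \int[P]_z (`|jdiff u z| `^ p)%:E)%E.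
Proof.
move=> mu; rewrite GammaJTE//; apply: eq_integral => z _.
by rewrite norm_jdiff.
Qed.

Lemma FJP u : FJ m p K u <-> Lp_fun m p u /\ Lp_fun P p (jdiff u).
Proof.
split=> [[Lu uoo]|[Lu [mj joo]]].
  split; first exact: Lu.
  split; first exact: measurable_jdiff (proj1 Lu).
  rewrite -(GammaJ_jdiff (proj1 Lu)); exact: uoo.
by split; [exact: Lu|rewrite (GammaJ_jdiff (proj1 Lu)); exact: joo].
Qed.

Lemma EJE u : measurable_fun setT u -> EJ m p K u = Lp_pow P p (jdiff u).
Proof. by move=> mu; rewrite /EJ GammaJ_jdiff. Qed.

Lemma jdiffD u v : jdiff (fun x => u x + v x) = (fun z => jdiff u z + jdiff v z).
Proof. by apply/funext => z; rewrite /jdiff; ring. Qed.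

Lemma jdiffB u v : jdiff (fun x => u x - v x) = (fun z => jdiff u z - jdiff v z).
Proof. by apply/funext => z; rewrite /jdiff; ring. Qed.

Lemma jdiffZ a u : jdiff (fun x => a * u x) = (fun z => a * jdiff u z).
Proof. by apply/funext => z; rewrite /jdiff; ring. Qed.

Lemma FJD u v : FJ m p K u -> FJ m p K v -> FJ m p K (fun x => u x + v x).
Proof.
move=> /FJP[Lu Ju] /FJP[Lv Jv]; apply/FJP; split.
  exact: (Lp_funD (ltW p1) Lu Lv).
by rewrite jdiffD; exact: (Lp_funD (ltW p1) Ju Jv).
Qed.

Lemma FJB u v : FJ m p K u -> FJ m p K v -> FJ m p K (fun x => u x - v x).
Proof.
move=> /FJP[Lu Ju] /FJP[Lv Jv]; apply/FJP; split.
  exact: (Lp_funB (ltW p1) Lu Lv).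
by rewrite jdiffB; exact: (Lp_funB (ltW p1) Ju Jv).
Qed.

Lemma prod_ae (Q : X -> Prop) : {ae m, forall x, Q x} ->
  {ae P, forall z, Q z.1 /\ Q z.2}.
Proof.
move=> [N [mN N0 QN]]; exists ((N `*` setT) `|` (setT `*` N)); split.
- by apply: measurableU; exact: measurableX.
- apply/eqP; rewrite eq_le measure_ge0 andbT.
  apply: le_trans (measureU2 _ _ _) _; [exact: measurableX|exact: measurableX|].
  have E1 : (P (N `*` setT) <= 0)%E.
    apply: (@le_trans _ _ (m N * m setT)%E); last by rewrite N0 mul0e.
    have /eqP := product_measure1E m m mN measurableT.
    by rewrite eq_le => /andP[].
  have E2 : (P (setT `*` N) <= 0)%E.
    apply: (@le_trans _ _ (m setT * m N)%E); last by rewrite N0 mule0.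
    have /eqP := product_measure1E m m measurableT mN.
    by rewrite eq_le => /andP[].
  apply: (@le_trans _ _ (0 + 0)%E); last by rewrite adde0.
  exact: leeD E1 E2.
- move=> [x y] /= H; have [Qx|nQx] := pselect (Q x); last first.
    by left; split => //; apply: QN.
  right; split => //; apply: QN => Qy; exact: H.
Qed.

Lemma EJ_ae f g : FJ m p K f -> measurable_fun setT g ->
  {ae m, forall x, f x = g x} -> FJ m p K g /\ EJ m p K g = EJ m p K f.
Proof.
move=> /FJP[[mf Lf] [mjf Jf]] mg fg.
have mjg := measurable_jdiff mg.
have jfg : {ae P, forall z, jdiff f z = jdiff g z}.
  have [N [mN N0 sub]] := prod_ae fg; exists N; split => //.
  by apply: subset_trans sub => z /= H [E1 E2]; apply: H; rewrite /jdiff E1 E2.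
have I := Lp_int_ae p mf mg fg; have J := Lp_int_ae p mjf mjg jfg.
split; last by rewrite (EJE mf) (EJE mg) /Lp_pow J.
apply/FJP; split; split; [exact: mg|rewrite I; exact: Lf|exact: mjg|].
by rewrite J; exact: Jf.
Qed.

Lemma is_pform_jump : is_pform m p (FJ m p K) (EJ m p K).
Proof.
have mF f : FJ m p K f -> measurable_fun setT f by move=> [[]].
split; first by move=> f [].
split.
  apply/FJP; split; first exact: Lp_fun0.
  have -> : jdiff (fun=> 0) = (fun=> 0).
    by apply/funext => z; rewrite /jdiff subrr mul0r.
  exact: Lp_fun0.
split; first exact: FJD.
split.
  move=> a f /FJP[Lf Jf]; apply/FJP; split; first exact: Lp_funZ.
  by rewrite jdiffZ; exact: Lp_funZ.
split; first exact: EJ_ae.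
split.
  by move=> f Ff; rewrite EJE; [exact: Lp_pow_ge0|exact: mF].
split.
  move=> a f Ff; have /FJP[Lf Jf] := Ff.
  rewrite (EJE (mF _ Ff)) (EJE (proj1 (Lp_funZ a Lf))).
  by rewrite jdiffZ (Lp_powZ a Jf).
move=> f g Ff Fg; have /FJP[Lf Jf] := Ff; have /FJP[Lg Jg] := Fg.
rewrite (EJE (mF _ Ff)) (EJE (mF _ Fg)) (EJE (mF _ (FJD Ff Fg))) jdiffD.
exact: (Lp_pow_minkowski (ltW p1) Jf Jg).
Qed.

Lemma clarkson_jump : clarkson p (FJ m p K) (EJ m p K).
Proof.
move=> f g Ff Fg; have /FJP[Lf Jf] := Ff; have /FJP[Lg Jg] := Fg.
have mF h : FJ m p K h -> measurable_fun setT h by move=> [[]].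
rewrite (EJE (mF _ Ff)) (EJE (mF _ Fg)) (EJE (mF _ (FJD Ff Fg))).
rewrite (EJE (mF _ (FJB Ff Fg))) jdiffD jdiffB.
exact: (Lp_clarkson p1 Jf Jg).
Qed.

Lemma markovian_jump (phi : R -> R) : phi 0 = 0 ->
  (forall s t, `|phi s - phi t| <= `|s - t|) ->
  forall f, FJ m p K f -> FJ m p K (phi \o f) /\ EJ m p K (phi \o f) <= EJ m p K f.
Proof.
move=> phi0 phiL f Ff; have /FJP[Lf Jf] := Ff; have mf := proj1 Lf.
have cphi : continuous phi.
  move=> x; apply/cvgrPdist_lt => e e0; near=> y.
  by apply: le_lt_trans (phiL x y) _; near: y; exact: cvgr_dist_lt.
have mphi : measurable_fun setT phi by exact: continuous_measurable_fun.
have mpf : measurable_fun setT (phi \o f) by exact: measurableT_comp.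
have [L1 _] : Lp_fun m p (phi \o f) /\ Lp_pow m p (phi \o f) <= Lp_pow m p f.
  apply: (Lp_fun_le (ltW p0) mpf Lf) => x /=.
  by have := phiL (f x) 0; rewrite phi0 !subr0.
have [J1 J2] : Lp_fun P p (jdiff (phi \o f)) /\
    Lp_pow P p (jdiff (phi \o f)) <= Lp_pow P p (jdiff f).
  apply: (Lp_fun_le (ltW p0) (measurable_jdiff mpf) Jf) => z.
  by rewrite /jdiff !normrM; apply: ler_wpM2r => //; exact: phiL.
split; first by apply/FJP; split; [exact: L1|exact: J1].
by rewrite (EJE mf) (EJE mpf); exact: J2.
Unshelve. all: by end_near. Qed.

(** The limit [v] is found on [X] alone. Fatou's lemma with [u n] fixed, applied on [X] and on the
    product space along the same subsequence, carries both Cauchy estimates over to [v]; no limit in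
    [L^p] of the product has to be identified. *)
Lemma complete_jump (u : nat -> X -> R) : (forall n, FJ m p K (u n)) ->
  (forall e, 0 < e -> exists N, forall n k, (N <= n)%N -> (N <= k)%N ->
     E1 m p (EJ m p K) (fun x => u n x - u k x) < e) ->
  exists v, FJ m p K v /\ forall e, 0 < e -> exists N, forall n, (N <= n)%N ->
     E1 m p (EJ m p K) (fun x => u n x - v x) < e.
Proof.
move=> Fu cu.
have mF h : FJ m p K h -> measurable_fun setT h by move=> [[]].
have mu n := mF _ (Fu n).
have FB n k := FJB (Fu n) (Fu k).
have cu' e : 0 < e -> exists N, forall n k, (N <= n)%N -> (N <= k)%N ->
    (\int[m]_x (`|u n x - u k x| `^ p)%:E < e%:E)%E /\
    (\int[P]_z (`|jdiff (u n) z - jdiff (u k) z| `^ p)%:E < e%:E)%E.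
  move=> e0; have [N HN] := cu _ e0; exists N => n k Nn Nk.
  have /FJP[LB JB] := FB n k; have := HN n k Nn Nk.
  rewrite /E1 (EJE (mF _ (FB n k))).
  have := Lp_pow_ge0 m p (fun x => u n x - u k x).
  have := Lp_pow_ge0 P p (jdiff (fun x => u n x - u k x)).
  rewrite (Lp_powE LB); move: (Lp_powE JB); rewrite {1}jdiffB => ->.
  rewrite !lte_fin; move: (Lp_pow _ _ _) (Lp_pow _ _ _) => a b a0 b0 ab.
  by split; lra.
have [v [phi [mv phik uv]]] : exists (v : X -> R) (phi : nat -> nat),
    [/\ measurable_fun setT v, forall k, (k <= phi k)%N &
    {ae m, forall x, u (phi n) x @[n --> \oo] --> v x}].
  apply: (Lp_cauchy_subseq p0 mu) => e e0; have [N HN] := cu' e e0.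
  by exists N => n k Nn Nk; have [] := HN n k Nn Nk.
have lim_le e : 0 < e -> exists N, forall n, (N <= n)%N ->
    (\int[m]_x (`|u n x - v x| `^ p)%:E <= e%:E)%E /\
    (\int[P]_z (`|jdiff (fun x => u n x - v x) z| `^ p)%:E <= e%:E)%E.
  move=> e0; have [N HN] := cu' e e0; exists N => n Nn.
  have uvN : {ae m, forall x, u (phi (k + N)%N) x @[k --> \oo] --> v x}.
    case: uv => A [mA A0 sub]; exists A; split => //.
    apply: subset_trans sub => x /= H1 H2; apply: H1.
    by apply: (cvg_comp _ _ (cvg_addnr N) H2).
  have phiN k : (N <= phi (k + N))%N by rewrite (leq_trans _ (phik _))// leq_addl.
  split.
    apply: (@Lp_fatou _ _ _ m p (fun k x => u n x - u (phi (k + N)%N) x)) => //.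
    - by move=> k; exact: measurable_funB.
    - exact: measurable_funB.
    - case: uvN => A [mA A0 sub]; exists A; split => //.
      apply: subset_trans sub => x /= H1 H2; apply: H1.
      by apply: cvgB => //; exact: cvg_cst.
    - by move=> k; apply: ltW; have [] := HN n _ Nn (phiN k).
  apply: (@Lp_fatou _ _ _ P p
    (fun k => jdiff (fun x => u n x - u (phi (k + N)%N) x))) => //.
  - by move=> k; apply: measurable_jdiff; exact: measurable_funB.
  - by apply: measurable_jdiff; exact: measurable_funB.
  - have [A [mA A0 sub]] := prod_ae uvN; exists A; split => //.
    apply: subset_trans sub => z /= H1 [H2 H3]; apply: H1.
    rewrite /jdiff; apply: cvgM; last exact: cvg_cst.
    by apply: cvgB; apply: cvgB => //; exact: cvg_cst.
  - move=> k; rewrite jdiffB; apply: ltW.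
    by have [] := HN n _ Nn (phiN k).
have FB' e n : (\int[m]_x (`|u n x - v x| `^ p)%:E <= e%:E)%E /\
    (\int[P]_z (`|jdiff (fun x => u n x - v x) z| `^ p)%:E <= e%:E)%E ->
    FJ m p K (fun x => u n x - v x).
  move=> [H1 H2]; apply/FJP; split; split.
  - exact: measurable_funB.
  - by apply: le_lt_trans H1 _; rewrite ltry.
  - by apply: measurable_jdiff; exact: measurable_funB.
  - by apply: le_lt_trans H2 _; rewrite ltry.
exists v; split.
  have [N HN] := lim_le 1 ltr01.
  have -> : v = (fun x => u N x - (u N x - v x)) by apply/funext => x; ring.
  by apply: FJB => //; apply: (FB' 1); exact: HN.
(* Fatou's lemma gives weak inequalities; two terms of size [e / 3] keep the sum strictly below
   [e]. *)
move=> e e0; have [N HN] := lim_le (e / 3) (divr_gt0 e0 (ltr0n R 3)).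
exists N => n Nn; have H := HN n Nn; have Fnv := FB' _ _ H.
have /FJP[LB JB] := Fnv; rewrite /E1 (EJE (mF _ Fnv)).
move: H; rewrite (Lp_powE LB) (Lp_powE JB) !lee_fin => -[H1 H2].
by move: (Lp_pow _ _ _) (Lp_pow _ _ _) H1 H2 => a b H1 H2; lra.
Qed.

Lemma is_penergy_jump :
  (forall f, Lp_fun m p f -> forall e, 0 < e ->
     exists g, FJ m p K g /\ Lp_pow m p (fun x => f x - g x) < e) ->
  is_penergy m p (FJ m p K) (EJ m p K).
Proof.
move=> dens; split; first exact: is_pform_jump.
split; first exact: dens.
split; first exact: complete_jump.
split; first exact: markovian_jump.
exact: clarkson_jump.
Qed.

End jump_energy.

(** * Near and far jumps; transfer of cutoff functions *)

Section jump_bounds.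
Context {R : realType} {d0 : measure_display} {X : measurableType d0}.
Variables (dist : X -> X -> R) (m : {sigma_finite_measure set X -> \bar R}).
Hypothesis SS : standing_setting dist m.
Hypothesis VDm : VD dist m.
Variables (p : R) (U : R -> R) (K : X -> X -> R) (CU b1 b2 : R).
Hypothesis p1 : 1 < p.
Hypothesis HU : scale_bounds U CU b1 b2.
Hypothesis HK : jump_kernel dist m U K.
Implicit Types (u v f g : X -> R) (z : X * X) (t : R) (S : set (X * X)).

Local Notation J := (jint p K).
Local Notation V := (vol dist m).

Definition near_set (A : set X) t : set (X * X) :=
  [set z | A z.1 /\ dist z.1 z.2 < t].
Definition far_set (A : set X) t : set (X * X) :=
  [set z | A z.1 /\ t <= dist z.1 z.2].

Lemma measurable_fst_set (A : set X) : measurable A ->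
  measurable [set z : X * X | A z.1].
Proof.
by move=> mA; have := @measurable_fst _ _ X X measurableT A mA; rewrite setTI.
Qed.

Lemma measurable_near A t : measurable A -> measurable (near_set A t).
Proof.
move=> mA; apply: measurableI; first exact: measurable_fst_set.
by apply: measurable_set_lt => //; exact: (measurable_mdist SS).
Qed.

Lemma measurable_far A t : measurable A -> measurable (far_set A t).
Proof.
move=> mA; apply: measurableI; first exact: measurable_fst_set.
by apply: measurable_set_le => //; exact: (measurable_mdist SS).
Qed.

Lemma GammaJ_near_far u A t : measurable_fun setT u -> measurable A ->
  (GammaJ m p K u A <= \int[m \x m]_(z in near_set A t) (J u z)%:E +
    \int[m \x m]_(z in far_set A t) (J u z)%:E)%E.
Proof.
move=> mu mA; rewrite (GammaJE SS p1 HU HK mu mA).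
apply: le_trans (integral_setU_le _ (measurable_near t mA) (measurable_far t mA)
  (measurable_EFin_jint p HK mu) (EFin_jint_ge0 SS p1 HU HK u)).
apply: integral_setS; first exact: (EFin_jint_ge0 SS p1 HU HK).
by move=> [x y] [/= Ax _]; case: (ltP (dist x y) t) => h; [left|right].
Qed.

Lemma far_set_kernel_ge0 A t z : 0 < t -> far_set A t z -> 0 <= K z.1 z.2.
Proof.
move=> t0 [_ tz]; rewrite ltW// (kernel_gt0 SS HU HK)// => zz.
by move: (lt_le_trans t0 tz); rewrite zz (mdistxx SS) ltxx.
Qed.

Lemma measurable_dist_powR_kernel (g : R) :
  measurable_fun setT (fun z => dist z.1 z.2 `^ g * K z.1 z.2).
Proof.
apply: measurable_funM; last exact: (measurable_kernel HK).
exact: (measurableT_comp (measurable_powR g) (measurable_mdist SS)).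
Qed.

Lemma far_weighted (g : R) : 0 <= g < b1 -> exists C, 0 < C /\
  forall (h : X -> R) A t, 0 < t -> measurable A -> measurable_fun setT h ->
  (forall x, 0 <= h x) ->
  (\int[m \x m]_(z in far_set A t) (h z.1 * (dist z.1 z.2 `^ g * K z.1 z.2))%:E <=
   (C * (t `^ g / U t))%:E * \int[m]_(x in A) (h x)%:E)%E.
Proof.
move=> gb; have [C [C0 HC]] := far_kernel SS VDm HU HK gb.
have [_ _ U0 _ _] := HU.
exists C; split => // h A t t0 mA mh h0.
pose F z := ((h z.1 * (dist z.1 z.2 `^ g * K z.1 z.2))%:E).
have mF : measurable_fun setT F.
  apply/measurable_EFinP; apply: measurable_funM; last exact: measurable_dist_powR_kernel.
  exact: (measurableT_comp mh measurable_fst).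
pose F' := F \_ (far_set A t).
have mf := measurable_far t mA.
have mF' : measurable_fun setT F'.
  by apply/(measurable_restrict _ mf measurableT); rewrite setTI; exact: measurable_funTS.
have F0 z : (0 <= F' z)%E.
  rewrite /F' /patch; case: ifPn => // /set_mem zf.
  by rewrite lee_fin mulr_ge0// mulr_ge0 ?powR_ge0//; exact: far_set_kernel_ge0 zf.
rewrite integral_mkcond (fubini_tonelli1 F' mF' F0).
have c0 : 0 <= C * (t `^ g / U t).
  by apply: mulr_ge0; [exact: ltW|apply: divr_ge0; [exact: powR_ge0|exact/ltW/U0]].
rewrite -ge0_integralZl_EFin//; last 2 first.
- by move=> x _; rewrite lee_fin.
- by apply/measurable_EFinP; exact: measurable_funTS.
rewrite [leRHS]integral_mkcond; apply: ge0_le_integral_nomeas => x _.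
  by apply: integral_ge0 => y _; exact: F0.
rewrite /fubini_F /patch; case: ifPn => [/set_mem Ax|/negP nAx]; last first.
  rewrite integral0_eq// => y _; rewrite /F' /patch.
  by case: ifPn => // /set_mem [/= Ax _]; exfalso; apply: nAx; exact: mem_set.
apply: (@le_trans _ _ (\int[m]_(y in [set y | (t <= dist x y)%R])
    ((h x)%:E * (dist x y `^ g * K x y)%:E))%E).
  rewrite [leRHS]integral_mkcond; apply: ge0_le_integral_nomeas => y _; first exact: F0.
  rewrite /F' /patch; case: ifPn => [/set_mem [_ /= ty]|nf].
    by rewrite mem_set.
  case: ifPn => // /set_mem /= ty.
  by exfalso; move/negP : nf; apply; apply: mem_set; split.
have mD : measurable [set y | t <= dist x y].
  by apply: measurable_set_le => //; exact: (measurable_mdist_l SS).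
rewrite ge0_integralZl_EFin//.
- rewrite muleC; apply: lee_wpmul2r; first by rewrite lee_fin.
  exact: HC.
- by move=> y /= ty; rewrite lee_fin mulr_ge0 ?powR_ge0//;
    exact: (@far_set_kernel_ge0 setT t (x, y)).
- apply/measurable_EFinP; apply: measurable_funTS.
  exact: (measurableT_comp (measurable_dist_powR_kernel g) (pair1_measurable x)).
Qed.

(** The increment is split as [|u x - u y|^p <= 2^p (|u x|^p + |u y|^p)]. The second term is the
    first with the variables exchanged, and kernel and far set are symmetric. *)
Lemma far_Lp : exists C, 0 < C /\ forall u t, 0 < t -> measurable_fun setT u ->
  (\int[m \x m]_(z in far_set setT t) (J u z)%:E <=
   (C / U t)%:E * \int[m]_x (`|u x| `^ p)%:E)%E.
Proof.
have [C1 b10 U0 _ _] := HU.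
have [C [C0 HC]] := @far_weighted 0 (ltac:(by rewrite lexx)).
exists (2 * 2 `^ p * C); split; first by rewrite !mulr_gt0// powR_gt0.
move=> u t t0 mu.
have mup := measurable_norm_powR p mu.
have up0 x : 0 <= `|u x| `^ p by exact: powR_ge0.
have := HC _ setT t t0 measurableT mup up0.
rewrite powRr0 div1r; set I := integral m _ _ => H1.
have mS := measurable_far t measurableT.
pose F z := (`|u z.1| `^ p * (dist z.1 z.2 `^ 0 * K z.1 z.2))%:E.
have mF : measurable_fun setT F.
  apply/measurable_EFinP; apply: measurable_funM; last exact: measurable_dist_powR_kernel.
  exact: (measurableT_comp mup measurable_fst).
pose F' := F \_ (far_set setT t).
have mF' : measurable_fun setT F'.
  by apply/(measurable_restrict _ mS measurableT); rewrite setTI; exact: measurable_funTS.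
have F0 z : (0 <= F' z)%E.
  rewrite /F' /patch; case: ifPn => // /set_mem zf.
  by rewrite lee_fin mulr_ge0// mulr_ge0 ?powR_ge0//; exact: far_set_kernel_ge0 zf.
rewrite integral_mkcond -/F' in H1.
have H2 : (\int[m \x m]_z F' (z.2, z.1) <= (C * (U t)^-1)%:E * I)%E.
  by rewrite prod_integral_swap.
apply: (@le_trans _ _ (\int[m \x m]_z ((2 `^ p)%:E * (F' z + F' (z.2, z.1))))%E).
  rewrite integral_mkcond; apply: ge0_le_integral_nomeas => z _.
    by rewrite /patch; case: ifP => // _; exact: (EFin_jint_ge0 SS p1 HU HK).
  rewrite {1}/patch; case: ifPn => [|_]; last first.
    by rewrite mule_ge0 ?adde_ge0// lee_fin powR_ge0.
  move=> /set_mem [_ tz].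
  have ez : F' z = (`|u z.1| `^ p * K z.1 z.2)%:E.
    by rewrite /F' /patch mem_set// /F powRr0 mul1r.
  have zz : z.1 <> z.2.
    by move=> zz; move: (lt_le_trans t0 tz); rewrite zz (mdistxx SS) ltxx.
  have ez' : F' (z.2, z.1) = (`|u z.2| `^ p * K z.1 z.2)%:E.
    rewrite /F' /patch mem_set.
      by rewrite /F powRr0 mul1r/= (kernel_sym HK zz).
    by split => //=; rewrite (mdistC SS).
  rewrite ez ez' -EFinD -EFinM lee_fin /jint -mulrDl mulrA ler_wpM2r//.
    by rewrite ltW// (kernel_gt0 SS HU HK).
  by rewrite -(normrN (u z.2)) powR_normD_le// ltW.
have mF2 : measurable_fun setT (fun z => F' (z.2, z.1)).
  by apply: measurableT_comp => //; exact: measurable_swap.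
rewrite ge0_integralZl_EFin ?powR_ge0//; last 2 first.
- by move=> z _; rewrite adde_ge0.
- exact: emeasurable_funD.
rewrite ge0_integralD//.
apply: (@le_trans _ _ ((2 `^ p)%:E * ((C * (U t)^-1)%:E * I + (C * (U t)^-1)%:E * I))%E).
  by apply: lee_wpmul2l; [rewrite lee_fin powR_ge0|exact: leeD].
have c0 : 0 <= C * (U t)^-1 by rewrite mulr_ge0 ?invr_ge0 ?(ltW (U0 t t0)) ?ltW.
rewrite -ge0_muleDl ?lee_fin// muleA -EFinD -EFinM.
by rewrite le_eqVlt; apply/orP; left; apply/eqP; congr (_%:E * _)%E; ring.
Qed.

End jump_bounds.

(** * From short-jump domination to the domain and the cutoff condition *)

Section transfer.
Context {R : realType} {d0 : measure_display} {X : measurableType d0}.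
Variables (dist : X -> X -> R) (m : {sigma_finite_measure set X -> \bar R}).
Hypothesis SS : standing_setting dist m.
Hypothesis VDm : VD dist m.
Variables (p : R) (U : R -> R) (K : X -> X -> R) (CU b1 b2 : R).
Hypothesis p1 : 1 < p.
Hypothesis HU : scale_bounds U CU b1 b2.
Hypothesis HK : jump_kernel dist m U K.
Variables (Psi : R -> R) (CP a1 a2 : R).
Hypothesis HPsi : scale_bounds Psi CP a1 a2.
Variables (F : set (X -> R)) (G : (X -> R) -> set X -> \bar R).
Implicit Types (u v f g : X -> R) (z : X * X) (t : R).

Local Notation J := (jint p K).
Local Notation V := (vol dist m).

(* The jumps of [f] shorter than [t] cost at most [Psi t / U t] times the
   energy [G f] of a neighbourhood; this is all that is needed of [G]. *)
Definition near_dominated : Prop := exists Cn L : R, 0 < Cn /\ 1 <= L /\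
  forall f (A A' : set X) t, F f -> measurable A -> measurable A' -> 0 < t ->
    (forall x, A x -> dball dist x (L * t) `<=` A') ->
    (\int[m \x m]_(z in near_set dist A t) (J f z)%:E <=
      (Cn * (Psi t / U t))%:E * G f A')%E.

Hypothesis ND : near_dominated.
Hypothesis HF : forall f, F f -> Lp_fun m p f.
Hypothesis HG : forall f, F f -> (G f setT < +oo)%E.

Lemma transfer_domain f : F f -> FJ m p K f.
Proof.
move=> Ff; have Lf := HF Ff; have mf := proj1 Lf.
have [_ _ U0 _ _] := HU; have [_ _ P0 _ _] := HPsi.
split; first exact: Lf.
have [Cf [Cf0 Hfar]] := far_Lp SS VDm p1 HU HK.
have [Cn [L [Cn0 [L1 Hnear]]]] := ND.
apply: le_lt_trans (GammaJ_near_far SS p1 HU HK 1 mf measurableT) _.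
apply: lte_add_pinfty.
  apply: le_lt_trans (Hnear f setT setT 1 Ff measurableT measurableT ltr01 _) _; first by [].
  apply: lte_mul_pinfty; [|by []|exact: HG].
  by rewrite lee_fin mulr_ge0 ?(ltW Cn0)// divr_ge0// ltW ?P0 ?U0.
apply: le_lt_trans (Hfar f 1 ltr01 mf) _.
by rewrite (Lp_powE Lf) -EFinM ltry.
Qed.

(** The jumps are cut at [min s r], the scale at which [U] appears in the bound to be proved. The
    near part is the given energy on a ball of radius [(L + 1) * s]; the far part uses the Hoelder
    bound alone. The same cutoff functions serve. *)
Lemma transfer_CE : CE_strong dist m F G Psi ->
  CE_strong dist m (FJ m p K) (GammaJ m p K) U.
Proof.
move=> [del [AE [C [/andP[del0 del1] [AE1 [C0 HCE]]]]]].
have [CU1 b10 U0 _ _] := HU; have [CP1 _ P0 _ _] := HPsi.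
have Pm := scale_bounds_le HPsi.
have [D HD] := VD_scale SS VDm.
have [Cn [L [Cn0 [L1 Hnear]]]] := ND.
have p0 : 0 < p by rewrite (lt_trans _ p1).
(* The exponent stays below [b1], so that [far_kernel] converges, and below [del], so that both
   given bounds weaken to it on bases at most 1. *)
pose g := Num.min del (b1 / 2).
have g0 : 0 < g by rewrite lt_min del0 divr_gt0.
have gdel : g <= del by rewrite ge_min lexx.
have gb : 0 <= g < b1.
  rewrite ltW//= gt_min; apply/orP; right.
  by rewrite ltr_pdivrMr// ltr_pMr// ltr1n.
have [Cw [Cw0 Hw]] := far_weighted SS VDm HU HK gb.
have CP0 : 0 < CP by rewrite (lt_le_trans _ CP1).
have L10 : 0 < L + 1 by rewrite addr_gt0// (lt_le_trans _ L1).
have [D1 {}HD] := HD (L + 1).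
have Dp : 0 < D (L + 1) by rewrite (lt_le_trans _ D1).
pose C1 := C `^ p * Cw.
pose C2 := Cn * C * (L + 1) `^ del * D (L + 1) * CP.
have C10 : 0 < C1 by rewrite mulr_gt0// powR_gt0.
have C20 : 0 < C2 by rewrite !mulr_gt0// powR_gt0.
have min01 (a : R) : 0 <= a -> 0 <= Num.min a 1 <= 1.
  by move=> a0; rewrite le_min a0 ler01 ge_min lexx orbT.
have pow_anti (a b c : R) : 0 <= a <= 1 -> 0 < b -> b <= c -> a `^ c <= a `^ b.
  move=> /andP[a0 a1'] b0 bc; have [->|an0] := eqVneq a 0.
    by rewrite !powR0 ?gt_eqF// (lt_le_trans b0).
  by apply: ger_powR => //; rewrite lt_def an0 a0.
exists g, AE, (C + (C1 + C2)); split.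
  by rewrite g0 (le_lt_trans gdel).
split=> //; split; first by rewrite !addr_gt0.
move=> x0 r r0; have [phi [Fphi [cutphi [hol en]]]] := HCE x0 r r0.
have Lphi := HF Fphi; have mphi := proj1 Lphi.
exists phi; split; first exact: transfer_domain.
split=> //; split.
  move=> x y; apply: le_trans (hol x y) _; apply: ler_pM.
  - exact: ltW.
  - exact: powR_ge0.
  - by rewrite lerDl addr_ge0// ltW.
  - apply: pow_anti => //; apply: min01; rewrite divr_ge0 ?(ltW r0)//.
    exact: (mdist_ge0 SS).
move=> x s s0.
pose t := Num.min s r.
have t0 : 0 < t by rewrite lt_min s0.
have V0 : 0 < V x s by exact: (vol_gt0 SS).
have tr : t / r = Num.min (s / r) 1.
  by rewrite -(divff (lt0r_neq0 r0)) -minr_pMl// invr_ge0 ltW.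
set mg := Num.min (s / r) 1 `^ g.
have mg0 : 0 <= mg by exact: powR_ge0.
have mA := measurable_dball SS x s.
have mA' := measurable_dball SS x ((L + 1) * s).
have Ut := U0 t t0.
apply: le_trans (GammaJ_near_far SS p1 HU HK t mphi mA) _.
have near_le : (\int[m \x m]_(z in near_set dist (dball dist x s) t) (J phi z)%:E <=
    (C2 * mg * V x s / U t)%:E)%E.
  apply: le_trans (Hnear phi _ _ t Fphi mA mA' t0 _) _.
    move=> z /= xz w /= zw; rewrite /dball/=.
    apply: le_lt_trans (mdist_tri SS z x w) _.
    rewrite mulrDl mul1r addrC ltrD//; apply: lt_le_trans zw _.
    by rewrite ler_pM2l ?(lt_le_trans _ L1)// ge_min lexx.
  have c0 : 0 <= Cn * (Psi t / U t).
    by rewrite mulr_ge0 ?(ltW Cn0)// divr_ge0// ltW ?P0.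
  have Ls0 : 0 < (L + 1) * s by rewrite mulr_gt0.
  apply: le_trans (lee_wpmul2l _ (en x _ Ls0)) _; first by rewrite lee_fin.
  rewrite -EFinM lee_fin.
  (* The given condition, used at radius [(L + 1) * s], divides by [Psi t'] with [t' >= t]. Almost
     monotonicity bounds [Psi t / Psi t'] by [CP]. *)
  set t' := Num.min ((L + 1) * s) r.
  have t'0 : 0 < t' by rewrite lt_min Ls0.
  have tt' : t <= t'.
    rewrite le_min !ge_min lexx orbT andbT; apply/orP; left.
    by rewrite ler_peMl ?(ltW s0)// lerDr (le_trans _ L1).
  have Pt := P0 _ t0; have Pt' := P0 _ t'0.
  have E1 : Num.min ((L + 1) * s / r) 1 `^ del <= (L + 1) `^ del * mg.
    apply: (@le_trans _ _ (((L + 1) * Num.min (s / r) 1) `^ del)).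
      apply: le_powR2 => //; first exact: ltW.
        by rewrite le_min ler01 divr_ge0// ltW.
      rewrite minr_pMr ?(ltW L10)// mulr1 mulrA le_min ge_min lexx /=.
      by rewrite ge_min lerDr (le_trans _ L1)// orbT.
    have /andP[m0 m1] := min01 (s / r) (divr_ge0 (ltW s0) (ltW r0)).
    rewrite powRM ?(ltW L10)//; apply: ler_wpM2l; first exact: powR_ge0.
    by apply: pow_anti => //; rewrite m0.
  have E2 := HD x s s0; have E3 := Pm _ _ t0 tt'.
  apply: (@le_trans _ _ (Cn * (Psi t / U t) *
     (C * ((L + 1) `^ del * mg) * (D (L + 1) * V x s) / Psi t'))).
    apply: ler_wpM2l => //; apply: ler_wpM2r; first by rewrite invr_ge0 ltW.
    apply: ler_pM => //; [by rewrite mulr_ge0 ?powR_ge0 ?(ltW C0)|..].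
      by rewrite ltW// (vol_gt0 SS).
    by apply: ler_wpM2l => //; exact: ltW.
  have -> : Cn * (Psi t / U t) *
     (C * ((L + 1) `^ del * mg) * (D (L + 1) * V x s) / Psi t') =
     (Cn * C * (L + 1) `^ del * D (L + 1) * mg * V x s / U t) * (Psi t / Psi t').
    by field; rewrite !gt_eqF.
  have -> : C2 * mg * V x s / U t =
     (Cn * C * (L + 1) `^ del * D (L + 1) * mg * V x s / U t) * CP.
    by rewrite /C2; field; rewrite gt_eqF.
  apply: ler_wpM2l; last by rewrite ler_pdivrMr.
  by rewrite divr_ge0 ?(ltW Ut)// !mulr_ge0 ?powR_ge0 ?(ltW Cn0) ?(ltW C0) ?(ltW Dp) ?(ltW V0).
have far_le : (\int[m \x m]_(z in far_set dist (dball dist x s) t) (J phi z)%:E <=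
    (C1 * mg * V x s / U t)%:E)%E.
  pose h (_ : X) : R := C `^ p * r `^ (- g).
  have h0 y : 0 <= h y by rewrite mulr_ge0 ?powR_ge0.
  have mh : measurable_fun setT h by exact: measurable_cst.
  have EI : (\int[m]_(y in dball dist x s) (h y)%:E = (C `^ p * r `^ (- g) * V x s)%:E)%E.
    apply: (etrans (integral_cst m mA (C `^ p * r `^ (- g))%:E)).
    by rewrite [RHS]EFinM; congr (_ * _)%E; exact: (volE SS).
  have := Hw h _ t t0 mA mh h0.
  rewrite EI -EFinM => Hfar.
  apply: (le_trans _ (le_trans Hfar _)); last first.
    rewrite lee_fin /C1 /mg -tr powRM ?(ltW t0) ?invr_ge0 ?(ltW r0)//.
    rewrite -(powR_inv1 (ltW r0)) -powRrM mulN1r.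
    by rewrite le_eqVlt; apply/orP; left; apply/eqP; field; rewrite gt_eqF.
  apply: ge0_le_integral_nomeas => z zf; first exact: (EFin_jint_ge0 SS p1 HU HK).
  rewrite lee_fin /jint mulrA; apply: ler_wpM2r.
    exact: (far_set_kernel_ge0 SS HU HK t0 zf).
  apply: (@le_trans _ _ ((C * Num.min (dist z.1 z.2 / r) 1 `^ del) `^ p)).
    by apply: le_powR2 => //; exact: ltW.
  have d0' := mdist_ge0 SS z.1 z.2.
  have dr0 : 0 <= dist z.1 z.2 / r by rewrite divr_ge0// ltW.
  rewrite powRM ?powR_ge0 ?(ltW C0)// -mulrA; apply: ler_wpM2l; first exact: powR_ge0.
  (* As [del * p >= del >= g] and the base is at most 1, the exponent drops to [g]. The truncation
     at 1 is then dropped too, which leaves the weight [dist ^ g] expected by [Hw]. *)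
  rewrite -powRrM; apply: (@le_trans _ _ (Num.min (dist z.1 z.2 / r) 1 `^ g)).
    apply: pow_anti => //; first exact: min01.
    by apply: le_trans gdel _; rewrite ler_peMr ?(ltW p1)// ltW.
  apply: (@le_trans _ _ ((dist z.1 z.2 / r) `^ g)).
    apply: le_powR2; [exact: ltW|by have /andP[] := min01 _ dr0|].
    by rewrite ge_min lexx.
  rewrite powRM ?invr_ge0 ?(ltW r0)// -(powR_inv1 (ltW r0)) -powRrM mulN1r.
  by rewrite mulrC.
apply: le_trans (leeD near_le far_le) _.
rewrite -EFinD lee_fin -mulrDl; apply: ler_wpM2r; first by rewrite invr_ge0 ltW.
rewrite -mulrDl; apply: ler_wpM2r; first exact: ltW.
rewrite -mulrDl; apply: ler_wpM2r => //.
by rewrite (addrC C2) lerDr ltW.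
Qed.

End transfer.

(** * Short jumps controlled by a comparable kernel or by a Poincare inequality *)

Section near_domination.
Context {R : realType} {d0 : measure_display} {X : measurableType d0}.
Variables (dist : X -> X -> R) (m : {sigma_finite_measure set X -> \bar R}).
Hypothesis SS : standing_setting dist m.
Hypothesis VDm : VD dist m.
Variables (p : R) (U : R -> R) (K : X -> X -> R) (CU b1 b2 : R).
Hypothesis p1 : 1 < p.
Hypothesis HU : scale_bounds U CU b1 b2.
Hypothesis HK : jump_kernel dist m U K.
Variables (Psi : R -> R) (CP a1 a2 : R).
Hypothesis HPsi : scale_bounds Psi CP a1 a2.
Implicit Types (u v f g : X -> R) (z : X * X) (t : R).

Local Notation J := (jint p K).
Local Notation V := (vol dist m).

(** [UG] between the radii [dist x y] and [t] says that [1 / U (dist x y)] is at most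
    [C * Psi t / (U t * Psi (dist x y))], which is the pointwise comparison of the kernels. *)
Lemma near_dominated_jump (KP : X -> X -> R) : jump_kernel dist m Psi KP ->
  UG U Psi -> near_dominated dist m p U K Psi (FJ m p KP) (GammaJ m p KP).
Proof.
move=> HKP [C [C1 HC]].
have [_ _ U0 _ _] := HU; have [_ _ P0 _ _] := HPsi.
have C0 : 0 < C by rewrite (lt_le_trans _ C1).
have [k1 [k2 [k10 k20 _ Ku]]] := kernel_bounds SS HU HK.
have [l1 [l2 [l10 l20 Kl _]]] := kernel_bounds SS HPsi HKP.
pose Cn := k2 * C / l1.
have Cn0 : 0 < Cn by rewrite divr_gt0// mulr_gt0.
exists Cn, 1; split => //; split => // f A A' t Ff mA mA' t0 AA'.
have mf : measurable_fun setT f by case: Ff => -[].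
have c0 : 0 <= Cn * (Psi t / U t).
  by rewrite mulr_ge0 ?(ltW Cn0)// divr_ge0// ltW ?P0 ?U0.
have AsubA' : A `<=` A'.
  by move=> x Ax; apply: (AA' x Ax); rewrite /dball/= (mdistxx SS) mul1r.
have JP0 z := EFin_jint_ge0 SS p1 HPsi HKP f z.
apply: (@le_trans _ _ ((Cn * (Psi t / U t))%:E *
    \int[m \x m]_(z in near_set dist A t) (jint p KP f z)%:E)%E).
  rewrite -ge0_integralZl_EFin//; last 2 first.
  - exact: (measurable_near SS).
  - by apply: measurable_funTS; exact: (measurable_EFin_jint p HKP).
  apply: ge0_le_integral_nomeas => -[x y] [_ /= xyt]; first exact: (EFin_jint_ge0 SS p1 HU HK).
  rewrite -EFinM lee_fin.
  have [->|/eqP xy] := eqVneq x y; first by rewrite !(jint_diag _ p1) mulr0.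
  have dxy := mdist_gt0 SS xy.
  rewrite /jint /= mulrCA; apply: ler_wpM2l; first exact: powR_ge0.
  have H1 := Ku x y _ dxy (lexx _); have H2 := Kl x y _ xy (lexx _).
  have H3 := HC _ _ dxy (ltW xyt).
  have Vd := vol_gt0 SS x dxy; have Ud := U0 _ dxy; have Pd := P0 _ dxy.
  have Ut := U0 _ t0; have Pt := P0 _ t0.
  apply: le_trans H1 _.
  apply: le_trans (ler_wpM2l c0 H2).
  rewrite ler_pdivrMr ?mulr_gt0//.
  have -> : Cn * (Psi t / U t) * (l1 / (V x (dist x y) * Psi (dist x y))) *
     (V x (dist x y) * U (dist x y)) =
     k2 * (C * (Psi t / Psi (dist x y))) * (U (dist x y) / U t).
    by rewrite /Cn; field; rewrite !gt_eqF.
  rewrite -mulrA ler_peMr ?(ltW k20)//.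
  have := ler_wpM2r (ltW (divr_gt0 Ud Ut)) H3.
  by rewrite mulrA divfK ?gt_eqF// divff ?gt_eqF.
apply: lee_wpmul2l; first by rewrite lee_fin.
rewrite (GammaJE SS p1 HPsi HKP mf mA').
by apply: integral_setS => // z [/AsubA' Az _].
Qed.

(** On the annulus the kernel is at most a constant over [V * U r]. A jump that starts within [r] of
    a net point stays in the ball of radius [2 * r] around it, where the Poincare inequality
    applies; the volume it produces cancels [V]. Bounded overlap of the enlarged balls sums the
    energies. *)
Lemma annulus_poincare (F : set (X -> R)) (G : (X -> R) -> {measure set X -> \bar R}) :
  (forall f, F f -> Lp_fun m p f) -> PI_L dist m p F G Psi ->
  exists C1 L : R, 0 < C1 /\ 1 <= L /\ forall f (A A' : set X) r,
    F f -> measurable A -> measurable A' -> 0 < r ->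
    (forall x, A x -> dball dist x (L * r) `<=` A') ->
    (\int[m \x m]_(z in [set z | A z.1 /\ (r / 2 < dist z.1 z.2 <= r)%R]) (J f z)%:E <=
      (C1 * (Psi r / U r))%:E * G f A')%E.
Proof.
move=> HF [CPI [API [CPI0 [API1 HPI]]]].
have [CU1 _ U0 _ Uu] := HU; have [CP1 _ P0 _ Pu] := HPsi.
have CU0 : 0 < CU by rewrite (lt_le_trans _ CU1).
have CP0 : 0 < CP by rewrite (lt_le_trans _ CP1).
have [k1 [k2 [k10 k20 _ Ku]]] := kernel_bounds SS HU HK.
(* The ball of radius [2 * r] around the net point lies in that of radius [3 * r = 6 * (r / 2)]
   around [x]. *)
have [D HD] := VD_scale SS VDm; have [D1 {}HD] := HD 6.
have D0 : 0 < D 6 by rewrite (lt_le_trans _ D1).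
have [N [N0 HN]] := exists_net SS VDm.
pose kap := k2 * D 6 * CU * 2 `^ b2.
have kap0 : 0 < kap by rewrite !mulr_gt0// powR_gt0.
pose C2 := kap * (2 * 2 `^ p) * CPI * CP * 2 `^ a2.
have C20 : 0 < C2 by rewrite !mulr_gt0// powR_gt0.
(* A point of [A] within [r] of a net point sees the whole Poincare ball of radius [2 * API * r]
   within [(2 * API + 2) * r]. The summand 1 only ensures a positive constant. *)
exists (C2 * (N (2 * API) + 1)), (2 * API + 2); split.
  by rewrite mulr_gt0// ltr_wpDl.
split; first by lra.
move=> f A A' r Ff mA mA' r0 AA'.
have Lf := HF _ Ff; have mf := proj1 Lf.
have [c [s [cov ovl]]] := HN r r0.
have r2 : 0 < r / 2 by rewrite divr_gt0.
have r20 : 0 < 2 * r by rewrite mulr_gt0.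
set An := [set z : X * X | A z.1 /\ r / 2 < dist z.1 z.2 <= r].
have md := measurable_mdist SS.
have mAn : measurable An.
  rewrite (_ : An = [set z | A z.1] `&` ([set z | r / 2 < dist z.1 z.2] `&`
     [set z | dist z.1 z.2 <= r])); last first.
    by apply/seteqP; split => [z [Az /andP[h1 h2]]|z [Az [h1 h2]]]; split => //;
      apply/andP.
  apply: measurableI; first exact: measurable_fst_set.
  by apply: measurableI; [exact: measurable_set_lt|exact: measurable_set_le].
pose S i := if s i then An `&` [set z | dball dist (c i) r z.1] else set0.
have mS i : measurable (S i).
  rewrite /S; case: ifP => _; last exact: measurable0.
  by apply: measurableI => //; apply: measurable_fst_set; exact: (measurable_dball SS).
have AnS : An `<=` \bigcup_i S i.
  move=> z Az; have [i si ci] := cov z.1; exists i => //.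
  by rewrite /S si; split.
pose Fb i := if s i then dball dist (c i) (API * (2 * r)) else set0.
have mFb i : measurable (Fb i).
  by rewrite /Fb; case: ifP => _; [exact: (measurable_dball SS)|exact: measurable0].
have Ur := U0 _ r0; have Pr := P0 _ r0; have P2r := P0 _ r20; have U2 := U0 _ r2.
have Q0 : 0 <= C2 * (Psi r / U r).
  by rewrite mulr_ge0 ?(ltW C20)// divr_ge0// ltW.
have iS i : (\int[m \x m]_(z in S i) (J f z)%:E <=
    (C2 * (Psi r / U r))%:E * \int[G f]_(x in Fb i) (\1_A' x)%:E)%E.
  (* Only net balls that meet [A] have their enlargement inside [A']; the other pieces are empty and
     contribute 0. *)
  have [S0|/set0P[z0 Sz0]] := eqVneq (S i) set0.
    rewrite S0 integral_set0 mule_ge0 ?lee_fin//.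
    by apply: integral_ge0 => x _; rewrite lee_fin.
  have si : s i by move: Sz0; rewrite /S; case: ifP.
  rewrite /Fb si integral_indic//; last exact: (measurable_dball SS).
  have subA' : dball dist (c i) (API * (2 * r)) `<=` A'.
    move: Sz0; rewrite /S si => -[[Az0 _] cz0] w cw; apply: (AA' _ Az0).
    rewrite /dball/= in cz0 cw *.
    have := mdist_tri SS (c i) z0.1 w; rewrite (mdistC SS z0.1 (c i)).
    have -> : (2 * API + 2) * r = API * (2 * r) + 2 * r by ring.
    by move: cz0 cw; lra.
  have -> : A' `&` dball dist (c i) (API * (2 * r)) = dball dist (c i) (API * (2 * r)).
    by apply/setIidPr.
  set B := dball dist (c i) (2 * r).
  have mB : measurable B by exact: (measurable_dball SS).
  have Vi := vol_gt0 SS (c i) r20.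
  have g0 z : (0 <= (`|f z.1 - f z.2| `^ p)%:E)%E by rewrite lee_fin powR_ge0.
  have mg : measurable_fun setT (fun z => (`|f z.1 - f z.2| `^ p)%:E).
    exact: (measurable_EFin_norm_powR p (measurable_fun_diff mf)).
  pose q := kap / (V (c i) (2 * r) * U r).
  have q0 : 0 <= q by rewrite divr_ge0 ?(ltW kap0)// ltW// mulr_gt0.
  apply: (@le_trans _ _ (q%:E * \int[m \x m]_(z in S i) (`|f z.1 - f z.2| `^ p)%:E)%E).
    rewrite -ge0_integralZl_EFin//; last exact: measurable_funTS.
    apply: ge0_le_integral_nomeas => -[x y]; first by move=> _; exact: (EFin_jint_ge0 SS p1 HU HK).
    rewrite /S si => -[[/= _ /andP[xyl xyu]] cx].
    rewrite lee_fin /jint /= mulrC; apply: ler_wpM2r; first exact: powR_ge0.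
    apply: le_trans (Ku x y _ r2 (ltW xyl)) _.
    have Vx := vol_gt0 SS x r2.
    have H1 : V (c i) (2 * r) <= D 6 * V x (r / 2).
      apply: le_trans (HD x _ r2); apply: (vol_sub SS).
      by rewrite (mdistC SS); rewrite /dball/= in cx; lra.
    have H2 : U r <= CU * 2 `^ b2 * U (r / 2).
      have r2r : r / 2 <= r by lra.
      have := Uu _ _ r2 r2r; congr (_ <= _); congr (_ * _ `^ _ * _).
      by field; rewrite gt_eqF.
    rewrite ler_pdivrMr ?mulr_gt0// /q mulrAC ler_pdivlMr ?mulr_gt0//.
    have -> : kap * (V x (r / 2) * U (r / 2)) =
      k2 * ((D 6 * V x (r / 2)) * (CU * 2 `^ b2 * U (r / 2))) by rewrite /kap; ring.
    by rewrite ler_pM2l//; apply: ler_pM => //; exact: ltW.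
  have SB : S i `<=` B `*` B.
    rewrite /S si => -[x y] [[/= _ /andP[_ xy]] cx]; rewrite /dball/= in cx.
    split; rewrite /B /dball/=; first by lra.
    by have := mdist_tri SS x (c i) y; lra.
  apply: (@le_trans _ _ (q%:E * \int[m \x m]_(z in B `*` B) (`|f z.1 - f z.2| `^ p)%:E)%E).
    by apply: lee_wpmul2l; [rewrite lee_fin|exact: integral_setS].
  have Boo : (m B < +oo)%E by exact: (measure_dball_lty SS).
  apply: le_trans (lee_wpmul2l _ (prod_oscillation_le (average m f B) (ltW p1) mf mB Boo)) _.
    by rewrite lee_fin.
  have EB : m B = (V (c i) (2 * r))%:E by exact: (volE SS).
  have HPIi := HPI (c i) (2 * r) f r20 Ff.
  apply: (@le_trans _ _ (q%:E * ((2 * 2 `^ p)%:E * ((V (c i) (2 * r))%:E *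
    ((CPI * Psi (2 * r))%:E * G f (dball dist (c i) (API * (2 * r)))))))%E).
    rewrite EB; apply: lee_wpmul2l; first by rewrite lee_fin.
    apply: lee_wpmul2l; first by rewrite lee_fin mulr_ge0// powR_ge0.
    by apply: lee_wpmul2l; [rewrite lee_fin ltW|exact: HPIi].
  rewrite !muleA -!EFinM; apply: lee_wpmul2r; first exact: measure_ge0.
  rewrite lee_fin.
  have H3 : Psi (2 * r) <= CP * 2 `^ a2 * Psi r.
    have r2r : r <= 2 * r by lra.
    have := Pu _ _ r0 r2r; congr (_ <= _); congr (_ * _ `^ _ * _).
    by field; rewrite gt_eqF.
  have -> : q * (2 * 2 `^ p) * V (c i) (2 * r) * (CPI * Psi (2 * r)) =
     (kap * (2 * 2 `^ p) * CPI / U r) * Psi (2 * r).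
    by rewrite /q; field; rewrite !gt_eqF.
  have -> : C2 * (Psi r / U r) =
     (kap * (2 * 2 `^ p) * CPI / U r) * (CP * 2 `^ a2 * Psi r).
    by rewrite /C2; ring.
  apply: ler_wpM2l => //; rewrite divr_ge0 ?(ltW Ur)//.
  apply: mulr_ge0; last exact: ltW.
  by apply: mulr_ge0; [exact: ltW|rewrite mulr_ge0// powR_ge0].
have JJ z := EFin_jint_ge0 SS p1 HU HK f z.
apply: le_trans (integral_cover_le (m \x m)%E mS (measurable_EFin_jint p HK mf) JJ AnS) _.
apply: (@le_trans _ _ (\sum_(i <oo) (C2 * (Psi r / U r))%:E *
    \int[G f]_(x in Fb i) (\1_A' x)%:E)%E).
  by apply: lee_nneseries => i *; [apply: integral_ge0 => z _; exact: JJ|exact: iS].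
have i0 i : (0 <= \int[G f]_(x in Fb i) (\1_A' x)%:E)%E.
  by apply: integral_ge0 => x _; rewrite lee_fin.
rewrite nneseriesZl; last by move=> i _; exact: i0.
have mi : measurable_fun setT (fun x => (\1_A' x : R)%:E).
  by apply/measurable_EFinP; exact: measurable_indic.
have N20 : 0 <= N (2 * API) by exact: N0.
have ov x n : (\sum_(i < n) \1_(Fb i) x <= N (2 * API)).
  apply: le_trans (ovl (2 * API) x n _); last by lra.
  rewrite [leRHS]big_mkcond; apply: ler_sum => i _; rewrite indicE /Fb.
  case: (s i) => /=; last by rewrite memNset.
  case: ifPn => [_|nd]; first by case: (_ \in _).
  rewrite memNset//= /dball/= => h; move/negP : nd; apply.
  by apply: lt_le_trans h _; lra.
apply: le_trans (lee_wpmul2l _ (integral_overlap (G f) N20 mFb mi _ ov)) _.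
- by rewrite lee_fin.
- by move=> x; rewrite lee_fin.
rewrite integral_indic// setIT muleA -EFinM; apply: lee_wpmul2r => //.
rewrite lee_fin [leRHS]mulrAC; apply: ler_wpM2l; first exact: Q0.
by rewrite lerDl.
Qed.

(** [SUG] between [2 ^- n * t] and [t] bounds the annulus factor [Psi / U] at scale [2 ^- n * t] by
    [Th (2 ^- n)] times its value at [t]. All annuli share the neighbourhood [A'], since their
    scales are at most [t]. *)
Lemma near_dominated_poincare (F : set (X -> R))
    (G : (X -> R) -> {measure set X -> \bar R}) :
  (forall f, F f -> Lp_fun m p f) -> PI_L dist m p F G Psi -> SUG U Psi ->
  near_dominated dist m p U K Psi F (fun f A => G f A).
Proof.
move=> HF HPI [Th [Thm [Th0 [_ [[M HM] HTh]]]]].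
have [_ _ U0 _ _] := HU; have [_ _ P0 _ _] := HPsi.
have [C1 [L [C10 [L1 HC]]]] := annulus_poincare HF HPI.
have Thn0 n : 0 <= Th (2 ^- n).
  by apply: Th0; rewrite invr_ge0 exprn_ge0//= invf_le1 ?exprn_gt0// exprn_ege1// ler1n.
have M0 : 0 <= M by have := HM 0%N; rewrite big_geq.
have L0 : 0 < L by rewrite (lt_le_trans _ L1).
exists (C1 * (M + 1)), L; split; first by rewrite mulr_gt0// ltr_wpDl.
split => // f A A' t Ff mA mA' t0 AA'.
have mf := proj1 (HF _ Ff).
pose r n : R := 2 ^- n * t.
have r0 n : 0 < r n by rewrite mulr_gt0// invr_gt0 exprn_gt0.
have rt n : r n <= t.
  by rewrite /r ler_piMl ?(ltW t0)// invf_le1 ?exprn_gt0// exprn_ege1// ler1n.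
pose An n := [set z : X * X | A z.1 /\ r n / 2 < dist z.1 z.2 <= r n].
have md := measurable_mdist SS.
have mAn n : measurable (An n).
  rewrite (_ : An n = [set z | A z.1] `&` ([set z | r n / 2 < dist z.1 z.2] `&`
     [set z | dist z.1 z.2 <= r n])); last first.
    by apply/seteqP; split => [z [Az /andP[h1 h2]]|z [Az [h1 h2]]]; split => //;
      apply/andP.
  apply: measurableI; first exact: measurable_fst_set.
  by apply: measurableI; [exact: measurable_set_lt|exact: measurable_set_le].
have JJ z := EFin_jint_ge0 SS p1 HU HK f z.
pose off := [set z : X * X | A z.1 /\ 0 < dist z.1 z.2 < t].
have offA : off `<=` \bigcup_n An n.
  move=> [x y] [/= Ax /andP[xy0 xyt]].
  have td1 : 1 <= t / dist x y by rewrite ler_pdivlMr// mul1r ltW.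
  have [n /andP[nl nu]] := dyadic_bracket td1.
  have pn : 0 < (2 : R) ^+ n by rewrite exprn_gt0.
  have pn1 : 0 < (2 : R) ^+ n.+1 by rewrite exprn_gt0.
  exists n => //; split => //=; rewrite /r; apply/andP; split.
    rewrite mulrAC -invfM -exprSr ltr_pdivrMl//.
    by move: nu; rewrite ltr_pdivrMr.
  by rewrite ler_pdivlMl//; move: nl; rewrite ler_pdivlMr.
(* The annuli miss the diagonal, where the integrand vanishes. *)
have -> : (\int[m \x m]_(z in near_set dist A t) (J f z)%:E =
    \int[m \x m]_(z in off) (J f z)%:E)%E.
  rewrite integral_mkcond [RHS]integral_mkcond; apply: eq_integral => -[x y] _.
  rewrite /patch; have [Nxy|Nxy] := boolP ((x, y) \in near_set dist A t); last first.
    case: ifPn => // /set_mem [/= Ax /andP[_ xyt]].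
    by exfalso; move/negP : Nxy; apply; apply: mem_set.
  case: ifPn => // noff; have [Ax /= xyt] := set_mem Nxy.
  have [->|/eqP xy] := eqVneq x y; first by rewrite jint_diag.
  exfalso; move/negP : noff; apply; apply: mem_set; split => //=.
  by rewrite (mdist_gt0 SS xy).
apply: le_trans (integral_cover_le (m \x m)%E mAn (measurable_EFin_jint p HK mf) JJ offA) _.
have Ut := U0 _ t0; have Pt := P0 _ t0.
pose a := C1 * (Psi t / U t).
have a0 : 0 <= a by rewrite mulr_ge0 ?(ltW C10)// divr_ge0// ltW.
have G0 : (0 <= G f A')%E by exact: measure_ge0.
have iA n : (\int[m \x m]_(z in An n) (J f z)%:E <= (a * Th (2 ^- n))%:E * G f A')%E.
  apply: le_trans (HC f A A' (r n) Ff mA mA' (r0 n) _) _.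
    move=> x Ax; apply: subset_trans (AA' x Ax) => w /= /lt_le_trans; apply.
    by rewrite ler_pM2l.
  apply: lee_wpmul2r => //; rewrite lee_fin /a -mulrA ler_pM2l//.
  have := HTh _ _ (r0 n) (rt n).
  have -> : r n / t = 2 ^- n by rewrite /r mulfK// gt_eqF.
  have Urn := U0 _ (r0 n); have Prn := P0 _ (r0 n).
  have c0 : 0 <= Psi (r n) / U t by rewrite divr_ge0// ltW.
  move=> /(ler_wpM2r c0).
  have -> : U t / U (r n) * (Psi (r n) / U t) = Psi (r n) / U (r n).
    by field; rewrite !gt_eqF.
  have -> : Th (2 ^- n) * (Psi t / Psi (r n)) * (Psi (r n) / U t) =
    Psi t / U t * Th (2 ^- n) by field; rewrite !gt_eqF.
  by [].
apply: (@le_trans _ _ (\sum_(n <oo) (a * Th (2 ^- n))%:E * G f A')%E).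
  by apply: lee_nneseries => n *; [apply: integral_ge0 => z _; exact: JJ|exact: iA].
apply: lime_le.
  by apply: is_cvg_nneseries => n _ _; rewrite mule_ge0// lee_fin mulr_ge0.
apply: nearW => n; rewrite -ge0_sume_distrl; last first.
  by move=> k _; rewrite lee_fin mulr_ge0.
apply: lee_wpmul2r => //; rewrite sumEFin lee_fin -mulr_sumr /a.
rewrite [leRHS]mulrAC ler_wpM2l//.
by apply: le_trans (HM n) _; rewrite lerDl.
Qed.

End near_domination.

(** * Density of continuous functions in the energy norm *)

Section painter.
Context {R : realType} {X : Type}.
Variables (psi : nat -> X -> R) (a : nat -> R).
Hypothesis psi01 : forall n x, 0 <= psi n x <= 1.

(* Successive overpainting: the [n]-th layer paints the value [a n] with
   opacity [psi n]. This replaces a partition of unity. *)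
Fixpoint painter (n : nat) (x : X) : R :=
  if n is n'.+1 then (1 - psi n' x) * painter n' x + psi n' x * a n' else 0.

Lemma painter_eq0 n x : (forall k, (k < n)%N -> psi k x = 0) -> painter n x = 0.
Proof.
elim: n => //= n IH H; rewrite H// mul0r addr0 IH ?mulr0// => k kn.
by apply: H; rewrite ltnS ltnW.
Qed.

(** Each layer is a convex combination, so convexity of the power can be iterated. Layer [k]
    contributes with weight at most [psi k], and the product of transparencies is what remains of
    the blank background 0. *)
Lemma painter_powR_le p (f : R) n x : 1 <= p ->
  `|f - painter n x| `^ p <= \sum_(k < n) psi k x * `|f - a k| `^ p +
    \prod_(k < n) (1 - psi k x) * `|f| `^ p.
Proof.
move=> p1; elim: n => [|n IH] /=; first by rewrite big_ord0 big_ord0 add0r mul1r subr0.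
have /andP[s0 s1] := psi01 n x.
have -> : f - ((1 - psi n x) * painter n x + psi n x * a n) =
   (1 - psi n x) * (f - painter n x) + psi n x * (f - a n) by ring.
apply: le_trans (powR_convex2 _ _ p1 (psi01 n x)) _.
rewrite big_ord_recr big_ord_recr /= [leRHS]addrAC lerD2r.
apply: le_trans (ler_wpM2l _ IH) _; first by rewrite subr_ge0.
rewrite mulrDr lerD//.
  by rewrite ler_piMl ?lerBlDr ?lerDl// sumr_ge0// => k _;
    rewrite mulr_ge0 ?powR_ge0//; have /andP[] := psi01 k x.
by rewrite mulrA [_ * \prod_(_ < _) _]mulrC.
Qed.

(** At stage [n0] both points carry the same value, within [b] of a reference [c]: an opaque layer
    has just been laid, or the canvas is blank. Afterwards only the layers in [rel] act, and each
    adds its opacity difference times the distance of its value from the current one, both measured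
    from [c]. *)
Lemma painter_diff_le (c b : R) (x y : X) (n0 : nat) (rel : pred nat) :
  painter n0 x = painter n0 y -> `|painter n0 y - c| <= b ->
  (forall k, (n0 <= k)%N -> ~~ rel k -> psi k x = 0 /\ psi k y = 0) ->
  forall n, (n0 <= n)%N ->
    `|painter n x - painter n y| <=
      (b + \sum_(k < n | rel k) `|a k - c|) * \sum_(k < n | rel k) `|psi k x - psi k y|.
Proof.
move=> exy yb rel0.
pose M n := b + \sum_(k < n | rel k) `|a k - c|.
pose S n := \sum_(k < n | rel k) `|psi k x - psi k y|.
have b0 : 0 <= b by exact: le_trans yb.
have M0 n : 0 <= M n by rewrite addr_ge0// sumr_ge0.
have S0 n : 0 <= S n by rewrite sumr_ge0.
suff H n : (n0 <= n)%N -> `|painter n y - c| <= M n /\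
    `|painter n x - painter n y| <= M n * S n by move=> n /H[].
elim: n => [|n IH].
  rewrite leqn0 => /eqP n00; move: exy yb; rewrite n00 => exy yb.
  rewrite exy subrr normr0 mulr_ge0//; split => //.
  by rewrite /M big_ord0 addr0.
rewrite leq_eqVlt => /orP[/eqP n0E|].
  rewrite -n0E exy subrr normr0 mulr_ge0//; split => //.
  by apply: le_trans yb _; rewrite lerDl sumr_ge0.
rewrite ltnS => n0n; have {IH} [H1 H2] := IH n0n.
rewrite /M /S !(big_mkcond (fun k : 'I_n.+1 => rel k)) !big_ord_recr/=.
rewrite -!(big_mkcond (fun k : 'I_n => rel k)) addrA -/(M n) -/(S n).
have [rn|nrn] := boolP (rel n); last first.
  have [-> ->] := rel0 n n0n nrn.
  by rewrite !subr0 !mul1r !mul0r !addr0.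
have /andP[y0 y1] := psi01 n y; have /andP[x0 x1] := psi01 n x.
split.
  have -> : (1 - psi n y) * painter n y + psi n y * a n - c =
     (1 - psi n y) * (painter n y - c) + psi n y * (a n - c) by ring.
  apply: le_trans (ler_normD _ _) _; rewrite !normrM lerD//.
    rewrite ger0_norm ?subr_ge0//; apply: le_trans H1.
    by rewrite ler_piMl// lerBlDr lerDl.
  by rewrite ger0_norm// ler_piMl.
have -> : (1 - psi n x) * painter n x + psi n x * a n -
   ((1 - psi n y) * painter n y + psi n y * a n) =
   (1 - psi n x) * (painter n x - painter n y) +
   (psi n x - psi n y) * ((a n - c) - (painter n y - c)) by ring.
apply: le_trans (ler_normD _ _) _; rewrite [leRHS]mulrDr lerD//.
  rewrite normrM ger0_norm ?subr_ge0//.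
  apply: (@le_trans _ _ `|painter n x - painter n y|).
    by rewrite ler_piMl// lerBlDr lerDl.
  by apply: le_trans H2 _; rewrite ler_wpM2r// lerDl.
rewrite normrM mulrC ler_wpM2r//; apply: le_trans (ler_normB _ _) _.
by rewrite addrC lerD.
Qed.

End painter.

(** * Continuity, compact support and pointwise values of cutoff functions *)

Section pointwise_cutoffs.
Context {R : realType} {d0 : measure_display} {X : measurableType d0}.
Variables (dist : X -> X -> R) (m : {sigma_finite_measure set X -> \bar R}).
Hypothesis SS : standing_setting dist m.
Implicit Types (u v f g phi : X -> R) (x y : X) (r e : R).

Lemma holder_dcontinuous phi (C del r : R) : 0 < C -> 0 < del -> 0 < r ->
  (forall x y, `|phi x - phi y| <= C * (Num.min (dist x y / r) 1) `^ del) ->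
  dcontinuous dist phi.
Proof.
move=> C0 del0 r0 H x e e0.
have eC : 0 < (e / C) `^ del^-1 by rewrite powR_gt0// divr_gt0.
exists (r * (e / C) `^ del^-1); split; first by rewrite mulr_gt0.
move=> y xy; apply: le_lt_trans (H x y) _.
rewrite mulrC -ltr_pdivlMr//.
have -> : e / C = ((e / C) `^ del^-1) `^ del.
  by rewrite powRV_powR ?gt_eqF// ltW// divr_gt0.
have dr : 0 <= dist x y / r by rewrite divr_ge0 ?(mdist_ge0 SS)// ltW.
apply: gt0_ltr_powR; rewrite ?nnegrE ?(ltW eC)//.
  by rewrite le_min dr ler01.
by rewrite gt_min ltr_pdivrMr// mulrC xy.
Qed.

Lemma ae_dense (P : X -> Prop) : {ae m, forall x, P x} ->
  forall x e, 0 < e -> exists y, dist x y < e /\ P y.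
Proof.
move=> [N [mN N0 PN]] x e e0; apply: contrapT => H.
have : (0 < m (dball dist x e))%E.
  by rewrite (volE SS) lte_fin (vol_gt0 SS).
suff : (m (dball dist x e) <= 0)%E by rewrite leNgt => /negP.
rewrite -N0; apply: le_measure; rewrite ?inE//; first exact: (measurable_dball SS).
by move=> y xy; apply: PN => /= Py; apply: H; exists y.
Qed.

(** A cutoff function is constrained only almost everywhere. By full support every ball meets a set
    of full measure, and continuity then gives the constraints at every point, as the painting
    argument requires. *)
Lemma cutoff_pointwise (A B : set X) phi : dcontinuous dist phi ->
  cutoff dist m A B phi ->
  [/\ forall x, 0 <= phi x <= 1, forall x, A x -> phi x = 1 &
      forall x, ~ B x -> phi x = 0].
Proof.
move=> cphi [mphi [p01 [[W [oW [AW pW]]] supB]]]; split.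
- move=> x; apply/andP; split; rewrite leNgt; apply/negP => h.
    have [r [r0 Hr]] := cphi x (- phi x) (ltac:(by rewrite oppr_gt0)).
    have [y [/Hr xy /andP[y0 _]]] := ae_dense p01 x r0.
    have : phi y <= 0.
      by move: xy; rewrite distrC => /(le_lt_trans (ler_norm _)); lra.
    move=> y0'; have : phi y = 0 by apply: le_anti; rewrite y0 y0'.
    by move=> yy; move: xy; rewrite yy subr0 ltr0_norm// ltxx.
  have [r [r0 Hr]] := cphi x (phi x - 1) (ltac:(by rewrite subr_gt0)).
  have [y [/Hr xy /andP[_ y1]]] := ae_dense p01 x r0.
  by move: (le_lt_trans (ler_norm _) xy); lra.
- move=> x Ax; apply/eqP; rewrite -subr_eq0; apply: contrapT => /negP h.
  have h0 : 0 < `|phi x - 1| by rewrite normr_gt0.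
  have [r [r0 Hr]] := cphi x _ h0.
  have [r' [r'0 Wr']] := oW x (AW x (sub_dclosure SS Ax)).
  have mn : 0 < Num.min r r' by rewrite lt_min r0.
  have [y [+ Wy]] := ae_dense pW x mn.
  rewrite lt_min => /andP[/Hr xy yr'].
  by move: xy; rewrite (Wy (Wr' _ yr')) ltxx.
- move=> x nBx; apply/eqP; apply: contrapT => /negP h.
  have : ~ dsupp dist m phi x by move=> /supB.
  rewrite /dsupp/= => /existsNP[e /not_implyP[e0]]; apply.
  have h0 : 0 < `|phi x| by rewrite normr_gt0.
  have [r [r0 Hr]] := cphi x _ h0.
  have mn : 0 < Num.min e r by rewrite lt_min e0.
  apply: (@lt_le_trans _ _ (m (dball dist x (Num.min e r)))).
    by rewrite (volE SS) lte_fin (vol_gt0 SS).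
  apply: le_measure; rewrite ?inE.
  + exact: (measurable_dball SS).
  + apply: measurableI; first exact: (measurable_dball SS).
    have := mphi measurableT (~` [set 0]) (measurableC (measurable_set1 0)).
    rewrite setTI (_ : _ @^-1` _ = [set y | phi y != 0])//.
    by apply/seteqP; split => y /= /eqP.
  + move=> y; rewrite /dball /= lt_min => /andP[ye /Hr yr]; split => //=.
    by apply/eqP => y0; move: yr; rewrite y0 subr0 ltxx.
Qed.

Lemma Cc_bounded_support (g : X -> R) x0 r : dcontinuous dist g ->
  (forall x, g x != 0 -> dball dist x0 r x) -> Cc dist g.
Proof.
move=> cg sg; split => //.
have [_ [_ [_ [_ [_ [rc _]]]]]] := SS.
move=> I V oV cov.
(* The complement of the closed support is added to the cover under the index [None], so that
   compactness of a closed ball yields compactness of the support. *)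
pose V' (i : option I) := if i is Some i then V i else ~` dclosure dist [set x | g x != 0].
have oV' i : dopen dist (V' i) by case: i => [i|]; [exact: oV|exact: (dopenC_dclosure SS)].
have [F [finF HF]] := rc x0 r (option I) V' oV' (ltac:(
  by move=> x _; have [/cov[i _ Vi]|nx] := pselect (dclosure dist [set x | g x != 0] x);
    [exists (Some i)|exists None])).
exists (Some @^-1` F); split.
  by apply: finite_preimage => // i j _ _ [].
move=> x gx.
have [[i|] Fi Vi] := HF x (ltac:(move=> e e0; have [w [gw xw]] := gx e e0;
  by exists w; split => //; exact: sg)).
  by exists i.
by exfalso; exact: Vi.
Qed.

End pointwise_cutoffs.

Section near_energy.
Context {R : realType} {d0 : measure_display} {X : measurableType d0}.
Variables (dist : X -> X -> R) (m : {sigma_finite_measure set X -> \bar R}).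
Hypothesis SS : standing_setting dist m.
Variables (p : R) (U : R -> R) (K : X -> X -> R) (CU b1 b2 : R).
Hypothesis p1 : 1 < p.
Hypothesis HU : scale_bounds U CU b1 b2.
Hypothesis HK : jump_kernel dist m U K.

(** Dominated convergence: as [t] decreases to 0 the near sets shrink to the diagonal, where the
    jump density vanishes. *)
Lemma near_energy_small f : FJ m p K f -> forall eta, 0 < eta ->
  exists t, 0 < t /\
    (\int[m \x m]_(z in near_set dist setT t) (jint p K f z)%:E < eta%:E)%E.
Proof.
move=> [Lf Gf] eta eta0; have mf := proj1 Lf.
have JJ z := EFin_jint_ge0 SS p1 HU HK f z.
rewrite (GammaJTE SS p1 HU HK mf) in Gf.
pose nr n := near_set dist setT (n.+1%:R^-1 : R).
pose h n := (fun z => (jint p K f z)%:E) \_ (nr n).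
have mnr n : measurable (nr n) by exact: (measurable_near SS).
have mJf := measurable_EFin_jint p HK mf.
have mh n : measurable_fun setT (h n).
  by apply/(measurable_restrict _ (mnr n) measurableT); rewrite setTI; exact: measurable_funTS.
have h0 n z : (0 <= h n z)%E by rewrite /h /patch; case: ifP.
have hJ n z : (h n z <= (jint p K f z)%:E)%E by rewrite /h /patch; case: ifP.
have intJ : integrable (m \x m)%E setT (fun z => (jint p K f z)%:E).
  apply/integrableP; split => //; under eq_integral do rewrite gee0_abs//.
  exact: Gf.
have cvh : (\int[m \x m]_z h n z)%E @[n --> \oo] --> (0 : \bar R)%E.
  have [] := @dominated_convergence _ _ _ (m \x m)%E setT measurableT h (cst 0%E)
    (fun z => (jint p K f z)%:E) mh (measurable_cst _) _ intJ _.
  - apply: aeW => -[x y] _ /=.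
    have [xy|/eqP xy] := eqVneq x y.
      rewrite (_ : h ^~ (x, y) = cst 0%E); first exact: cvg_cst.
      by apply/funext => n; rewrite /h /patch xy jint_diag//; case: ifP.
    have dxy := mdist_gt0 SS xy.
    apply: cvg_near_cst; have := near_infty_natSinv_lt (PosNum dxy).
    apply: filterS => n /= nxy.
    by rewrite /h /patch memNset// => -[_ /=]; apply/negP; rewrite -leNgt ltW.
  - by apply: aeW => z n _; rewrite gee0_abs.
  - by move=> _ _; rewrite integral0.
apply: contrapT => H.
have Hn n : (eta%:E <= \int[m \x m]_z h n z)%E.
  rewrite -integral_mkcond leNgt; apply/negP => hn; apply: H.
  by exists n.+1%:R^-1; rewrite invr_gt0 ltr0n.
have : (eta%:E <= 0)%E.
  rewrite -(cvg_lim _ cvh)//; apply: lime_ge; first by apply/cvg_ex; exists 0%E.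
  exact: nearW.
by rewrite lee_fin leNgt eta0.
Qed.

End near_energy.

Section dcontinuity.
Context {R : realType} {d0 : measure_display} {X : measurableType d0}.
Variables (dist : X -> X -> R).

Lemma dcontinuous_cst (a : R) : dcontinuous dist (fun=> a).
Proof. by move=> x e e0; exists 1; split => // y _; rewrite subrr normr0. Qed.

Lemma dcontinuousD (u v : X -> R) : dcontinuous dist u -> dcontinuous dist v ->
  dcontinuous dist (fun x => u x + v x).
Proof.
move=> cu cv x e e0; have e2 : 0 < e / 2 by rewrite divr_gt0.
have [r [r0 Hr]] := cu x _ e2; have [s [s0 Hs]] := cv x _ e2.
exists (Num.min r s); rewrite lt_min r0; split => // y.
rewrite lt_min => /andP[/Hr ur /Hs vs].
have -> : u x + v x - (u y + v y) = (u x - u y) + (v x - v y) by ring.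
by apply: le_lt_trans (ler_normD _ _) _; rewrite (splitr e) ltrD.
Qed.

Lemma dcontinuousM (u v : X -> R) : dcontinuous dist u -> dcontinuous dist v ->
  dcontinuous dist (fun x => u x * v x).
Proof.
move=> cu cv x e e0.
pose A := `|u x| + 1; pose B := `|v x| + 1.
have A0 : 0 < A by rewrite ltr_wpDl.
have B0 : 0 < B by rewrite ltr_wpDl.
have eA : 0 < e / 2 / A by rewrite !divr_gt0.
have eB : 0 < e / 2 / B by rewrite !divr_gt0.
have [r [r0 Hr]] := cu x _ eB; have [s [s0 Hs]] := cv x _ eA.
have [t [t0 Ht]] := cv x 1 ltr01.
exists (Num.min r (Num.min s t)); rewrite !lt_min r0 s0; split => // y.
rewrite !lt_min => /and3P[/Hr ur /Hs vs /Ht vt].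
have -> : u x * v x - u y * v y = u x * (v x - v y) + (u x - u y) * v y by ring.
apply: le_lt_trans (ler_normD _ _) _; rewrite !normrM (splitr e).
apply: ltr_leD.
  apply: (@le_lt_trans _ _ (A * `|v x - v y|)); first by rewrite ler_wpM2r// lerDl.
  by rewrite mulrC -ltr_pdivlMr.
apply: (@le_trans _ _ (`|u x - u y| * B)); last by rewrite -ler_pdivlMr// ltW.
rewrite ler_wpM2l//; have := ler_normB (v y) (v x).
have -> : v y = v x - (v x - v y) by ring.
by move=> _; apply: le_trans (ler_normB _ _) _; rewrite lerD2l ltW.
Qed.

Lemma dcontinuous_painter (psi : nat -> X -> R) (a : nat -> R) n :
  (forall k, dcontinuous dist (psi k)) -> dcontinuous dist (painter psi a n).
Proof.
move=> cpsi; elim: n => [|n IH] /=; first exact: dcontinuous_cst.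
apply: dcontinuousD; apply: dcontinuousM => //; last exact: dcontinuous_cst.
have -> : (fun x => 1 - psi n x) = (fun x => 1 + -1 * psi n x).
  by apply/funext => x; rewrite mulN1r.
by apply: dcontinuousD; [|apply: dcontinuousM => //]; exact: dcontinuous_cst.
Qed.

End dcontinuity.

Lemma integral_const_diff_le {d} {T : measurableType d} {R : realType}
    (mu : {measure set T -> \bar R}) (p : R) (f : T -> R) (B : set T) (a b : R) :
  1 <= p -> measurable_fun setT f -> measurable B ->
  ((`|a - b| `^ p)%:E * mu B <=
   (2 `^ p)%:E * (\int[mu]_(x in B) (`|f x - b| `^ p)%:E +
                  \int[mu]_(x in B) (`|f x - a| `^ p)%:E))%E.
Proof.
move=> p1 mf mB.
have mg (q : R) : measurable_fun B (fun x => (`|f x - q| `^ p)%:E).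
  apply: measurable_funTS.
  exact: (measurable_EFin_norm_powR p (measurable_funB mf (measurable_cst q))).
rewrite -ge0_integralD//.
have mm : measurable_fun B (fun x => (`|f x - b| `^ p)%:E + (`|f x - a| `^ p)%:E)%E.
  by apply: emeasurable_funD; exact: mg.
have nn x : B x -> (0 <= (`|f x - b| `^ p)%:E + (`|f x - a| `^ p)%:E)%E.
  by move=> _; rewrite adde_ge0// lee_fin powR_ge0.
rewrite -ge0_integralZl_EFin ?powR_ge0//.
rewrite -integral_cst//; apply: ge0_le_integral_nomeas => x Bx.
  by rewrite lee_fin powR_ge0.
rewrite /= -EFinD -EFinM lee_fin.
have -> : a - b = (f x - b) + - (f x - a) by ring.
by rewrite -(normrN (f x - a)) powR_normD_le.
Qed.

Section good_values.
Context {R : realType} {d0 : measure_display} {X : measurableType d0}.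
Variables (dist : X -> X -> R) (m : {sigma_finite_measure set X -> \bar R}).
Hypothesis SS : standing_setting dist m.
Hypothesis VDm : VD dist m.
Variables (p : R) (U : R -> R) (K : X -> X -> R) (CU b1 b2 : R).
Hypothesis p1 : 1 < p.
Hypothesis HU : scale_bounds U CU b1 b2.
Hypothesis HK : jump_kernel dist m U K.
Local Notation J := (jint p K).
Local Notation V := (vol dist m).

(** A substitute for the Poincare inequality: the value is [f y0] for a point [y0] of the small ball
    at which the oscillation on the large ball is at most its mean over [y0]. That mean is a double
    integral over pairs at distance below [(L + 1) * e], and the lower kernel bound turns it into
    jump energy, with the crucial factor [U e]. *)
Lemma exists_good_value (L : R) : 1 <= L -> exists C, 0 < C /\
  forall (f : X -> R) x0 e, measurable_fun setT f -> 0 < e -> exists a : R,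
    (\int[m]_(x in dball dist x0 (L * e)) (`|f x - a| `^ p)%:E <=
      (C * U e)%:E *
      \int[m \x m]_(z in near_set dist (dball dist x0 e) ((L + 1) * e)) (J f z)%:E)%E.
Proof.
move=> L1; have [CU1 _ U0 _ Uu] := HU.
have CU0 : 0 < CU by rewrite (lt_le_trans _ CU1).
have [k1 [k2 [k10 k20 Kl _]]] := kernel_bounds SS HU HK.
have [D HD] := VD_scale SS VDm; have [D1 {}HD] := HD (L + 2).
have D0 : 0 < D (L + 2) by rewrite (lt_le_trans _ D1).
have L10 : 0 < L + 1 by rewrite addr_gt0// (lt_le_trans _ L1).
pose C := D (L + 2) * CU * (L + 1) `^ b2 / k1.
have C0 : 0 < C by rewrite divr_gt0// !mulr_gt0// powR_gt0.
exists C; split => // f x0 e mf e0.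
have Ve := vol_gt0 SS x0 e0; have Ue := U0 _ e0.
set B := dball dist x0 e; set B' := dball dist x0 (L * e).
have mB : measurable B by exact: (measurable_dball SS).
have mB' : measurable B' by exact: (measurable_dball SS).
have EB : m B = (V x0 e)%:E by exact: (volE SS).
pose g (z : X * X) := (`|f z.1 - f z.2| `^ p)%:E.
have mg : measurable_fun setT g.
  exact: (measurable_EFin_norm_powR p (measurable_fun_diff mf)).
have g0 z : (0 <= g z)%E by rewrite lee_fin powR_ge0.
pose h y := (\int[m]_(x in B') g (y, x))%E.
have mh : measurable_fun setT h.
  have mg' : measurable_fun setT (g \_ (setT `*` B')).
    have mTB : measurable ([set: X] `*` B') by exact: measurableX.
    by apply/(measurable_restrict _ mTB measurableT); rewrite setTI; exact: measurable_funTS.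
  have g'0 z : (0 <= (g \_ (setT `*` B')) z)%E by rewrite /patch; case: ifP.
  have := measurable_fun_fubini_tonelli_F (m2 := m) _ mg' g'0.
  congr measurable_fun; apply/funext => y; rewrite /fubini_F /h [RHS]integral_mkcond.
  by apply: eq_integral => x _; rewrite /patch in_setX/= in_setT.
have h0 y : (0 <= h y)%E by apply: integral_ge0 => x _; exact: g0.
have B0 : (0 < m B)%E by rewrite EB lte_fin.
have Boo : (m B < +oo)%E by rewrite EB ltry.
have key : (\int[m]_(y in B) h y <= (C * U e * V x0 e)%:E *
    \int[m \x m]_(z in near_set dist B ((L + 1) * e)) (J f z)%:E)%E.
  rewrite -(prod_integral_setX m mB mB' mg g0).
  have c0 : 0 <= C * U e * V x0 e.
    exact: (mulr_ge0 (mulr_ge0 (ltW C0) (ltW Ue)) (ltW Ve)).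
  have mJf := measurable_EFin_jint p HK mf; have JJ z := EFin_jint_ge0 SS p1 HU HK f z.
  apply: (@le_trans _ _ ((C * U e * V x0 e)%:E *
      \int[m \x m]_(z in B `*` B') (J f z)%:E)%E); last first.
    apply: lee_wpmul2l; first by rewrite lee_fin.
    apply: integral_setS => // -[x y] [/= Bx By]; split => //=.
    rewrite /B /B' /dball/= in Bx By.
    by have := mdist_tri SS x0 x y; rewrite (mdistC SS x x0) mulrDl mul1r; lra.
  have mBB : measurable (B `*` B') by exact: measurableX.
  rewrite -ge0_integralZl_EFin//; last exact: measurable_funTS.
  apply: ge0_le_integral_nomeas => -[x y] [/= Bx By]; first exact: g0.
  rewrite /g /= -EFinM lee_fin.
  have [->|/eqP xy] := eqVneq x y.
    rewrite jint_diag// mulr0 subrr normr0 powR0// gt_eqF//.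
    by rewrite (lt_trans _ p1).
  rewrite /jint /= mulrCA ler_peMr ?powR_ge0//.
  rewrite /B /B' /dball/= in Bx By.
  have xyL : dist x y <= (L + 1) * e.
    by have := mdist_tri SS x0 x y; rewrite (mdistC SS x x0) mulrDl mul1r; lra.
  have Le0 : 0 < (L + 1) * e by rewrite mulr_gt0.
  have H1 := Kl x y _ xy xyL.
  have Vx := vol_gt0 SS x Le0; have UL := U0 _ Le0.
  have H2 : V x ((L + 1) * e) <= D (L + 2) * V x0 e.
    apply: le_trans (HD x0 _ e0); apply: (vol_sub SS).
    by rewrite !mulrDl mul1r; lra.
  have H3 : U ((L + 1) * e) <= CU * (L + 1) `^ b2 * U e.
    have eL : e <= (L + 1) * e by rewrite ler_peMl ?(ltW e0)// lerDr (le_trans _ L1).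
    by have := Uu _ _ e0 eL; rewrite mulfK// gt_eqF.
  apply: le_trans (ler_wpM2l c0 H1).
  rewrite mulrA ler_pdivlMr ?mulr_gt0// mul1r.
  have -> : C * U e * V x0 e * k1 = (D (L + 2) * V x0 e) * (CU * (L + 1) `^ b2 * U e).
    by rewrite /C; field; rewrite gt_eqF.
  by apply: ler_pM => //; exact: ltW.
have [y0 By0 Hy0] := exists_le_mean mB B0 Boo mh h0.
exists (f y0).
have IE : (\int[m]_(x in B') (`|f x - f y0| `^ p)%:E = h y0)%E.
  by apply: eq_integral => x _; rewrite /g/= distrC.
rewrite IE.
have := le_trans Hy0 key; rewrite EB [C * U e * _]mulrC EFinM -muleA.
by rewrite lee_pmul2l// ?lte_fin.
Qed.

End good_values.

(** * [L^p] error and energy of a painted function at a fixed mesh *)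

Section painter_estimates.
Context {R : realType} {d0 : measure_display} {X : measurableType d0}.
Variables (dist : X -> X -> R) (m : {sigma_finite_measure set X -> \bar R}).
Hypothesis SS : standing_setting dist m.
Variables (p : R) (U : R -> R) (K : X -> X -> R) (CU b1 b2 : R).
Hypothesis p1 : 1 < p.
Hypothesis HU : scale_bounds U CU b1 b2.
Hypothesis HK : jump_kernel dist m U K.
Local Notation J := (jint p K).
Local Notation V := (vol dist m).

Variables (e H CE : R) (N : R -> R) (c : nat -> X) (s : pred nat).
Variable (psi : nat -> X -> R).
Hypothesis e0 : 0 < e.
Hypothesis H0 : 0 <= H.
Hypothesis CE0 : 0 < CE.
Hypothesis N0 : forall L, 0 <= N L.
Hypothesis cov : forall x, exists2 i, s i & dist (c i) x < e.
Hypothesis ovl : forall L x n, 0 <= L ->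
  \sum_(i < n | s i && (dist (c i) x < L * e)) 1 <= N L.
Hypothesis psi01 : forall k x, 0 <= psi k x <= 1.
Hypothesis mpsi : forall k, measurable_fun setT (psi k).
(** Layers are opaque up to [2 * e], twice the cell radius, so that a jump shorter than [e] starting
    in the cell has both ends under the opaque part. *)
Hypothesis psi1 : forall k x, s k -> dist (c k) x < 2 * e -> psi k x = 1.
Hypothesis psi0 : forall k x, psi k x != 0 -> s k /\ dist (c k) x < H * e.
Hypothesis psiE : forall k x,
  (GammaJ m p K (psi k) (dball dist x e) <= (CE * V x e / U e)%:E)%E.
Variables (f : X -> R) (a : nat -> R).
Hypothesis mf : measurable_fun setT f.

Let p0 : 0 < p. Proof. by rewrite (lt_trans _ p1). Qed.

Definition net_ball (L : R) (k : nat) : set X :=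
  if s k then dball dist (c k) (L * e) else set0.

(** The radius [H + 3] contains the whole cell of every centre within [(H + 2) * e], so that
    neighbouring values can be compared with [f] on a common cell. *)
Definition net_osc (k : nat) : \bar R :=
  (\int[m]_(x in net_ball (H + 3) k) (`|f x - a k| `^ p)%:E)%E.

Definition net_mass (k : nat) : \bar R :=
  (\int[m]_(x in net_ball 1 k) (`|f x| `^ p)%:E)%E.

(* The mass of [f] on the cells that the first [n] layers leave unpainted. *)
Definition net_tail (n : nat) : \bar R :=
  (\sum_(j <oo) if (n <= j)%N then net_mass j else 0)%E.

Local Notation O := net_osc.
Local Notation T := net_mass.
Local Notation OS := (\sum_(k <oo) O k)%E.
Local Notation v n := (painter psi a n).

Lemma measurable_net_ball L k : measurable (net_ball L k).
Proof.
by rewrite /net_ball; case: (s k); [exact: (measurable_dball SS)|exact: measurable0].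
Qed.

Lemma net_osc_ge0 k : (0 <= O k)%E.
Proof. by apply: integral_ge0 => x _; rewrite lee_fin powR_ge0. Qed.

Lemma net_mass_ge0 k : (0 <= T k)%E.
Proof. by apply: integral_ge0 => x _; rewrite lee_fin powR_ge0. Qed.

Lemma net_tail_term_ge0 n k : (0 <= if (n <= k)%N then T k else 0)%E.
Proof. by case: ifP => // _; exact: net_mass_ge0. Qed.

Lemma sum_net_osc_ge0 : (0 <= OS)%E.
Proof. by apply: nneseries_ge0 => k _ _; exact: net_osc_ge0. Qed.

Lemma net_tail_ge0 n : (0 <= net_tail n)%E.
Proof. by apply: nneseries_ge0 => k _ _; exact: net_tail_term_ge0. Qed.

Let mfa (b : R) : measurable_fun setT (fun x => (`|f x - b| `^ p)%:E).
Proof. exact: (measurable_EFin_norm_powR p (measurable_funB mf (measurable_cst b))). Qed.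

Let mfp : measurable_fun setT (fun x => (`|f x| `^ p)%:E).
Proof. exact: (measurable_EFin_norm_powR p mf). Qed.

(** Integrated form of [painter_powR_le]. Layer [k] lives on its net ball, and the product of
    transparencies vanishes on every cell whose own layer was laid, so only cells of index at least
    [n] leave a remainder. *)
Lemma painter_Lp_le n :
  (\int[m]_x (`|f x - v n x| `^ p)%:E <= OS + net_tail n)%E.
Proof.
pose g k := (fun x => (`|f x - a k| `^ p)%:E) \_ (net_ball (H + 3) k).
pose h k := if (n <= k)%N then (fun x => (`|f x| `^ p)%:E) \_ (net_ball 1 k)
            else cst 0%E.
have g0 k x : (0 <= g k x)%E.
  by rewrite /g /patch; case: ifP => // _; rewrite lee_fin powR_ge0.
have h0 k x : (0 <= h k x)%E.
  rewrite /h; case: ifP => _; last exact: lexx.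
  by rewrite /patch; case: ifP => // _; rewrite lee_fin powR_ge0.
have mg k : measurable_fun setT (g k).
  have mB := measurable_net_ball (H + 3) k.
  by apply/(measurable_restrict _ mB measurableT); rewrite setTI; exact: measurable_funTS.
have mh k : measurable_fun setT (h k).
  rewrite /h; case: ifP => _; last exact: measurable_cst.
  have mB := measurable_net_ball 1 k.
  by apply/(measurable_restrict _ mB measurableT); rewrite setTI; exact: measurable_funTS.
have Sg x : (0 <= \sum_(k <oo) g k x)%E by apply: nneseries_ge0 => k _ _; exact: g0.
have Sh x : (0 <= \sum_(k <oo) h k x)%E by apply: nneseries_ge0 => k _ _; exact: h0.
apply: (@le_trans _ _ (\int[m]_x (\sum_(k <oo) g k x + \sum_(k <oo) h k x))%E); last first.
  rewrite ge0_integralD//; [|exact: ge0_emeasurable_sum|exact: ge0_emeasurable_sum].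
  rewrite integral_nneseries// integral_nneseries//.
  apply: leeD; apply: lee_nneseries => k *.
  - by apply: integral_ge0.
  - by rewrite /O /g -integral_mkcond.
  - by apply: integral_ge0.
  - rewrite /h; case: ifP => _; last by rewrite integral0.
    by rewrite /T -integral_mkcond.
apply: ge0_le_integral_nomeas => x _; first by rewrite lee_fin powR_ge0.
apply: (@le_trans _ _ ((\sum_(k < n) psi k x * `|f x - a k| `^ p)%:E +
    (\prod_(k < n) (1 - psi k x) * `|f x| `^ p)%:E)%E).
  by rewrite -EFinD lee_fin; exact: (painter_powR_le a psi01 (f x) n x (ltW p1)).
apply: leeD.
  apply: le_trans (nneseries_lim_ge n (fun k _ _ => g0 k x)).
  rewrite big_mkord -sumEFin; apply: lee_sum => k _.
  have /andP[q0 q1] := psi01 k x.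
  have [ps|ps] := eqVneq (psi k x) 0; first by rewrite ps mul0r; exact: g0.
  have [sk ck] := psi0 ps.
  rewrite /g /patch mem_set; last first.
    rewrite /net_ball sk /dball/=; apply: lt_le_trans ck _.
    by rewrite ler_pM2r// lerDl.
  by rewrite lee_fin ler_piMl// powR_ge0.
have [j sj cj] := cov x.
have jx : net_ball 1 j x by rewrite /net_ball sj /dball/= mul1r.
have [nj|jn] := leqP n j.
  apply: le_trans (nneseries_ge_term j (fun k => h0 k x)).
  rewrite /h nj /patch mem_set// lee_fin ler_piMl ?powR_ge0//.
  apply: prodr_ile1 => k _; have /andP[q0 q1] := psi01 k x.
  by rewrite subr_ge0 q1/= lerBlDr lerDl.
have pj : psi j x = 1.
  by apply: psi1 => //; apply: lt_le_trans cj _; rewrite ler_peMl ?ler1n// ltW.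
rewrite (bigD1 (Ordinal jn))//= pj subrr !mul0r.
exact: Sh.
Qed.

Local Notation N1 := (N (H + 2)).
(** The layers visible at either end of a jump shorter than [e] from cell [j]: the ends lie within
    [2 * e] of [c j], the supports within [H * e] of their centres. *)
Local Notation rel j := (fun k : nat => s k && (dist (c k) (c j) < (H + 2) * e)).

Lemma neighbour_count j n : \sum_(k < n | rel j k) 1 <= N1.
Proof. by apply: ovl; rewrite addr_ge0. Qed.

(** If layer [j] was laid, it resets both ends to [a j], so the comparison starts at stage [j.+1]
    with no initial error. Otherwise it starts from the blank canvas, whose value 0 is at distance
    [|a j|] from the reference. *)
Lemma painter_jump_le n j (z : X * X) : s j ->
  near_set dist (dball dist (c j) e) e z ->
  `|v n z.1 - v n z.2| <=
   ((if (j < n)%N then 0 else `|a j|) + \sum_(k < n | rel j k) `|a k - a j|) *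
   \sum_(k < n | rel j k) `|psi k z.1 - psi k z.2|.
Proof.
case: z => x y sj [/= cx xy]; rewrite /dball/= in cx xy.
have cy : dist (c j) y < 2 * e by have := mdist_tri SS x (c j) y; lra.
have cx2 : dist (c j) x < 2 * e by move: e0; lra.
have far k : ~~ rel j k -> psi k x = 0 /\ psi k y = 0.
  move=> nr; split; apply/eqP; apply: contrapT => /negP /psi0[sk ck];
    move/negP : nr; apply; rewrite sk/=.
    have := mdist_tri SS x (c k) (c j); rewrite (mdistC SS x (c j)).
    by rewrite mulrDl; lra.
  have := mdist_tri SS y (c k) (c j); rewrite (mdistC SS y (c j)).
  by rewrite mulrDl; lra.
have [jn|nj] := ltnP j n.
  apply: (@painter_diff_le _ _ psi a psi01 (a j) 0 x y j.+1 (rel j)) => //=.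
  - by rewrite (psi1 sj cx2) (psi1 sj cy) !subrr !mul0r.
  - by rewrite (psi1 sj cy) subrr mul0r add0r mul1r subrr normr0.
  - by move=> k _; exact: far.
apply: (@painter_diff_le _ _ psi a psi01 (a j) `|a j| x y 0 (rel j)) => //=.
  by rewrite sub0r normrN.
by move=> k _; exact: far.
Qed.

(** One [2 ^ p] compares values through [f], the other with [1 + N1 ^ p] splits the colour bound,
    [N1 ^ p] splits the sum of opacity differences, and [N1 * CE] is the energy of at most [N1]
    layers. *)
Definition jump_const : R :=
  2 `^ p * 2 `^ p * (1 + N1 `^ p) * (N1 `^ p * N1 * CE).

Lemma jump_const_ge0 : 0 <= jump_const.
Proof.
rewrite /jump_const; apply: mulr_ge0; last first.
  by apply: mulr_ge0; [apply: mulr_ge0; [exact: powR_ge0|exact: N0]|exact: ltW].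
by apply: mulr_ge0; [rewrite mulr_ge0 ?powR_ge0|rewrite addr_ge0 ?powR_ge0].
Qed.

(* Up to constants, the oscillation on cell [j] of the first [n] layers: cell [j] is
   compared with its neighbours and, while it is itself unpainted, with 0. *)
Definition local_osc n j : \bar R :=
  ((if (j < n)%N then 0 else O j + T j) + \sum_(k < n | rel j k) (O k + O j))%E.

Lemma local_value_le n j : s j ->
  (((if (j < n)%N then 0 else `|a j|) `^ p +
     \sum_(k < n | rel j k) `|a k - a j| `^ p)%:E * m (dball dist (c j) e) <=
   (2 `^ p)%:E * local_osc n j)%E.
Proof.
move=> sj.
have mB : measurable (dball dist (c j) e) by exact: (measurable_dball SS).
have fp0 b x : (0 <= (`|f x - b| `^ p)%:E)%E by rewrite lee_fin powR_ge0.
have sub k : s k -> dist (c k) (c j) < (H + 2) * e ->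
    (\int[m]_(x in dball dist (c j) e) (`|f x - a k| `^ p)%:E <= O k)%E.
  move=> sk ckj; apply: integral_setS; first exact: fp0.
  move=> x; rewrite /net_ball sk /dball/= => cx.
  by have := mdist_tri SS (c j) (c k) x; rewrite mulrDl in ckj *; lra.
have subj : (\int[m]_(x in dball dist (c j) e) (`|f x - a j| `^ p)%:E <= O j)%E.
  by apply: sub => //; rewrite (mdistxx SS) mulr_gt0// ltr_wpDl.
have tj : (\int[m]_(x in dball dist (c j) e) (`|f x - 0| `^ p)%:E = T j)%E.
  rewrite /T /net_ball sj mul1r.
  by apply: eq_integral => x _; rewrite subr0.
have m0 := measure_ge0 m (dball dist (c j) e).
rewrite EFinD ge0_muleDl; last 2 first.
- by rewrite lee_fin powR_ge0.
- by rewrite lee_fin sumr_ge0// => k _; exact: powR_ge0.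
rewrite /local_osc ge0_muleDr; last 2 first.
- by case: ifP => // _; rewrite adde_ge0 ?net_osc_ge0 ?net_mass_ge0.
- by apply: sume_ge0 => k _; rewrite adde_ge0 ?net_osc_ge0.
apply: leeD.
  case: ifP => _; first by rewrite powR0 ?gt_eqF// mul0e mule0.
  have := integral_const_diff_le m (a j) 0 (ltW p1) mf mB.
  rewrite subr0 tj => /le_trans; apply; apply: lee_wpmul2l; first by rewrite lee_fin powR_ge0.
  by rewrite [leRHS]addeC; apply: leeD; [exact: lexx|exact: subj].
rewrite -sumEFin ge0_sume_distrl; last by move=> k _; rewrite lee_fin powR_ge0.
rewrite ge0_sume_distrr; last by move=> k _; rewrite adde_ge0 ?net_osc_ge0.
apply: lee_sum => k /andP[sk ck].
apply: le_trans (integral_const_diff_le m (a k) (a j) (ltW p1) mf mB) _.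
apply: lee_wpmul2l; first by rewrite lee_fin powR_ge0.
by rewrite [leRHS]addeC; apply: leeD; [exact: subj|exact: sub].
Qed.

(** In the jump bound the colour factor is constant on the cell, so only the energies of at most
    [N1] layers are integrated. Each gives [CE * V / U e], and the volume [V] turns the powers of
    value differences into integrals over the cell. *)
Lemma local_jump_le n j : s j ->
  (\int[m \x m]_(z in near_set dist (dball dist (c j) e) e) (J (v n) z)%:E <=
   (jump_const / U e)%:E * local_osc n j)%E.
Proof.
move=> sj; have [_ _ U0 _ _] := HU.
have Ue := U0 _ e0; have Vj := vol_gt0 SS (c j) e0.
have n1 := N0 (H + 2).
set b := if (j < n)%N then 0 else `|a j|.
have b0 : 0 <= b by rewrite /b; case: ifP.
pose A := \sum_(k < n | rel j k) `|a k - a j|.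
pose Ap := \sum_(k < n | rel j k) `|a k - a j| `^ p.
have A0 : 0 <= A by apply: sumr_ge0.
have Ap0 : 0 <= Ap by apply: sumr_ge0 => k _; exact: powR_ge0.
have Y0 : 0 <= b + A by exact: addr_ge0.
have cnt := neighbour_count j n.
have W_le : (b + A) `^ p <= 2 `^ p * (1 + N1 `^ p) * (b `^ p + Ap).
  have AAp : A `^ p <= N1 `^ p * Ap.
    by apply: (@sum_powR_le _ p n (fun k => `|a k - a j|) (rel j) N1 (ltW p1) n1).
  have := powR_normD_le b A (ltW p1); rewrite !ger0_norm// => /le_trans; apply.
  rewrite -mulrA ler_wpM2l ?powR_ge0// mulrDl mul1r mulrDr.
  apply: (@le_trans _ _ (b `^ p + N1 `^ p * Ap)); first by rewrite lerD2l.
  have bp := powR_ge0 b p; have nb : 0 <= N1 `^ p * b `^ p by rewrite mulr_ge0 ?powR_ge0.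
  by move: (N1 `^ p * Ap) (N1 `^ p * b `^ p) (b `^ p) nb bp Ap0 => *; lra.
have mB : measurable (dball dist (c j) e) by exact: (measurable_dball SS).
pose w k (z : X * X) : \bar R := if rel j k then (J (psi k) z)%:E else 0%E.
have w0 k z : (0 <= w k z)%E.
  by rewrite /w; case: ifP => // _; exact: (EFin_jint_ge0 SS p1 HU HK).
have mw k : measurable_fun setT (w k).
  rewrite /w; case: (rel j k) => /=; first exact: (measurable_EFin_jint p HK (mpsi k)).
  exact: measurable_cst.
have q0 : 0 <= (b + A) `^ p * N1 `^ p by rewrite mulr_ge0 ?powR_ge0.
have mnear : measurable (near_set dist (dball dist (c j) e) e) by exact: (measurable_near SS).
apply: (@le_trans _ _ (((b + A) `^ p * N1 `^ p)%:E *
    \int[m \x m]_(z in near_set dist (dball dist (c j) e) e) \sum_(k < n) w k z)%E).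
  have msw : measurable_fun (near_set dist (dball dist (c j) e) e)
      (fun z => \sum_(k < n) w k z)%E.
    by apply: emeasurable_sum => k; exact: measurable_funTS.
  have sw0 (z : X * X) : near_set dist (dball dist (c j) e) e z ->
      (0 <= \sum_(k < n) w k z)%E by move=> _; exact: sume_ge0.
  rewrite -ge0_integralZl_EFin//.
  apply: ge0_le_integral_nomeas => -[x y] zn; first exact: (EFin_jint_ge0 SS p1 HU HK).
  have [xy|/eqP xy] := eqVneq x y.
    rewrite xy jint_diag//; apply: mule_ge0; first by rewrite lee_fin.
    exact: sume_ge0.
  have K0 := kernel_gt0 SS HU HK xy.
  rewrite /w -big_mkcond sumEFin -EFinM lee_fin /jint /= -mulr_suml mulrA.
  apply: ler_wpM2r; first exact: ltW.
  have PJ := painter_jump_le n sj zn; rewrite -/b -/A /= in PJ.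
  apply: le_trans (le_powR2 (ltW p0) (normr_ge0 _) PJ) _.
  rewrite powRM//; last exact: sumr_ge0.
  rewrite -mulrA; apply: ler_wpM2l; first exact: powR_ge0.
  exact: (@sum_powR_le _ p n (fun k => `|psi k x - psi k y|) (rel j) N1 (ltW p1) n1).
rewrite ge0_integral_sum//; last by move=> k; exact: measurable_funTS.
pose E := CE * V (c j) e / U e.
have E0 : 0 <= E by rewrite /E divr_ge0 ?(ltW Ue)// mulr_ge0 ?(ltW CE0) ?(ltW Vj).
apply: (@le_trans _ _ (((b + A) `^ p * N1 `^ p)%:E * (N1 * E)%:E)%E).
  apply: lee_wpmul2l; first by rewrite lee_fin.
  apply: (@le_trans _ _ (\sum_(k < n | rel j k) E%:E)%E).
    rewrite [leRHS]big_mkcond; apply: lee_sum => k _.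
    rewrite /w; case: ifP => _; last by rewrite integral0.
    apply: le_trans (psiE k (c j)); rewrite (GammaJE SS p1 HU HK (mpsi k) mB).
    apply: integral_setS; first by move=> z; exact: (EFin_jint_ge0 SS p1 HU HK).
    by move=> z [].
  rewrite sumEFin lee_fin -[X in X <= _](_ : (\sum_(k < n | rel j k) 1) * E = _).
    by rewrite ler_wpM2r.
  by rewrite mulr_suml; apply: eq_bigr => k _; rewrite mul1r.
have X0 : 0 <= b `^ p + Ap by rewrite addr_ge0// powR_ge0.
have L := local_value_le n sj.
rewrite -/b -/Ap in L.
have EB : m (dball dist (c j) e) = (V (c j) e)%:E by exact: (volE SS).
rewrite EB -EFinM in L.
pose q := 2 `^ p * (1 + N1 `^ p) * (N1 `^ p * N1 * CE) / U e.
have qq0 : 0 <= q.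
  rewrite /q; apply: divr_ge0; last exact: ltW.
  apply: mulr_ge0; first by rewrite mulr_ge0 ?addr_ge0 ?powR_ge0.
  by apply: mulr_ge0; [rewrite mulr_ge0 ?powR_ge0|exact: ltW].
apply: (@le_trans _ _ (q%:E * ((b `^ p + Ap) * V (c j) e)%:E)%E).
  rewrite -!EFinM lee_fin /E /q.
  have -> : (b + A) `^ p * N1 `^ p * (N1 * (CE * V (c j) e / U e)) =
     (b + A) `^ p * (N1 `^ p * N1 * CE * V (c j) e / U e) by ring.
  have -> : 2 `^ p * (1 + N1 `^ p) * (N1 `^ p * N1 * CE) / U e * ((b `^ p + Ap) * V (c j) e) =
     2 `^ p * (1 + N1 `^ p) * (b `^ p + Ap) * (N1 `^ p * N1 * CE * V (c j) e / U e) by ring.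
  apply: ler_wpM2r W_le; apply: divr_ge0; last exact: ltW.
  exact: (mulr_ge0 (mulr_ge0 (mulr_ge0 (powR_ge0 _ _) n1) (ltW CE0)) (ltW Vj)).
apply: le_trans (lee_wpmul2l _ L) _; first by rewrite lee_fin.
rewrite muleA -EFinM (_ : q * 2 `^ p = jump_const / U e)//.
by rewrite /q /jump_const; ring.
Qed.

(** Exchange of summation: as an own term [O j] is counted at most [N1] times, and as a neighbour's
    term again at most [N1] times since [rel] is symmetric on selected indices. *)
Lemma sum_local_osc_le n :
  (\sum_(j <oo) (if s j then local_osc n j else 0) <=
   (1 + 2 * N1)%:E * (OS + net_tail n))%E.
Proof.
have n1 := N0 (H + 2).
pose w k j : \bar R := if s j && (dist (c j) (c k) < (H + 2) * e) then O k else 0%E.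
have w0 k j : (0 <= w k j)%E.
  by rewrite /w; case: ifP => // _; exact: net_osc_ge0.
have O0 k := net_osc_ge0 k; have T0 k := net_mass_ge0 k.
have t0 k := net_tail_term_ge0 n k.
have OS0 := sum_net_osc_ge0; have TS0 := net_tail_ge0 n.
have NO0 k : (0 <= N1%:E * O k)%E by rewrite mule_ge0 ?lee_fin.
have Sw0 j : (0 <= \sum_(k < n) w k j)%E by exact: sume_ge0.
apply: (@le_trans _ _ (\sum_(j <oo) ((O j + (if (n <= j)%N then T j else 0)) +
    (N1%:E * O j + \sum_(k < n) w k j)))%E).
  apply: lee_nneseries => j *.
    case: (s j) => //; rewrite /local_osc adde_ge0//.
      by case: ifP => // _; exact: adde_ge0.
    by apply: sume_ge0 => k _; exact: adde_ge0.
  case sj : (s j); last exact: (adde_ge0 (adde_ge0 (O0 j) (t0 j)) (adde_ge0 (NO0 j) (Sw0 j))).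
  rewrite /local_osc; apply: leeD.
    by case: ltnP => _; [rewrite adde0; exact: O0|exact: lexx].
  rewrite big_split/= addeC; apply: leeD.
    rewrite (eq_bigr (fun k : 'I_n => 1%:E * O j)%E); last by move=> k _; rewrite mul1e.
    rewrite -ge0_sume_distrl; last by move=> k _; rewrite lee_fin.
    by rewrite sumEFin; apply: lee_wpmul2r => //; rewrite lee_fin; exact: neighbour_count.
  rewrite big_mkcond; apply: lee_sum => k _.
  case: ifP => // /andP[sk ck]; rewrite /w sj/= (mdistC SS) ck.
  exact: lexx.
rewrite nneseriesD; [|by move=> *; exact: adde_ge0|by move=> *; exact: adde_ge0].
rewrite nneseriesD//; rewrite -/(net_tail n).
have -> : (\sum_(j <oo) (N1%:E * O j + \sum_(k < n) w k j) =
    N1%:E * OS + \sum_(j <oo) \sum_(k < n) w k j)%E.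
  rewrite (nneseriesD (fun j _ _ => NO0 j) (fun j _ _ => Sw0 j)).
  by rewrite (nneseriesZl _ _ (fun j _ => O0 j)).
rewrite (@nneseries_sum _ _ _ _ (fun k : 'I_n => w k) 0 (fun k j _ => w0 k j)).
have wk k : (\sum_(j <oo) w k j <= N1%:E * O k)%E.
  apply: lime_le; first by apply: is_cvg_nneseries.
  apply: nearW => l; rewrite big_mkord /w -big_mkcond.
  rewrite (eq_bigr (fun j : 'I_l => 1%:E * O k)%E); last by move=> j _; rewrite mul1e.
  rewrite -ge0_sume_distrl; last by move=> j _; rewrite lee_fin.
  rewrite sumEFin; apply: lee_wpmul2r => //; rewrite lee_fin.
  by apply: ovl; exact: addr_ge0.
have Sk : (\sum_(k < n) \sum_(j <oo) w k j <= N1%:E * OS)%E.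
  apply: (@le_trans _ _ (\sum_(k < n) N1%:E * O k)%E); first by apply: lee_sum => k _; exact: wk.
  rewrite -ge0_sume_distrr//; apply: lee_wpmul2l; first by rewrite lee_fin.
  have := nneseries_lim_ge n (fun k _ _ => O0 k) (P := xpredT) (m := 0).
  by rewrite big_mkord.
apply: (@le_trans _ _ ((OS + net_tail n) + (N1%:E * OS + N1%:E * OS))%E).
  by apply: leeD => //; apply: leeD.
have N20 : (0 <= (2 * N1)%:E :> \bar R)%E by rewrite lee_fin mulr_ge0.
rewrite EFinD ge0_muleDl// mul1e; apply: leeD => //.
rewrite (_ : (2 * N1)%:E = N1%:E + N1%:E)%E; last by rewrite -EFinD; congr EFin; ring.
rewrite [leRHS]ge0_muleDl ?lee_fin//.
by apply: leeD; (apply: lee_wpmul2l; [rewrite lee_fin|rewrite leeDl]).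
Qed.

Lemma measurable_painter n : measurable_fun setT (v n).
Proof.
elim: n => [|n IH] /=; first exact: measurable_cst.
apply: measurable_funD; apply: measurable_funM.
- by apply: measurable_funB => //; exact: measurable_cst.
- exact: IH.
- exact: mpsi.
- exact: measurable_cst.
Qed.

Lemma painter_near_le n :
  (\int[m \x m]_(z in near_set dist setT e) (J (v n) z)%:E <=
   (jump_const / U e * (1 + 2 * N1))%:E * (OS + net_tail n))%E.
Proof.
have [_ _ U0 _ _] := HU; have Ue := U0 _ e0.
have mv := measurable_painter n.
have mJv := measurable_EFin_jint p HK mv; have JJ z := EFin_jint_ge0 SS p1 HU HK (v n) z.
have jc0 : 0 <= jump_const / U e by rewrite divr_ge0 ?jump_const_ge0// ltW.
have cover : near_set dist setT e `<=` \bigcup_j near_set dist (net_ball 1 j) e.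
  move=> z [_ zn]; have [j sj cj] := cov z.1; exists j => //; split => //.
  by rewrite /net_ball sj /dball/= mul1r.
have mN j : measurable (near_set dist (net_ball 1 j) e).
  by apply: (measurable_near SS); exact: measurable_net_ball.
apply: le_trans (integral_cover_le (m \x m)%E mN mJv JJ cover) _.
apply: (@le_trans _ _ (\sum_(j <oo) (jump_const / U e)%:E *
    (if s j then local_osc n j else 0))%E).
  apply: lee_nneseries => j *; first by apply: integral_ge0 => z _; exact: JJ.
  case sj : (s j); rewrite /net_ball sj; first by rewrite mul1r; exact: local_jump_le.
  rewrite mule0 (_ : near_set dist set0 e = set0) ?integral_set0//.
  by apply/seteqP; split => z // -[].
have lo0 j : (0 <= if s j then local_osc n j else 0)%E.
  case: ifP => // _; rewrite /local_osc adde_ge0//.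
    by case: ifP => // _; rewrite adde_ge0 ?net_osc_ge0 ?net_mass_ge0.
  by apply: sume_ge0 => k _; rewrite adde_ge0 ?net_osc_ge0.
rewrite nneseriesZl; last by move=> j _; exact: lo0.
rewrite [X in (_ <= X * _)%E]EFinM -muleA; apply: lee_wpmul2l; first by rewrite lee_fin.
exact: sum_local_osc_le.
Qed.

End painter_estimates.

(** * Choice of mesh and number of layers *)

Section energy_density.
Context {R : realType} {d0 : measure_display} {X : measurableType d0}.
Variables (dist : X -> X -> R) (m : {sigma_finite_measure set X -> \bar R}).
Hypothesis SS : standing_setting dist m.
Hypothesis VDm : VD dist m.
Variables (p : R) (U : R -> R) (K : X -> X -> R) (CU b1 b2 : R).
Hypothesis p1 : 1 < p.
Hypothesis HU : scale_bounds U CU b1 b2.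
Hypothesis HK : jump_kernel dist m U K.
Local Notation J := (jint p K).

Lemma net_tail_small (e : R) (N : R -> R) (c : nat -> X) (s : pred nat) (f : X -> R) (eta : R) :
  (forall L, 0 <= N L) ->
  (forall L x n, 0 <= L -> \sum_(i < n | s i && (dist (c i) x < L * e)) 1 <= N L) ->
  Lp_fun m p f -> 0 < eta ->
  exists n, (net_tail dist m p e c s f n < eta%:E)%E.
Proof.
move=> N0 ovl [mf If] eta0.
have mb k := measurable_net_ball SS e c s 1 k.
have cnt x n : \sum_(i < n) \1_(net_ball dist e c s 1 i) x <= N 1 :> R.
  apply: le_trans (ovl 1 x n ler01); rewrite [leRHS]big_mkcond; apply: ler_sum => i _.
  rewrite indicE /net_ball; case: (s i) => /=; last by rewrite in_set0.
  case: ifPn => [_|/negP h]; first by rewrite lern1 leq_b1.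
  by rewrite memNset.
have fp0 (x : X) : (0 <= (`|f x| `^ p)%:E)%E by rewrite lee_fin powR_ge0.
have mfp := measurable_EFin_norm_powR p mf.
have T0 k := net_mass_ge0 dist m p e c s f k.
have H : (\sum_(k <oo) net_mass dist m p e c s f k < +oo)%E.
  apply: le_lt_trans (integral_overlap m (N0 1) mb mfp fp0 cnt) _.
  rewrite lte_mul_pinfty// lee_fin; exact: N0.
have tailE n : net_tail dist m p e c s f n =
    (\sum_(n <= k <oo) net_mass dist m p e c s f k)%E.
  by rewrite [RHS]eseries_cond eseries_mkcond.
have /(_ [set y | (y < eta%:E)%E]) := nneseries_tail_cvg H (fun k _ => T0 k).
case; first exact: (@nbhs_open_ereal_lt _ 0 (fun=> eta)).
by move=> n _ /(_ n (leqnn n)) /= h; exists n; rewrite tailE.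
Qed.

Lemma GammaJ0 (A : set X) : GammaJ m p K (fun=> 0) A = 0%E.
Proof.
rewrite /GammaJ integral0_eq// => x _; rewrite integral0_eq// => y _.
by rewrite subrr normr0 powR0 ?mul0r// gt_eqF// (lt_trans _ p1).
Qed.

Lemma cutoff_family : CE_strong dist m (FJ m p K) (GammaJ m p K) U ->
  exists H CE : R, [/\ 0 <= H, 0 < CE &
  forall (e : R) (c : nat -> X) (s : pred nat), 0 < e ->
  exists psi : nat -> X -> R,
  [/\ forall k x, 0 <= psi k x <= 1,
      forall k, dcontinuous dist (psi k),
      forall k x, s k -> dist (c k) x < 2 * e -> psi k x = 1,
      forall k x, psi k x != 0 -> s k /\ dist (c k) x < H * e &
      forall k x, (GammaJ m p K (psi k) (dball dist x e) <=
        (CE * vol dist m x e / U e)%:E)%E]].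
Proof.
move=> [del [AE [C [/andP[del0 del1] [AE1 [C0 HC]]]]]].
have [_ _ U0 _ _] := HU.
(* The cutoff functions are taken for balls of radius [2 * e], hence vanish outside [AE * 2 * e].
   Their energy bound is read at [s = e], where the Hoelder factor is at most 1. *)
exists (AE * 2), C; split => //; first by rewrite mulr_ge0// (le_trans ler01)// ltW.
move=> e c s e0.
have e20 : 0 < 2 * e by rewrite mulr_gt0.
pose Q k (phi : X -> R) := [/\ forall x, 0 <= phi x <= 1, dcontinuous dist phi,
  forall x, s k -> dist (c k) x < 2 * e -> phi x = 1,
  forall x, phi x != 0 -> s k /\ dist (c k) x < AE * 2 * e &
  forall x, (GammaJ m p K phi (dball dist x e) <= (C * vol dist m x e / U e)%:E)%E].
have : forall k, exists phi, Q k phi.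
  move=> k; case sk : (s k); last first.
    exists (fun=> 0); split; rewrite ?sk//.
    - by move=> x; rewrite lexx ler01.
    - by move=> x t t0; exists 1; split => // y _; rewrite subrr normr0.
    - by move=> x; rewrite eqxx.
    - move=> x; rewrite GammaJ0 lee_fin divr_ge0 ?mulr_ge0 ?ltW ?U0//.
      exact: (vol_gt0 SS).
  have [phi [_ [cphi [hphi ephi]]]] := HC (c k) _ e20.
  have dc := holder_dcontinuous SS C0 del0 e20 hphi.
  have [phi01 phi1 phi0] := cutoff_pointwise SS dc cphi.
  exists phi; split => //.
  - by move=> x _ xk; exact: phi1.
  - move=> x /eqP px; split; first exact: sk.
    by have [|/phi0//] := pselect (dball dist (c k) (AE * (2 * e)) x); rewrite /dball/= mulrA.
  - move=> x; apply: le_trans (ephi x _ e0) _; rewrite lee_fin.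
    have -> : Num.min e (2 * e) = e by apply/min_idPl; move: e0; lra.
    rewrite ler_pM2r ?invr_gt0 ?U0// ler_pM2r; last exact: (vol_gt0 SS).
    rewrite -[leRHS]mulr1 ler_pM2l//.
    have m0 : 0 <= Num.min (e / (2 * e)) 1 by rewrite le_min ler01 divr_ge0 ?ltW.
    have E1 : 1 `^ del = 1 :> R by rewrite powR1.
    rewrite -[leRHS]E1.
    by apply: le_powR2; rewrite ?ge_min ?lexx ?orbT// ltW.
move=> /choice[psi Hpsi]; exists psi; split.
- by move=> k x; have [h _ _ _ _] := Hpsi k; exact: h.
- by move=> k; have [_ h _ _ _] := Hpsi k.
- by move=> k x; have [_ _ h _ _] := Hpsi k; exact: h.
- by move=> k x; have [_ _ _ h _] := Hpsi k; exact: h.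
- by move=> k x; have [_ _ _ _ h] := Hpsi k; exact: h.
Qed.

Lemma near_diff_le (u v : X -> R) (t : R) (a b : R) :
  measurable_fun setT u -> measurable_fun setT v ->
  (\int[m \x m]_(z in near_set dist setT t) (J u z)%:E <= a%:E)%E ->
  (\int[m \x m]_(z in near_set dist setT t) (J v z)%:E <= b%:E)%E ->
  (\int[m \x m]_(z in near_set dist setT t) (J (fun x => (u x - v x)%R) z)%:E <=
   (2 `^ p * (a + b))%:E)%E.
Proof.
move=> mu mv ha hb.
have mN : measurable (near_set dist setT t) by exact: (measurable_near SS).
have Ju z := EFin_jint_ge0 SS p1 HU HK u z; have Jv z := EFin_jint_ge0 SS p1 HU HK v z.
have mJu : measurable_fun (near_set dist setT t) (fun z => (J u z)%:E).
  exact: measurable_funTS (measurable_EFin_jint p HK mu).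
have mJv : measurable_fun (near_set dist setT t) (fun z => (J v z)%:E).
  exact: measurable_funTS (measurable_EFin_jint p HK mv).
have q0 : 0 <= 2 `^ p :> R by exact: powR_ge0.
apply: (@le_trans _ _ ((2 `^ p)%:E * (\int[m \x m]_(z in near_set dist setT t) (J u z)%:E
    + \int[m \x m]_(z in near_set dist setT t) (J v z)%:E))%E); last first.
  by rewrite EFinM EFinD; apply: lee_wpmul2l; [rewrite lee_fin|exact: leeD].
have mJuv : measurable_fun (near_set dist setT t) (fun z => (J u z)%:E + (J v z)%:E)%E.
  exact: emeasurable_funD.
have Juv z : (0 <= (J u z)%:E + (J v z)%:E)%E by exact: adde_ge0.
rewrite -ge0_integralD//.
rewrite -ge0_integralZl_EFin//.
apply: ge0_le_integral_nomeas => -[x y] _; first exact: (EFin_jint_ge0 SS p1 HU HK).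
have [xy|/eqP xy] := eqVneq x y.
  by rewrite xy !jint_diag// adde0 mule0.
have K0 := kernel_gt0 SS HU HK xy.
rewrite -EFinD -EFinM lee_fin /jint /= -mulrDl mulrA.
apply: ler_wpM2r; first exact: ltW.
have := powR_normD_le (u x - u y) (- (v x - v y)) (ltW p1).
by rewrite normrN (_ : u x - v x - (u y - v y) = u x - u y + - (v x - v y)); last by ring.
Qed.

Lemma FJ_E1_bound (w : X -> R) (t B b F : R) : measurable_fun setT w ->
  (\int[m]_x (`|w x| `^ p)%:E <= B%:E)%E ->
  (\int[m \x m]_(z in near_set dist setT t) (J w z)%:E <= b%:E)%E ->
  (\int[m \x m]_(z in far_set dist setT t) (J w z)%:E <= F%:E)%E ->
  FJ m p K w /\ E1 m p (EJ m p K) w <= B + b + F.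
Proof.
move=> mw hB hb hF.
have G : (GammaJ m p K w setT <= (b + F)%:E)%E.
  apply: le_trans (GammaJ_near_far SS p1 HU HK t mw measurableT) _.
  by rewrite EFinD; exact: leeD.
have lw : Lp_fun m p w by split => //; exact: (le_lt_trans hB (ltry _)).
split; first by split => //; exact: (le_lt_trans G (ltry _)).
have G0 : (0 <= GammaJ m p K w setT)%E.
  rewrite (GammaJTE SS p1 HU HK mw); apply: integral_ge0 => z _; exact: (EFin_jint_ge0 SS p1 HU HK).
have E : EJ m p K w <= b + F.
  rewrite -lee_fin /EJ fineK// ge0_fin_numE//; exact: (le_lt_trans G (ltry _)).
have P : Lp_pow m p w <= B by rewrite -lee_fin -(Lp_powE lw).
by rewrite /E1; move: E P; lra.
Qed.

Lemma near_sum_overlap (e t : R) (N : R -> R) (c : nat -> X) (s : pred nat) (f : X -> R) :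
  (forall L, 0 <= N L) ->
  (forall L x n, 0 <= L -> \sum_(i < n | s i && (dist (c i) x < L * e)) 1 <= N L) ->
  measurable_fun setT f ->
  (\sum_(k <oo) \int[m \x m]_(z in near_set dist (net_ball dist e c s 1 k) t) (J f z)%:E <=
   (N 1)%:E * \int[m \x m]_(z in near_set dist setT t) (J f z)%:E)%E.
Proof.
move=> N0 ovl mf.
have mN k : measurable (near_set dist (net_ball dist e c s 1 k) t).
  by apply: (measurable_near SS); exact: (measurable_net_ball SS).
have mT : measurable (near_set dist setT t) by exact: (measurable_near SS).
pose g (z : X * X) := (((fun z => (J f z)%:E) \_ (near_set dist setT t)) z).
have g0 z : (0 <= g z)%E.
  by rewrite /g patchE; case: ifP => // _; exact: (EFin_jint_ge0 SS p1 HU HK).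
have mg : measurable_fun setT g.
  by apply/(measurable_restrictT _ mT); exact: measurable_funTS (measurable_EFin_jint p HK mf).
have cnt (z : X * X) n : \sum_(i < n) \1_(near_set dist (net_ball dist e c s 1 i) t) z <= N 1 :> R.
  apply: le_trans (ovl 1 z.1 n ler01); rewrite [leRHS]big_mkcond; apply: ler_sum => i _.
  rewrite indicE /near_set /net_ball; case: (s i) => /=.
    case: ifPn => [_|/negP h]; first by rewrite lern1 leq_b1.
    by rewrite memNset// => -[].
  by rewrite memNset// => -[].
have -> : (\int[m \x m]_(z in near_set dist setT t) (J f z)%:E =
    \int[m \x m]_z g z)%E by rewrite integral_mkcond.
apply: le_trans (integral_overlap (m \x m)%E (N0 1) mN mg g0 cnt).
apply: lee_nneseries => k *; first by
  apply: integral_ge0 => z _; exact: (EFin_jint_ge0 SS p1 HU HK).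
rewrite le_eqVlt; apply/orP; left; apply/eqP; apply: eq_integral => z /[!inE] -[_ zt].
by rewrite /g patchE mem_set.
Qed.

Lemma exists_values (H : R) : 0 <= H ->
  exists C : R, 0 < C /\
  forall (e : R) (N : R -> R) (c : nat -> X) (s : pred nat) (f : X -> R),
  0 < e -> (forall L, 0 <= N L) ->
  (forall L x n, 0 <= L -> \sum_(i < n | s i && (dist (c i) x < L * e)) 1 <= N L) ->
  measurable_fun setT f ->
  exists a : nat -> R,
   (\sum_(k <oo) net_osc dist m p e H c s f a k <=
   (C * U e * N 1)%:E * \int[m \x m]_(z in near_set dist setT ((H + 4) * e)) (J f z)%:E)%E.
Proof.
move=> H0; have L1 : 1 <= H + 3 by lra.
have [C [C0 HC]] := exists_good_value SS VDm p1 HU HK L1.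
exists C; split => // e N c s f e0 N0 ovl mf.
have [a Ha] := choice (fun k => HC f (c k) e mf e0).
have [_ _ U0 _ _] := HU.
have q0 : 0 <= C * U e by rewrite mulr_ge0// ltW// U0.
exists a; rewrite EFinM -muleA.
apply: le_trans (lee_wpmul2l _ (near_sum_overlap ((H + 4) * e) N0 ovl mf)); last by rewrite lee_fin.
rewrite -nneseriesZl; last by
  move=> k _; apply: integral_ge0 => z _; exact: (EFin_jint_ge0 SS p1 HU HK).
apply: lee_nneseries => k *; first exact: net_osc_ge0.
rewrite /net_osc /net_ball; case: (s k).
  by rewrite mul1r; have := Ha k; rewrite (_ : H + 3 + 1 = H + 4)//; ring.
rewrite integral_set0; apply: mule_ge0; first by rewrite lee_fin.
by apply: integral_ge0 => z _; exact: (EFin_jint_ge0 SS p1 HU HK).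
Qed.

Lemma energy_density (f : X -> R) (eta : R) :
  CE_strong dist m (FJ m p K) (GammaJ m p K) U -> FJ m p K f -> 0 < eta ->
  exists g, FJ m p K g /\ Cc dist g /\ E1 m p (EJ m p K) (fun x => f x - g x) < eta.
Proof.
move=> CE Ff eta0.
have [H [Cc [H0 Cc0 Hpsi]]] := cutoff_family CE.
have [C [C0 Ha]] := exists_values H0.
have [Cf [Cf0 Hfar]] := far_Lp SS VDm p1 HU HK.
have [N [N0 Hnet]] := exists_net SS VDm.
have [_ _ U0 _ _] := HU.
have [CU1 b10 _ HU1 _] := HU.
have [lf Gf] := Ff; have [mf _] := lf.
pose q := jump_const p H Cc N * (1 + 2 * N (H + 2)).
have q0 : 0 <= q.
  rewrite /q mulr_ge0 ?jump_const_ge0// addr_ge0// mulr_ge0//; exact: N0.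
pose A := 2 `^ p * q + Cf.
have A0 : 0 <= A := addr_ge0 (mulr_ge0 (powR_ge0 _ _) q0) (ltW Cf0).
pose M := 2 `^ p + (CU * U 1 + A) * (C * N 1).
have CUU0 : 0 <= CU * U 1 by exact: mulr_ge0 (le_trans ler01 CU1) (ltW (U0 _ ltr01)).
have CN0 : 0 <= C * N 1 := mulr_ge0 (ltW C0) (N0 1).
have M0 : 0 <= M := addr_ge0 (powR_ge0 _ _) (mulr_ge0 (addr_ge0 CUU0 A0) CN0).
(* The total error will be at most [M * del + tau * (1 + A / U e)], each term taking half of [eta].
   [M] is free of the mesh, since [e <= 1] bounds [U e] by [CU * U 1]. *)
pose del := eta / 2 / (M + 1).
have del0 : 0 < del by rewrite /del !divr_gt0// ltr_wpDl.
have [t [t0 Ht]] := near_energy_small SS p1 HU HK Ff del0.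
(* The choice of values uses jumps of [f] up to length [(H + 4) * e]; these must lie below the
   threshold [t]. *)
pose e := Num.min 1 (t / (H + 4)).
have H40 : 0 < H + 4 by rewrite ltr_wpDl.
have e0 : 0 < e by rewrite lt_min ltr01 divr_gt0.
have e1 : e <= 1 by rewrite ge_min lexx.
have et : (H + 4) * e <= t.
  by rewrite mulrC -ler_pdivlMr// ge_min lexx orbT.
have Ue := U0 _ e0.
have UeU1 : U e <= CU * U 1.
  apply: le_trans (HU1 _ _ e0 e1); rewrite ler_peMr ?(ltW Ue)//.
  have E1 : 1 `^ b1 = 1 :> R by rewrite powR1.
  by rewrite -[leLHS]E1; apply: le_powR2; rewrite ?(ltW b10)// ler_pdivlMr// mul1r.
have [c [s [cov ovl]]] := Hnet e e0.
have [a HOS] := Ha e N c s f e0 N0 ovl mf.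
have [psi [psi01 dpsi psi1 psi0 psiE]] := Hpsi e c s e0.
have mpsi k := measurable_fun_dcontinuous SS (dpsi k).
(* The unpainted mass enters the energy through [A / U e], so its tolerance, and with it the number
   of layers, depends on the mesh. *)
pose tau := eta / 2 / (1 + A / U e).
have AU0 : 0 <= A / U e by rewrite divr_ge0 ?(ltW Ue).
have tau0 : 0 < tau by rewrite /tau !divr_gt0// ltr_pwDl.
have [n Hn] := net_tail_small N0 ovl lf tau0.
have Jf z := EFin_jint_ge0 SS p1 HU HK f z.
have near_t (r : R) : r <= t ->
    (\int[m \x m]_(z in near_set dist setT r) (J f z)%:E <= del%:E)%E.
  move=> rt; apply: le_trans (ltW Ht); apply: integral_setS => // z [zA zr].
  by split => //; exact: lt_le_trans rt.
have eL : e <= t by apply: le_trans et; rewrite ler_peMl ?(ltW e0)//; move: H0; lra.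
pose B := C * U e * N 1 * del + tau.
have hS : (\sum_(k <oo) net_osc dist m p e H c s f a k + net_tail dist m p e c s f n <= B%:E)%E.
  rewrite /B EFinD; apply: leeD; last exact: ltW Hn.
  apply: le_trans HOS _; rewrite [leRHS]EFinM.
  have h0 : 0 <= C * U e * N 1 by rewrite !mulr_ge0 ?N0 ?(ltW C0) ?(ltW Ue).
  by apply: lee_wpmul2l; [rewrite lee_fin|exact: near_t].
pose v := painter psi a n; pose w x := f x - v x.
have mv : measurable_fun setT v by exact: measurable_painter.
have mw : measurable_fun setT w by exact: measurable_funB.
have hB : (\int[m]_x (`|w x| `^ p)%:E <= B%:E)%E.
  exact: le_trans (painter_Lp_le SS p1 e0 cov psi01 psi1 psi0 a mf n) hS.
have hv : (\int[m \x m]_(z in near_set dist setT e) (J v z)%:E <= (q / U e * B)%:E)%E.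
  apply: le_trans (painter_near_le SS p1 HU HK e0 H0 Cc0 N0 cov ovl psi01 mpsi
    psi1 psi0 psiE a mf n) _.
  rewrite (_ : jump_const p H Cc N / U e * (1 + 2 * N (H + 2)) = q / U e); last by rewrite /q; ring.
  by rewrite [leRHS]EFinM; apply: lee_wpmul2l => //; rewrite lee_fin divr_ge0// ltW.
have hw := near_diff_le mf mv (near_t e eL) hv.
have hF : (\int[m \x m]_(z in far_set dist setT e) (J w z)%:E <= (Cf / U e * B)%:E)%E.
  apply: le_trans (Hfar w e e0 mw) _.
  by rewrite [leRHS]EFinM; apply: lee_wpmul2l => //; rewrite lee_fin divr_ge0 ?ltW.
have [Fw Ew] := FJ_E1_bound mw hB hw hF.
exists v; split; last split.
(* The bounds show that the error [w] has finite energy; hence so has [v = f - w]. *)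
- have := FJB SS p1 HU HK Ff Fw; congr FJ; apply/funext => x; rewrite /w; ring.
(* Each summand bounds the reach of one layer from [c 0], and the sum bounds them all. *)
- pose r := \sum_(k < n) (dist (c 0%N) (c k) + H * e).
  apply: (@Cc_bounded_support _ _ _ dist m SS v (c 0%N) (r + 1)); first exact: dcontinuous_painter.
  move=> x vx; rewrite /dball/=.
  have [k [kn pk]] : exists k, (k < n)%N /\ psi k x != 0.
    apply: contrapT => h; move/eqP : vx; apply; apply: painter_eq0 => k kn.
    by apply/eqP; apply: contrapT => /negP pk; apply: h; exists k.
  have [_ ck] := psi0 k x pk.
  apply: le_lt_trans (mdist_tri SS (c k) _ _) _.
  rewrite ltr_pwDr//.
  apply: le_trans (_ : dist (c 0%N) (c k) + H * e <= _); first by rewrite lerD2l ltW.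
  rewrite /r (bigD1 (Ordinal kn))//= lerDl; apply: sumr_ge0 => i _.
  by rewrite addr_ge0 ?(mdist_ge0 SS)// mulr_ge0// ltW.
apply: le_lt_trans Ew _.
have -> : B + 2 `^ p * (del + q / U e * B) + Cf / U e * B = B * (1 + A / U e) + 2 `^ p * del.
  by rewrite /A; field; rewrite gt_eqF.
have -> : B * (1 + A / U e) = (U e + A) * (C * N 1) * del + tau * (1 + A / U e).
  by rewrite /B; field; rewrite gt_eqF.
have -> : tau * (1 + A / U e) = eta / 2 by rewrite /tau divfK// gt_eqF// ltr_pwDl.
have h1 : (U e + A) * (C * N 1) * del <= (CU * U 1 + A) * (C * N 1) * del.
  by rewrite ler_pM2r// ler_wpM2r// lerD2r.
have h2 : (CU * U 1 + A) * (C * N 1) * del + 2 `^ p * del < eta / 2.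
  rewrite -mulrDl addrC -/M /del mulrA ltr_pdivrMr ?ltr_wpDl//.
  by rewrite mulrC ltr_pM2l ?divr_gt0// ltrDl.
by move: h1 h2; set x1 := (_ * del); set x2 := (_ * del); set x3 := (_ * del); lra.
Qed.

End energy_density.

Section regular_transfer.
Context {R : realType} {d0 : measure_display} {X : measurableType d0}.
Variables (dist : X -> X -> R) (m : {sigma_finite_measure set X -> \bar R}).
Hypothesis SS : standing_setting dist m.
Hypothesis VDm : VD dist m.
Variables (p : R) (U Psi : R -> R) (K : X -> X -> R).
Hypothesis p1 : 1 < p.

(** The inclusion of [F] in the jump domain carries over density in [L^p] and uniform density in
    [Cc]. Energy density is not inherited in this way, as [F] approximates only its own members; it
    comes from the transferred cutoff condition. *)
Lemma transfer_regular_penergy (CU b1 b2 CP a1 a2 : R) (F : set (X -> R)) (E : (X -> R) -> R)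
    (G : (X -> R) -> set X -> \bar R) :
  scale_bounds U CU b1 b2 -> scale_bounds Psi CP a1 a2 -> jump_kernel dist m U K ->
  near_dominated dist m p U K Psi F G ->
  (forall f, F f -> (G f setT < +oo)%E) ->
  is_regular_penergy dist m p F E -> CE_strong dist m F G Psi ->
  is_regular_penergy dist m p (FJ m p K) (EJ m p K) /\
  CE_strong dist m (FJ m p K) (GammaJ m p K) U.
Proof.
move=> HU HP HK ND HG [[[HF _] [dense _]] [unif _]] CE.
have FFJ := transfer_domain SS VDm p1 HU HK HP ND HF HG.
have CEJ := transfer_CE SS VDm p1 HU HK HP ND HF HG CE.
split; last exact: CEJ.
split.
  apply: (is_penergy_jump SS p1 HU HK) => f lf e e0.
  by have [g [Fg fg]] := dense f lf e e0; exists g; split; [exact: FFJ|exact: fg].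
split.
  move=> f Cf e e0; have [g [Fg gh]] := unif f Cf e e0.
  by exists g; split; [exact: FFJ|exact: gh].
by move=> f Ff e e0; exact: (energy_density SS VDm p1 HU HK CEJ Ff e0).
Qed.

End regular_transfer.

(** Packs sigma-finiteness into the type of the measure, as product measures require. The equality
    of measures lets the bare measure of the theorem be replaced by substitution. *)
Lemma sigma_finite_extension {d : measure_display} {T : measurableType d} {R : realType}
    (mu : {measure set T -> \bar R}) : sigma_finite setT mu ->
  exists nu : {sigma_finite_measure set T -> \bar R}, nu = mu :> {measure set T -> \bar R}.
Proof.
move=> sf; have sfin : sfinite_measure mu by exact: sfinite_measure_sigma_finite.
pose nu : {sigma_finite_measure set T -> \bar R} :=
  HB.pack_for (sigma_finite_measure T R) (Measure.sort mu)
    (@isSFinite.Build _ _ _ mu sfin) (@isSigmaFinite.Build _ _ _ mu sf).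
by exists nu; apply: eq_measure.
Qed.

Theorem mainTheorem5 (R : realType) (d0 : measure_display) (X : measurableType d0)
    (dist : X -> X -> R) (m : {measure set X -> \bar R}) (p : R) :
  1 < p ->
  standing_setting dist m ->
  VD dist m ->
  (* (a) *)
  (forall (Psi Ups : R -> R) (FL : set (X -> R)) (EL : (X -> R) -> R)
          (GL : (X -> R) -> {measure set X -> \bar R}) (K : X -> X -> R),
     is_regular_penergy dist m p FL EL ->
     strongly_local dist m FL EL ->
     is_canonical_energy_measure dist m p FL EL GL ->
     doubling_fun Psi ->
     PI_L dist m p FL GL Psi ->
     CE_strong dist m FL (fun f A => GL f A) Psi ->
     doubling_fun Ups ->
     SUG Ups Psi ->
     jump_kernel dist m Ups K ->
     is_regular_penergy dist m p (FJ m p K) (EJ m p K) /\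
     CE_strong dist m (FJ m p K) (GammaJ m p K) Ups) /\
  (* (b) *)
  (forall (Psi Ups : R -> R) (KPsi KUps : X -> X -> R),
     doubling_fun Psi ->
     jump_kernel dist m Psi KPsi ->
     is_regular_penergy dist m p (FJ m p KPsi) (EJ m p KPsi) ->
     CE_strong dist m (FJ m p KPsi) (GammaJ m p KPsi) Psi ->
     doubling_fun Ups ->
     UG Ups Psi ->
     jump_kernel dist m Ups KUps ->
     is_regular_penergy dist m p (FJ m p KUps) (EJ m p KUps) /\
     CE_strong dist m (FJ m p KUps) (GammaJ m p KUps) Ups).
Proof.
move=> p1 SS VDm; have [m' mE] := sigma_finite_extension (standing_sigma_finite SS).
subst m; rename m' into m.
split.
  move=> Psi Ups FL EL GL K rE _ [_ [GT _]] /doubling_scale_bounds[CP [a1 [a2 HP]]] PI CE.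
  move=> /doubling_scale_bounds[CU [b1 [b2 HU]]] sug HK.
  have HF f : FL f -> Lp_fun m p f by case: rE => [[[h _] _] _]; exact: h.
  apply: (transfer_regular_penergy SS VDm p1 HU HP HK _ _ rE CE).
    exact: (near_dominated_poincare SS VDm p1 HU HK HP HF PI sug).
  by move=> f Ff; rewrite GT// ltry.
move=> Psi Ups KP K /doubling_scale_bounds[CP [a1 [a2 HP]]] HKP rE CE.
move=> /doubling_scale_bounds[CU [b1 [b2 HU]]] ug HK.
apply: (transfer_regular_penergy SS VDm p1 HU HP HK _ _ rE CE).
  exact: (near_dominated_jump SS p1 HU HK HP HKP ug).
by move=> f [].
Qed.
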